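(* Let $I$ be a small category and let $D\colon I\to\mathrm{Top}$ be a diagram of topological spaces. Then the homotopy colimits of $D$ as computed in $\mathrm{Top}$ and in $\mathrm{Top}^S$ have the same weak homotopy type.
   Context: $\mathrm{Top}$ is the category of all topological spaces with its usual model structure (weak equivalences are weak homotopy equivalences, fibrations are Serre fibrations). $\mathrm{Top}^S$ is the same category with the Strom model structure: weak equivalences are homotopy equivalences, fibrations are Hurewicz fibrations, and cofibrations are determined by the lifting property (every object is cofibrant). The homotopy colimit in a model category is the left derived functor of $\operatorname{colim}$ with respect to objectwise weak equivalences of diagrams: it is obtained by first functorially replacing the objects of the diagram by cofibrant ones and then taking the geometric realization of the simplicial replacement, where the simplicial replacement of $D$ is the simplicial space $[n]\mapsto\coprod_{i_0\to\cdots\to i_n}D(i_0)$, the coproduct running over chains of $n$ composable maps in $I$. In particular, in $\mathrm{Top}^S$ no cofibrant replacement is needed: the homotopy colimit there is the realization of the simplicial replacement of $D$ itself. *)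

(* Defs.v *)
From HB Require Import structures.
From Stdlib Require Import Relations.
From mathcomp Require Import all_boot all_order all_algebra generic_quotient.
From mathcomp Require Import all_classical all_reals topology normedtype.

Set Implicit Arguments.
Unset Strict Implicit.
Unset Printing Implicit Defensive.

Import Order.TTheory GRing.Theory Num.Theory.
Import numFieldNormedType.Exports.

Local Open Scope classical_set_scope.
Local Open Scope ring_scope.
Local Open Scope quotient_scope.

Definition comp_cts {X Y Z : topologicalType} (g : continuousType Y Z)
  (f : continuousType X Y) : continuousType X Z := g \o f.

Definition id_cts (X : topologicalType) : continuousType X X := @idfun X.

Lemma pair_continuous {X Y Z : topologicalType} (f : X -> Y) (g : X -> Z) :
  continuous f -> continuous g -> continuous (fun x => (f x, g x)).
Proof.
move=> cf cg x; have fx := cf x; have gx := cg x.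
exact: (@cvg_pair _ _ _ _ (nbhs (f x)) (nbhs (g x)) _ _ _ f g).
Qed.

Lemma fst_continuous {X Y : topologicalType} : continuous (@fst X Y).
Proof. by move=> [x y]; exact: cvg_fst. Qed.

Lemma snd_continuous {X Y : topologicalType} : continuous (@snd X Y).
Proof. by move=> [x y]; exact: cvg_snd. Qed.

Section Homotopy.
Context (R : realType).

Definition unit_interval : topologicalType := set_type (`[0, 1]%classic : set R).

Lemma unit_interval0 : (0 : R) \in (`[0, 1]%classic : set R).
Proof. by rewrite inE /= in_itv /= lexx ler01. Qed.

Lemma unit_interval1 : (1 : R) \in (`[0, 1]%classic : set R).
Proof. by rewrite inE /= in_itv /= lexx ler01. Qed.

Definition I0 : unit_interval := exist _ 0 unit_interval0.
Definition I1 : unit_interval := exist _ 1 unit_interval1.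

Definition cylinder (X : topologicalType) : topologicalType :=
  (X * unit_interval)%type.

Definition homotopic_rel {X Y : topologicalType} (A : set X)
    (f g : continuousType X Y) : Prop :=
  exists H : continuousType (cylinder X) Y,
    [/\ forall x, H (x, I0) = f x,
        forall x, H (x, I1) = g x
      & forall x t, A x -> H (x, t) = f x].

Definition homotopic {X Y : topologicalType} (f g : continuousType X Y) : Prop :=
  homotopic_rel set0 f g.

Definition homotopy_equivalence {X Y : topologicalType}
    (f : continuousType X Y) : Prop :=
  exists g : continuousType Y X,
    homotopic (comp_cts g f) (id_cts X) /\ homotopic (comp_cts f g) (id_cts Y).

Definition path_joined {X : topologicalType} (x y : X) : Prop :=
  exists p : continuousType unit_interval X, p I0 = x /\ p I1 = y.

Definition cube (n : nat) : topologicalType :=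
  set_type [set s : 'rV[R]_n | forall i, 0 <= s ord0 i <= 1].

Definition cube_val (n : nat) (s : cube n) : 'rV[R]_n := set_val s.

Definition cube_boundary (n : nat) : set (cube n) :=
  [set s | exists i, cube_val s ord0 i = 0 \/ cube_val s ord0 i = 1].

(* Representatives of the elements of pi_n(X, x0), two of them being
   identified when they are homotopic relative to the boundary. *)
Definition based_map (X : topologicalType) (x0 : X) (n : nat) : Type :=
  {a : continuousType (cube n) X | forall s, cube_boundary s -> a s = x0}.

Definition based_homotopic {X : topologicalType} {x0 : X} {n : nat}
    (a b : based_map x0 n) : Prop :=
  homotopic_rel (@cube_boundary n) (sval a) (sval b).

Lemma based_push_subproof {X Y : topologicalType} (f : continuousType X Y)
    (x0 : X) (n : nat) (a : based_map x0 n) s :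
  cube_boundary s -> comp_cts f (sval a) s = f x0.
Proof. by move=> bs /=; rewrite (svalP a). Qed.

Definition based_push {X Y : topologicalType} (f : continuousType X Y)
    {x0 : X} {n : nat} (a : based_map x0 n) : based_map (f x0) n :=
  exist _ (comp_cts f (sval a)) (based_push_subproof f a).

(* The map A/eA -> B/eB induced by F is a bijection. *)
Definition bijective_on_classes {A B : Type} (eA : A -> A -> Prop)
    (eB : B -> B -> Prop) (F : A -> B) : Prop :=
  (forall a a', eB (F a) (F a') -> eA a a') /\ (forall b, exists a, eB (F a) b).

(* The maps induced on pi_n, n > 0, are group morphisms, hence isomorphisms as
   soon as they are bijective.  As pi_0 is handled without a basepoint, the map
   from the empty space to a nonempty one is not an equivalence. *)
Definition weak_homotopy_equivalence {X Y : topologicalType}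
    (f : continuousType X Y) : Prop :=
  bijective_on_classes (@path_joined X) (@path_joined Y) f /\
  forall (n : nat) (x0 : X), (0 < n)%N ->
    bijective_on_classes (@based_homotopic X x0 n) (@based_homotopic Y (f x0) n)
      (based_push f).

Definition same_weak_homotopy_type : topologicalType -> topologicalType -> Prop :=
  clos_refl_sym_trans topologicalType
    (fun X Y => exists f : continuousType X Y, weak_homotopy_equivalence f).

Definition homotopy_lifting (A E B : topologicalType)
    (p : continuousType E B) : Prop :=
  forall (g : continuousType A E) (h : continuousType (cylinder A) B),
    (forall a, p (g a) = h (a, I0)) ->
    exists H : continuousType (cylinder A) E,
      (forall a, H (a, I0) = g a) /\ (forall z, p (H z) = h z).

Definition Hurewicz_fibration {E B : topologicalType}
    (p : continuousType E B) : Prop :=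
  forall A : topologicalType, homotopy_lifting A p.

Definition Serre_fibration {E B : topologicalType}
    (p : continuousType E B) : Prop :=
  forall n : nat, homotopy_lifting (cube n) p.

End Homotopy.

(* The data determining a model structure on the category of topological
   spaces, its cofibrations being the maps with the left lifting property with
   respect to the trivial fibrations. *)
Record model_data := ModelData {
  weq : forall X Y : topologicalType, continuousType X Y -> Prop;
  fib : forall X Y : topologicalType, continuousType X Y -> Prop }.

Definition Top_Quillen (R : realType) : model_data :=
  {| weq := @weak_homotopy_equivalence R; fib := @Serre_fibration R |}.

Definition Top_Strom (R : realType) : model_data :=
  {| weq := @homotopy_equivalence R; fib := @Hurewicz_fibration R |}.

Definition left_lifting {A B E C : topologicalType}
    (i : continuousType A B) (p : continuousType E C) : Prop :=
  forall (u : continuousType A E) (v : continuousType B C),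
    (forall a, p (u a) = v (i a)) ->
    exists h : continuousType B E,
      (forall a, h (i a) = u a) /\ (forall b, p (h b) = v b).

Definition cofibration (M : model_data) {A B : topologicalType}
    (i : continuousType A B) : Prop :=
  forall (E C : topologicalType) (p : continuousType E C),
    fib M p -> weq M p -> left_lifting i p.

Definition empty_space : topologicalType := discrete_topology void.

Definition from_empty_fun (X : topologicalType) (x : empty_space) : X :=
  of_void X x.

Lemma from_empty_continuous (X : topologicalType) :
  continuous (@from_empty_fun X).
Proof. by case. Qed.

Definition from_empty (X : topologicalType) : continuousType empty_space X :=
  mkcts (@from_empty_continuous X).

Definition cofibrant (M : model_data) (X : topologicalType) : Prop :=
  cofibration M (from_empty X).

Record top_functor := TopFunctor {
  fobj :> topologicalType -> topologicalType;
  fmap : forall X Y : topologicalType,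
    continuousType X Y -> continuousType (fobj X) (fobj Y);
  fmap_id : forall X : topologicalType, fmap (id_cts X) = id_cts (fobj X);
  fmap_comp : forall (X Y Z : topologicalType) (g : continuousType Y Z)
      (f : continuousType X Y),
    fmap (comp_cts g f) = comp_cts (fmap g) (fmap f) }.

Record cofibrant_replacement (M : model_data) := CofibrantReplacement {
  crep :> top_functor;
  crep_map : forall X : topologicalType, continuousType (crep X) X;
  crep_natural : forall (X Y : topologicalType) (f : continuousType X Y),
    comp_cts (crep_map Y) (fmap crep f) = comp_cts f (crep_map X);
  crep_weq : forall X : topologicalType, weq M (crep_map X);
  crep_cofibrant : forall X : topologicalType, cofibrant M (crep X) }.

Section StromReplacement.
Context (R : realType).

Lemma homotopy_equivalence_id (X : topologicalType) :
  homotopy_equivalence R (id_cts X).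
Proof.
exists (id_cts X); split;
  by exists (mkcts (@fst_continuous X (unit_interval R))).
Qed.

Lemma Strom_cofibrant (X : topologicalType) : cofibrant (Top_Strom R) X.
Proof.
move=> E B p pfib [g [_ [H [H0 H1 _]]]] u v _.
pose vI (z : cylinder R X) : cylinder R B := (v z.1, z.2).
have cvI : continuous vI.
  apply: pair_continuous; last exact: snd_continuous.
  by move=> z; apply: continuous_comp; [exact: fst_continuous|exact: cts_fun].
pose h := comp_cts H (mkcts cvI).
have gh x : p (comp_cts g v x) = h (x, I0 R) by rewrite /= /mkcts /vI /= H0.
have [G [_ G1]] := pfib X (comp_cts g v) h gh.
pose e (x : X) : cylinder R X := (x, I1 R).
have ce : continuous e.
  by apply: pair_continuous => x; [exact: cvg_id|exact: cvg_cst].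
exists (comp_cts G (mkcts ce)); split=> [[]//|b].
by rewrite /= /mkcts G1 /= /mkcts /vI /= H1.
Qed.

Definition id_top_functor : top_functor :=
  @TopFunctor id (fun _ _ f => f) (fun _ => erefl) (fun _ _ _ _ _ => erefl).

Lemma id_natural (X Y : topologicalType) (f : continuousType X Y) :
  comp_cts (id_cts Y) (fmap id_top_functor f) = comp_cts f (id_cts X).
Proof. by apply/continuousEP. Qed.

(* Every object of the Strom model structure being cofibrant, the identity is a
   cofibrant replacement there. *)
Definition Strom_id_replacement : cofibrant_replacement (Top_Strom R) :=
  @CofibrantReplacement (Top_Strom R) id_top_functor id_cts id_natural
    homotopy_equivalence_id Strom_cofibrant.

End StromReplacement.

Record small_category := SmallCategory {
  ob :> Type;
  hom : ob -> ob -> Type;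
  idm : forall i, hom i i;
  compm : forall i j k, hom j k -> hom i j -> hom i k;
  compm1 : forall i j (f : hom i j), compm f (idm i) = f;
  comp1m : forall i j (f : hom i j), compm (idm j) f = f;
  compmA : forall i j k l (h : hom k l) (g : hom j k) (f : hom i j),
    compm h (compm g f) = compm (compm h g) f }.

Record diagram (I : small_category) := Diagram {
  dobj :> I -> topologicalType;
  dmap : forall i j : I, hom i j -> continuousType (dobj i) (dobj j);
  dmap_id : forall i : I, dmap (idm i) = id_cts (dobj i);
  dmap_comp : forall (i j k : I) (g : hom j k) (f : hom i j),
    dmap (compm g f) = comp_cts (dmap g) (dmap f) }.

Section PostComposition.
Context (I : small_category) (F : top_functor) (D : diagram I).

Lemma post_comp_id (i : I) : fmap F (dmap D (idm i)) = id_cts (F (D i)).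
Proof. by rewrite dmap_id fmap_id. Qed.

Lemma post_comp_comp (i j k : I) (g : hom j k) (f : hom i j) :
  fmap F (dmap D (compm g f)) =
  comp_cts (fmap F (dmap D g)) (fmap F (dmap D f)).
Proof. by rewrite dmap_comp fmap_comp. Qed.

Definition post_comp : diagram I :=
  @Diagram I (fun i => F (D i)) (fun i j f => fmap F (dmap D f))
    post_comp_id post_comp_comp.

End PostComposition.

(* Morphisms [m] -> [n] of the simplex category, [n] being the ordinal
   {0 < ... < n}. *)
Record ord_map (m n : nat) := OrdMap {
  omap :> 'I_m.+1 -> 'I_n.+1;
  omap_homo : forall i j : 'I_m.+1, (i <= j)%N -> (omap i <= omap j)%N }.

Definition ord_map_id (n : nat) : ord_map n n :=
  @OrdMap n n id (fun _ _ h => h).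

Definition ord_map_comp (m n p : nat) (b : ord_map n p) (a : ord_map m n) :
    ord_map m p :=
  @OrdMap m p (b \o a) (fun _ _ h => omap_homo b (omap_homo a h)).

Record simplicial_space := SimplicialSpace {
  sspace :> nat -> topologicalType;
  sact : forall m n : nat, ord_map m n -> continuousType (sspace n) (sspace m);
  sact_id : forall n, sact (ord_map_id n) = id_cts (sspace n);
  sact_comp : forall (m n p : nat) (b : ord_map n p) (a : ord_map m n),
    sact (ord_map_comp b a) = comp_cts (sact a) (sact b) }.

Section Realization.
Context (R : realType).

Definition std_simplex (n : nat) : topologicalType :=
  set_type [set t : 'rV[R]_n.+1 |
    (forall i, 0 <= t ord0 i) /\ \sum_i t ord0 i = 1].

Definition simplex_val (n : nat) (t : std_simplex n) : 'rV[R]_n.+1 := set_val t.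

Definition simplex_push_fun (m n : nat) (a : ord_map m n)
    (t : 'rV[R]_m.+1) : 'rV[R]_n.+1 :=
  \row_j \sum_(i | a i == j) t ord0 i.

Lemma simplex_push_subproof (m n : nat) (a : ord_map m n) (t : std_simplex m) :
  simplex_push_fun a (simplex_val t) \in
    [set t : 'rV[R]_n.+1 | (forall i, 0 <= t ord0 i) /\ \sum_i t ord0 i = 1].
Proof.
have [t0 t1] := set_valP t; rewrite inE; split=> [j|].
  by rewrite mxE; apply: sumr_ge0 => i _; exact: t0.
under eq_bigr do rewrite mxE.
by rewrite -t1 [RHS](partition_big a xpredT).
Qed.

Definition simplex_push (m n : nat) (a : ord_map m n) (t : std_simplex m) :
    std_simplex n :=
  exist _ (simplex_push_fun a (simplex_val t)) (simplex_push_subproof a t).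

Section Quotient.
Context (X : simplicial_space).

Definition realization_total : topologicalType :=
  {n : nat & (X n * std_simplex n)%type}.

Definition realization_pt (n : nat) (x : X n) (t : std_simplex n) :
    realization_total :=
  existT (fun n => (X n * std_simplex n)%type) n (x, t).

Variant realization_step : realization_total -> realization_total -> Prop :=
  RealizationStep (m n : nat) (a : ord_map m n) (x : X n) (t : std_simplex m) :
    realization_step (realization_pt (sact X a x) t)
                     (realization_pt x (simplex_push a t)).

Definition realization_rel : rel realization_total :=
  fun u v => `[< clos_refl_sym_trans realization_total realization_step u v >].

Lemma realization_rel_refl : reflexive realization_rel.
Proof. by move=> u; apply/asboolP; exact: rst_refl. Qed.

Lemma realization_rel_sym : symmetric realization_rel.
Proof. by move=> u v; apply: asbool_equiv_eq; split; exact: rst_sym. Qed.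

Lemma realization_rel_trans : transitive realization_rel.
Proof.
by move=> v u w /asboolP uv /asboolP vw; apply/asboolP; exact: rst_trans uv vw.
Qed.

Canonical realization_equiv :=
  EquivRel realization_rel realization_rel_refl realization_rel_sym
    realization_rel_trans.

Definition realization : topologicalType :=
  quotient_topology {eq_quot realization_equiv}.

End Quotient.
End Realization.

Section SimplicialReplacement.
Context (I : small_category) (D : diagram I).

(* A chain i_0 -> ... -> i_n of composable maps, encoded together with all the
   composites i_j -> i_k for j <= k, that is, as a functor from the ordinal [n]
   to I; it is determined by its maps i_j -> i_(j+1), which are arbitrary. *)
Record chain (n : nat) := Chain {
  vertex : 'I_n.+1 -> I;
  edge : forall j k : 'I_n.+1, (j <= k)%N -> hom (vertex j) (vertex k);
  edge_id : forall (j : 'I_n.+1) (h : (j <= j)%N), edge h = idm (vertex j);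
  edge_comp : forall (j k l : 'I_n.+1) (hjk : (j <= k)%N) (hkl : (k <= l)%N)
      (hjl : (j <= l)%N),
    edge hjl = compm (edge hkl) (edge hjk) }.

Definition chain_pull (m n : nat) (a : ord_map m n) (c : chain n) : chain m :=
  @Chain m (fun j => vertex c (a j))
    (fun j k h => edge c (omap_homo a h))
    (fun j h => edge_id c (omap_homo a h))
    (fun j k l hjk hkl hjl =>
       edge_comp c (omap_homo a hjk) (omap_homo a hkl) (omap_homo a hjl)).

Definition srep_space (n : nat) : topologicalType :=
  {c : {classic chain n} & D (vertex (c : chain n) ord0)}.

Definition srep_pt (n : nat) (c : chain n) (x : D (vertex c ord0)) :
    srep_space n :=
  existT (fun c : {classic chain n} => D (vertex (c : chain n) ord0)) c x.

Definition from_start (n : nat) (c : chain n) (j : 'I_n.+1) :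
    hom (vertex c ord0) (vertex c j) :=
  edge c (leq0n j : (@ord0 n <= j)%N).

Definition srep_act_fun (m n : nat) (a : ord_map m n) (u : srep_space n) :
    srep_space m :=
  srep_pt (c := chain_pull a (projT1 u))
    (dmap D (from_start (projT1 u) (a ord0)) (projT2 u)).

Lemma srep_act_continuous (m n : nat) (a : ord_map m n) :
  continuous (@srep_act_fun m n a).
Proof.
move=> [c x].
apply: (@sigT_continuous {classic chain n}
  (fun c => D (vertex (c : chain n) ord0)) (srep_space m)
  (fun c x => srep_act_fun a (srep_pt (c := c) x))) => c' x'.
apply: (continuous_comp (f := dmap D (from_start (c' : chain n) (a ord0)))
  (g := fun y => srep_pt (c := chain_pull a c') y)); first exact: cts_fun.
exact: (@existT_continuous {classic chain m}
  (fun c => D (vertex (c : chain m) ord0))).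
Qed.

Definition srep_act (m n : nat) (a : ord_map m n) :
    continuousType (srep_space n) (srep_space m) :=
  mkcts (@srep_act_continuous m n a).

Lemma srep_pt_eq (n : nat) (v : 'I_n.+1 -> I)
    (e e' : forall j k : 'I_n.+1, (j <= k)%N -> hom (v j) (v k))
    e1 ec e1' ec' (x x' : D (v ord0)) :
  (forall j k h, e j k h = e' j k h) -> x = x' ->
  srep_pt (c := @Chain n v e e1 ec) x = srep_pt (c := @Chain n v e' e1' ec') x'.
Proof.
move=> ee' <-; have {ee'} ee : e = e'.
  by do 3![apply: functional_extensionality_dep => ?].
subst e'; rewrite (Prop_irrelevance e1' e1).
by rewrite (Prop_irrelevance ec' ec).
Qed.

Lemma srep_act_id (n : nat) : srep_act (ord_map_id n) = id_cts (srep_space n).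
Proof.
apply/continuousEP => -[[v e e1 ec] x] /=; rewrite /mkcts /srep_act_fun /=.
apply: srep_pt_eq => //.
by rewrite /from_start /= e1 dmap_id.
Qed.

Lemma srep_act_comp (m n p : nat) (b : ord_map n p) (a : ord_map m n) :
  srep_act (ord_map_comp b a) = comp_cts (srep_act a) (srep_act b).
Proof.
apply/continuousEP => -[[v e e1 ec] x] /=; rewrite /mkcts /srep_act_fun /=.
apply: srep_pt_eq => //.
have /= h := ec ord0 (b ord0) (b (a ord0)) (leq0n _)
  (omap_homo b (leq0n (a ord0) : (ord0 <= a ord0)%N)) (leq0n _).
by rewrite /from_start /= h dmap_comp.
Qed.

Definition simplicial_replacement : simplicial_space :=
  @SimplicialSpace srep_space srep_act srep_act_id srep_act_comp.

End SimplicialReplacement.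

Definition hocolim (R : realType) (M : model_data)
    (Q : cofibrant_replacement M) (I : small_category) (D : diagram I) :
    topologicalType :=
  realization R (simplicial_replacement (post_comp Q D)).

(* The identity being a cofibrant replacement in Top_Strom, this is just the
   realization of the simplicial replacement of D itself. *)
Definition hocolim_Strom (R : realType) (I : small_category) (D : diagram I) :
    topologicalType :=
  hocolim R (Strom_id_replacement R) D.

Lemma hocolim_StromE (R : realType) (I : small_category) (D : diagram I) :
  hocolim_Strom R D = realization R (simplicial_replacement D).
Proof.
case: D => o d d1 dc; rewrite /hocolim_Strom /hocolim /post_comp /=.
by congr (realization R (simplicial_replacement (Diagram _ _)));
  exact: Prop_irrelevance.
Qed.

(* Main.v *)
Require Import Defs.
From Stdlib Require Import Relations Eqdep_dec.
From mathcomp Require Import all_boot all_order all_algebra generic_quotient.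
From mathcomp Require Import all_classical all_reals topology normedtype.
From mathcomp Require Import zify ring lra.

Set Implicit Arguments.
Unset Strict Implicit.
Unset Printing Implicit Defensive.

Import Order.TTheory GRing.Theory Num.Theory.
Import numFieldNormedType.Exports.

Local Open Scope classical_set_scope.
Local Open Scope ring_scope.

(** Write [f] for the map of realizations induced by Q D -> D. It is a
    weak homotopy equivalence as soon as each component Q D(i) -> D(i) is one.

    A lifting problem for f is a map of a box K to the target together with a
    lift of its restriction to the boundary up to a given homotopy; f is a weak
    equivalence iff every such problem has a solution. The realization is
    filtered by its skeleta: each chain of maps of I is either degenerate or
    not, irrespective of points of D, so that over the open n-cells the
    realization is a disjoint union of products D(i_0) x int(Delta^n), for
    arbitrary spaces D(i_0), and a compact set meets finitely many skeleta.
    Inductively on n, a map of K to the n-skeleton is subdivided into small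
    cells lying either in the open n-cells or away from the barycentres of
    these. The former are solved first, in the factors D(i_0), with fixed
    coordinates in Delta^n: the paths of the solution then never leave the second
    region where they start in it. There, pushing away from the barycentres is a
    homotopy into the (n-1)-skeleton, where the induction hypothesis applies. *)

(** * Continuity on a subset *)

(** The spaces [D i] are arbitrary, so a realization need not be Hausdorff and its points need not
    be closed. What replaces a good cell structure is that degeneracy is a clopen condition
    ([degP]): functions may be given by one formula on nondegenerate elements and another on
    degenerate ones, and closedness can be tested on reduced representatives, which are unique.

    Commutation up to a homotopy, rather than on the nose, is what survives a construction cell by
    cell: the paths found over a face are the boundary homotopy of the next problem.

    The level 1/2 only serves to make the regions [mu > 0] and [mu < 1/2] overlap while keeping the
    second one away from the barycentres, where [mu] is 1.

    Maps are total functions, continuous relative to a subset, so that boxes, faces and grid cells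
    all live in one space of row vectors; values outside the subset are arbitrary. *)

Definition cont_on {X Y : topologicalType} (A : set X) (f : X -> Y) :=
  forall x, A x -> f @ within A (nbhs x) --> f x.

Section Con.
Context {X Y Z : topologicalType}.
Implicit Types (A B : set X) (f g : X -> Y).

Lemma cont_on_sub A B f : A `<=` B -> cont_on B f -> cont_on A f.
Proof.
move=> AB cf x Ax; apply: cvg_trans (cf x (AB _ Ax)).
move=> O; rewrite /within /= !nbhs_simpl /=.
by apply: filterS => y Oy Ay; exact: Oy (AB _ Ay).
Qed.

Lemma cont_on_ext A f g : (forall x, A x -> f x = g x) -> cont_on A f -> cont_on A g.
Proof.
move=> fg cf x Ax O; rewrite -fg// => /(cf x Ax).
rewrite /within /= !nbhs_simpl /=.
by apply: filterS => y Oy Ay; rewrite /= -fg//; exact: Oy.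
Qed.

Lemma cont_on_continuous A f : continuous f -> cont_on A f.
Proof.
move=> cf x Ax O /cf; rewrite !nbhs_simpl /= /within /=.
by apply: filterS => y.
Qed.

Lemma cont_onT f : cont_on setT f -> continuous f.
Proof.
move=> cf x O /(cf x I); rewrite !nbhs_simpl /= /within /=.
by apply: filterS => y /=; apply.
Qed.

Lemma cont_on_cst A (y : Y) : cont_on A (fun=> y).
Proof. by apply: cont_on_continuous => x; exact: cvg_cst. Qed.

Lemma cont_on_pair A f (g : X -> Z) :
  cont_on A f -> cont_on A g -> cont_on A (fun x => (f x, g x)).
Proof.
move=> cf cg x Ax.
exact: (@cvg_pair _ _ _ _ (nbhs (f x)) (nbhs (g x)) _ _ _ f g (cf x Ax) (cg x Ax)).
Qed.

Lemma cont_on_glue A B f : closed A -> closed B -> cont_on A f -> cont_on B f ->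
  cont_on (A `|` B) f.
Proof.
move=> cA cB fA fB x ABx O Of.
have H (C : set X) : closed C -> cont_on C f -> \forall y \near x, C y -> O (f y).
  move=> cC fC; have [Cx|nCx] := pselect (C x).
    by have := fC x Cx O Of; rewrite !nbhs_simpl.
  have : nbhs x (~` C) by apply: open_nbhs_nbhs; split=> //; exact: closed_openC.
  by apply: filterS => y nCy /nCy.
rewrite !nbhs_simpl /= /within /=.
by apply: filterS2 (H A cA fA) (H B cB fB) => y HA HB [/HA|/HB].
Qed.

Lemma cont_on_glue2 A B f g : closed A -> closed B -> cont_on A f -> cont_on B g ->
  (forall x, A x -> B x -> f x = g x) ->
  cont_on (A `|` B) (fun x => if pselect (A x) then f x else g x).
Proof.
move=> cA cB fA gB fg; apply: cont_on_glue => //.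
  by apply: cont_on_ext fA => x Ax; case: pselect.
by apply: cont_on_ext gB => x Bx; case: pselect => // Ax; rewrite fg.
Qed.

Lemma cont_on_closed A f (C : set Y) : closed A -> cont_on A f -> closed C ->
  closed (A `&` f @^-1` C).
Proof.
move=> cA fA cC; rewrite -openC openE => x nx; rewrite /interior.
have [Ax|nAx] := pselect (A x); last first.
  have : nbhs x (~` A) by apply: open_nbhs_nbhs; split=> //; exact: closed_openC.
  by apply: filterS => y nAy [/nAy].
have nC : nbhs (f x) (~` C).
  apply: open_nbhs_nbhs; split; first exact: closed_openC.
  by move=> Cf; apply: nx.
have := fA x Ax _ nC; rewrite !nbhs_simpl /= /within /=.
by apply: filterS => y H [Ay]; exact: H.
Qed.

End Con.

Lemma cont_on_comp {X Y Z : topologicalType} (A : set X) (B : set Y) (f : X -> Y)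
    (g : Y -> Z) :
  cont_on B g -> cont_on A f -> (forall x, A x -> B (f x)) -> cont_on A (fun x => g (f x)).
Proof.
move=> cg cf AB x Ax O /(cg _ (AB x Ax)).
rewrite !nbhs_simpl /= => /(cf x Ax); rewrite !nbhs_simpl /= /within /=.
by apply: filterS => y H Ay; apply: H => //; exact: AB.
Qed.

Lemma cont_on_comp_continuous {X Y Z : topologicalType} (A : set X) (f : X -> Y)
    (g : Y -> Z) :
  continuous g -> cont_on A f -> cont_on A (fun x => g (f x)).
Proof. by move=> cg cf; apply: (cont_on_comp (cont_on_continuous (A := setT) cg) cf). Qed.

Section ConReal.
Context {R : realType} {X : topologicalType}.
Implicit Types (A : set X) (f g : X -> R).

Lemma cont_on_add A f g : cont_on A f -> cont_on A g -> cont_on A (fun x => f x + g x).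
Proof. by move=> cf cg x Ax; apply: cvgD; [exact: cf|exact: cg]. Qed.

Lemma cont_on_opp A f : cont_on A f -> cont_on A (fun x => - f x).
Proof. by move=> cf x Ax; apply: cvgN; exact: cf. Qed.

Lemma cont_on_subr A f g : cont_on A f -> cont_on A g -> cont_on A (fun x => f x - g x).
Proof. by move=> cf cg; apply: cont_on_add => //; exact: cont_on_opp. Qed.

Lemma cont_on_mul A f g : cont_on A f -> cont_on A g -> cont_on A (fun x => f x * g x).
Proof. by move=> cf cg x Ax; apply: cvgM; [exact: cf|exact: cg]. Qed.

Lemma cont_on_inv A f : (forall x, A x -> f x != 0) -> cont_on A f ->
  cont_on A (fun x => (f x)^-1).
Proof. by move=> f0 cf x Ax; apply: cvgV; [exact: f0|exact: cf]. Qed.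

Lemma cont_on_norm A f : cont_on A f -> cont_on A (fun x => `|f x|).
Proof. by move=> cf x Ax; apply: cvg_norm; exact: cf. Qed.

Lemma cont_on_max A f g : cont_on A f -> cont_on A g -> cont_on A (fun x => Num.max (f x) (g x)).
Proof.
move=> cf cg; apply: (@cont_on_ext _ _ _ (fun x => (f x + g x + `|f x - g x|) / 2)).
  move=> x _; have [] := leP (f x) (g x) => fg.
    by rewrite ler0_norm ?subr_le0//; field.
  by rewrite ger0_norm ?subr_ge0 1?ltW//; field.
apply: cont_on_mul; last exact: cont_on_cst.
by apply: cont_on_add; [exact: cont_on_add|apply: cont_on_norm; exact: cont_on_subr].
Qed.

Lemma cont_on_min A f g : cont_on A f -> cont_on A g -> cont_on A (fun x => Num.min (f x) (g x)).
Proof.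
move=> cf cg.
apply: (@cont_on_ext _ _ _ (fun x => f x + g x - Num.max (f x) (g x))).
  by move=> x _; have [] := leP (f x) (g x) => fg; ring.
by apply: cont_on_subr; [exact: cont_on_add|exact: cont_on_max].
Qed.

Lemma cont_on_sum A (J : Type) (r : seq J) (P : pred J) (F : J -> X -> R) :
  (forall j, P j -> cont_on A (F j)) -> cont_on A (fun x => \sum_(j <- r | P j) F j x).
Proof.
move=> cF; elim: r => [|j r IH].
  by apply: (@cont_on_ext _ _ _ (fun=> 0)); [move=> x _; rewrite big_nil|exact: cont_on_cst].
apply: (@cont_on_ext _ _ _ (fun x => (if P j then F j x else 0)
    + \sum_(j <- r | P j) F j x)).
  by move=> x _; rewrite big_cons; case: ifP => // _; rewrite add0r.
apply: cont_on_add => //; have := cF j.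
by case: (P j) => [H|_]; [exact: H|exact: cont_on_cst].
Qed.

Lemma cont_on_bigmax A (J : Type) (r : seq J) (F : J -> X -> R) :
  (forall j, cont_on A (F j)) -> cont_on A (fun x => \big[Num.max/0]_(j <- r) F j x).
Proof.
move=> cF; elim: r => [|j r IH].
  by apply: (@cont_on_ext _ _ _ (fun=> 0)); [move=> x _; rewrite big_nil|exact: cont_on_cst].
apply: (@cont_on_ext _ _ _ (fun x => Num.max (F j x) (\big[Num.max/0]_(j <- r) F j x))).
  by move=> x _; rewrite big_cons.
exact: cont_on_max.
Qed.

Lemma cont_on_row A n (f : X -> 'rV[R]_n) : (forall i, cont_on A (fun x => f x ord0 i)) ->
  cont_on A f.
Proof.
move=> cf x Ax O [P nP PO]; rewrite !nbhs_simpl /=.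
have : \forall y \near within A (nbhs x), forall i, P ord0 i (f y ord0 i).
  by apply: filter_forall => i; exact: (cf i x Ax _ (nP ord0 i)).
by apply: filterS => y Hy; apply: PO => i j; rewrite (ord1 i); exact: Hy.
Qed.

Lemma cont_on_coord A n (f : X -> 'rV[R]_n) (i : 'I_n) : cont_on A f ->
  cont_on A (fun x => f x ord0 i).
Proof.
move=> cf; apply: (cont_on_comp_continuous (g := fun v : 'rV[R]_n => v ord0 i)) => //.
exact: coord_continuous.
Qed.

End ConReal.

Lemma cont_on_fst {X Y : topologicalType} (A : set (X * Y)) : cont_on A fst.
Proof. by apply: cont_on_continuous; exact: fst_continuous. Qed.

Lemma cont_on_snd {X Y : topologicalType} (A : set (X * Y)) : cont_on A snd.
Proof. by apply: cont_on_continuous; exact: snd_continuous. Qed.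

Lemma cont_on_id {X : topologicalType} (A : set X) : cont_on A id.
Proof. by apply: cont_on_continuous => x; exact: cvg_id. Qed.

(** * Cones and filling of cylinders *)

Section Conic.
Context {R : realType}.

Definition I01 : set R := [set t | 0 <= t <= 1].

Lemma closed_I01 : closed I01.
Proof.
have -> : I01 = `[0, 1]%classic by apply/seteqP; split=> t; rewrite /= in_itv.
exact: interval_closed.
Qed.

Lemma closed_preim {X Y : topologicalType} (f : X -> Y) (C : set Y) :
  continuous f -> closed C -> closed (f @^-1` C).
Proof. by move=> cf cC; apply: closed_comp => // x _; exact: cf. Qed.

Lemma closed_setX {X Y : topologicalType} (A : set X) (B : set Y) :
  closed A -> closed B -> closed (A `*` B).
Proof.
move=> cA cB; have -> : A `*` B = (fst @^-1` A) `&` (snd @^-1` B) by [].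
apply: closedI.
  by apply: closed_preim => //; exact: fst_continuous.
by apply: closed_preim => //; exact: snd_continuous.
Qed.

(* [K] is a cone on [dK]: the points of [K] are scaled by [sc] away from a
   centre, [N] is the gauge and [dK] its unit sphere. *)
Definition conic {W : topologicalType} (K dK : set W) :=
  exists (sc : R -> W -> W) (N : W -> R),
  [/\ closed K,
      continuous (fun x : R * W => sc x.1 x.2) /\ continuous N,
      (forall w, 0 <= N w) /\ (forall w, K w -> N w <= 1 /\ sc 1 w = w),
      (forall l w, 1 <= l -> K w -> N (sc l w) = l * N w /\
         (l * N w <= 1 -> K (sc l w)))
    & forall w, dK w <-> K w /\ N w = 1].

Section Fill.
Context {W : topologicalType} (K dK : set W) (cK : conic K dK).

Lemma conic_closed : closed K.
Proof. by have [? [? []]] := cK. Qed.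

Lemma conic_sub : dK `<=` K.
Proof. by have [? [? [_ _ _ _ H]]] := cK => w /H []. Qed.

Lemma conic_closed_bdry : closed dK.
Proof.
have [sc [N [clK [_ cN] _ _ H]]] := cK.
have -> : dK = K `&` N @^-1` [set 1] by apply/seteqP; split=> w /H.
by apply: closedI => //; apply: closed_preim => //; exact: closed_eq.
Qed.

(** Radial projection from the point at height -1 below the centre of [K]. The ray through [(w, u)]
    is followed, by the factor [l >= 1], until it first meets the wall, where [N = 1], or the lid at
    height 1; [M] is the larger of the two quantities that become 1 there. *)
Lemma conic_retraction : exists r : W * R -> W * R,
  [/\ cont_on (K `*` I01) r,
      forall w u, K w -> I01 u ->
        dK (r (w, u)).1 /\ I01 (r (w, u)).2 \/ K (r (w, u)).1 /\ (r (w, u)).2 = 1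
    & forall w u, K w -> I01 u -> dK w \/ u = 1 -> r (w, u) = (w, u)].
Proof.
have [sc [N [clK [csc cN] [N0 NK] scP dKP]]] := cK.
pose M (x : W * R) := Num.max (N x.1) ((1 + x.2) / 2).
pose l x := (M x)^-1.
have M0 x : (K `*` I01) x -> 0 < M x.
  move=> [_ /andP[u0 _]]; apply: (@lt_le_trans _ _ ((1 + x.2) / 2)); [lra|].
  by rewrite /M le_max lexx orbT.
have M1 x : (K `*` I01) x -> M x <= 1.
  move=> [/NK[N1 _] /andP[_ u1]]; rewrite /M ge_max N1 /=; lra.
have l1 x : (K `*` I01) x -> 1 <= l x.
  by move=> Kx; rewrite /l -invr1 lef_pV2 ?posrE ?M0 ?M1 ?ltr01.
have lM x : (K `*` I01) x -> l x * M x = 1.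
  by move=> Kx; rewrite mulVf// gt_eqF// M0.
have lN x : (K `*` I01) x -> l x * N x.1 <= 1.
  move=> Kx; rewrite -[leRHS](lM _ Kx) ler_pM2l; last by rewrite invr_gt0 M0.
  by rewrite /M le_max lexx.
have lu x : (K `*` I01) x -> l x * ((1 + x.2) / 2) <= 1.
  move=> Kx; rewrite -[leRHS](lM _ Kx) ler_pM2l; last by rewrite invr_gt0 M0.
  by rewrite /M le_max lexx orbT.
have cM : cont_on (K `*` I01) M.
  apply: cont_on_max; first by apply: cont_on_comp_continuous => //; exact: cont_on_fst.
  apply: cont_on_mul; last exact: cont_on_cst.
  by apply: cont_on_add; [exact: cont_on_cst|exact: cont_on_snd].
have cl : cont_on (K `*` I01) l.
  by apply: cont_on_inv => // x Kx; rewrite gt_eqF// M0.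
exists (fun x => (sc (l x) x.1, l x * (1 + x.2) - 1)); split.
- apply: cont_on_pair.
    apply: (cont_on_comp_continuous (f := fun x => (l x, x.1)) csc).
    by apply: cont_on_pair => //; exact: cont_on_fst.
  apply: cont_on_subr; last exact: cont_on_cst.
  by apply: cont_on_mul => //; apply: cont_on_add; [exact: cont_on_cst|exact: cont_on_snd].
- move=> w u Kw Iu; have Kx : (K `*` I01) (w, u) by split.
  have [scN scK] := scP _ _ (l1 _ Kx) Kw.
  have /scK K' := lN _ Kx.
  have := lM _ Kx; rewrite {1}/M /=; case: leP => /= _ E.
    right; split => //; move: E => /=; lra.
  left; split; first by apply/dKP; rewrite scN.
  have := lu _ Kx; have := l1 _ Kx; move: (Iu) => /andP[u0 u1] /= h1 h2.
  apply/andP; split; last by lra.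
  by rewrite subr_ge0 -[1 in leLHS](mulr1 1) ler_pM// lerDl.
- move=> w u Kw Iu H; have Kx : (K `*` I01) (w, u) by split.
  have Mx1 : M (w, u) = 1.
    apply/eqP; rewrite eq_le M1//=; rewrite /M /= le_max.
    case: H => [/dKP[_ ->]|->]; first by rewrite lexx.
    by apply/orP; right; lra.
  by rewrite /l Mx1 invr1 (NK _ Kw).2 mul1r /=; congr (_, _); ring.
Qed.

(** Homotopy extension, with the end [u = 1] prescribed. The filling is the given data composed with
    the retraction, hence takes no new values: this is the clause on [B]. *)
Lemma conic_fill (Z : topologicalType) (hs : W * R -> Z) (ht : W -> Z) :
  cont_on (dK `*` I01) hs -> cont_on K ht -> (forall w, dK w -> hs (w, 1) = ht w) ->
  exists h : W * R -> Z,
  [/\ cont_on (K `*` I01) h, forall w u, dK w -> I01 u -> h (w, u) = hs (w, u),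
      forall w, K w -> h (w, 1) = ht w
    & forall B : set Z, (forall w u, dK w -> I01 u -> B (hs (w, u))) ->
      (forall w, K w -> B (ht w)) -> forall w u, K w -> I01 u -> B (h (w, u))].
Proof.
move=> chs cht ht_hs; have [r [cr rP r1]] := conic_retraction.
pose A := dK `*` I01; pose A' := K `*` [set (1 : R)].
pose h0 := fun x => if pselect (A x) then hs x else ht x.1.
have ch0 : cont_on (A `|` A') h0.
  apply: cont_on_glue2 => //.
  - by apply: closed_setX; [exact: conic_closed_bdry|exact: closed_I01].
  - by apply: closed_setX; [exact: conic_closed|exact: closed_eq].
  - by apply: (cont_on_comp cht) => [|x []//]; exact: cont_on_fst.
  - by move=> [w u] [/= dw _] [/= _ ->]; exact: ht_hs.
have rA w u : K w -> I01 u -> (A `|` A') (r (w, u)).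
  by move=> Kw Iu; case: (rP w u Kw Iu) => H; [left|right].
exists (fun x => h0 (r x)); split.
- by apply: (cont_on_comp ch0 cr) => -[w u] [Kw Iu]; exact: rA.
- move=> w u dw Iu; rewrite r1//; [|exact: conic_sub|by left].
  by rewrite /h0; case: pselect => // nA; exfalso; apply: nA; split.
- move=> w Kw; have I1 : I01 (1 : R) by rewrite /I01/= ler01 lexx.
  rewrite r1//; last by right.
  by rewrite /h0; case: pselect => // -[/= dw _]; exact: ht_hs.
- move=> B Bs Bt w u Kw Iu; have := rA w u Kw Iu; rewrite /h0.
  case: (r (w, u)) => w' u'; case: pselect => [[/= ? ?] _|nA]; first exact: Bs.
  by move=> [//|[/= Kw' _]]; exact: Bt.
Qed.

Definition cyl_bdry : set (W * R) :=
  (dK `*` I01) `|` (K `*` [set t | t = 0 \/ t = 1]).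

(** The centre is at height 1/2. Being a cone again, the cylinder can itself be filled relative to
    its whole boundary, as is needed when homotopies are deformed. *)
Lemma conic_cyl : conic (K `*` I01) cyl_bdry.
Proof.
have [sc [N [clK [csc cN] [N0 NK] scP dKP]]] := cK.
exists (fun l x => (sc l x.1, 1 / 2 + l * (x.2 - 1 / 2))).
exists (fun x => Num.max (N x.1) (`|2 * x.2 - 1|)).
split.
- by apply: closed_setX => //; exact: closed_I01.
- split; apply: cont_onT.
    apply: cont_on_pair.
      apply: (cont_on_comp_continuous (f := fun x : R * (W * R) => (x.1, x.2.1)) csc).
      apply: cont_on_pair; first exact: cont_on_fst.
      by apply: cont_on_comp_continuous; [exact: fst_continuous|exact: cont_on_snd].
    apply: cont_on_add; first exact: cont_on_cst.
    apply: cont_on_mul; first exact: cont_on_fst.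
    apply: cont_on_subr; last exact: cont_on_cst.
    by apply: cont_on_comp_continuous; [exact: snd_continuous|exact: cont_on_snd].
  apply: cont_on_max; first by apply: cont_on_comp_continuous => //; exact: cont_on_fst.
  apply: cont_on_norm; apply: cont_on_subr; last exact: cont_on_cst.
  by apply: cont_on_mul; [exact: cont_on_cst|exact: cont_on_snd].
- split=> [[w t]|[w t] [/= Kw /andP[t0 t1]]]; first by rewrite le_max N0.
  have [N1 ->] := NK _ Kw; split; last by congr (_, _); ring.
  by rewrite ge_max N1 /= ler_norml; apply/andP; split; lra.
- move=> l [w t] l1 [/= Kw /andP[t0 t1]]; have [scN scK] := scP _ _ l1 Kw.
  have l0 : 0 <= l by apply: le_trans l1.
  have E : 2 * (1 / 2 + l * (t - 1 / 2)) - 1 = l * (2 * t - 1) by field.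
  split; first by rewrite scN E normrM (ger0_norm l0) maxr_pMr.
  rewrite maxr_pMr// ge_max -{2}(ger0_norm l0) -normrM -E => /andP[/scK Kw'].
  by rewrite ler_norml => /andP[h1 h2]; split=> //=; apply/andP; split; lra.
- move=> [w t]; split=> [[[/= dw It]|[/= Kw t01]]|[[/= Kw /andP[t0 t1]]]].
  + have /dKP[Kw N1] := dw; split; first by split.
    apply/eqP; rewrite eq_le le_max N1 lexx /= andbT ge_max lexx /= ler_norml.
    by move: It => /andP[? ?]; apply/andP; split; lra.
  + have [N1 _] := NK _ Kw.
    have Et : `|2 * t - 1| = 1.
      case: t01 => ->; last by rewrite ger0_norm; lra.
      by rewrite ler0_norm; lra.
    split; first by split=> //=; case: t01 => ->; rewrite /I01 /=; lra.
    by apply/eqP; rewrite Et eq_le ge_max N1 lexx /= le_max lexx orbT.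
  + case: leP => _ E; last first.
      by left; split=> /=; [apply/dKP|rewrite /I01 /= t0 t1].
    right; split=> //=; have [h|h] := leP 0 (2 * t - 1).
      by right; rewrite ger0_norm// in E; lra.
    by left; rewrite ltr0_norm// in E; lra.
Qed.

End Fill.

Section Box.
Context {k : nat}.
Implicit Types p q : 'I_k -> R.

Definition box p q : set 'rV[R]_k := [set s | forall i, p i <= s ord0 i <= q i].

(** The relative boundary: a side with [p i = q i] contributes no face. Faces of a box are thus
    boxes of the same ambient space, and the boundary of a single point is empty. *)
Definition bdry p q : set 'rV[R]_k :=
  [set s | box p q s /\
           exists i, p i < q i /\ (s ord0 i = p i \/ s ord0 i = q i)].

Lemma closed_box p q : closed (box p q).
Proof.
have -> : box p q = \bigcap_(i in [set: 'I_k])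
    ((fun s : 'rV[R]_k => s ord0 i) @^-1` `[p i, q i]%classic).
  apply/seteqP; split=> s H i; first by move=> _; rewrite /= in_itv; exact: H.
  by have := H i I; rewrite /= in_itv.
apply: closed_bigI => i _; apply: closed_preim; last exact: interval_closed.
exact: coord_continuous.
Qed.

Lemma compact_box p q : compact (box p q).
Proof.
have -> : box p q = [set v : 'rV[R]_k | forall i, `[p i, q i]%classic (v ord0 i)].
  by apply/seteqP; split=> s H i; have := H i; rewrite /= in_itv.
exact: (@rV_compact R k (fun i => `[p i, q i]%classic) (fun i => @segment_compact R (p i) (q i))).
Qed.

(** The gauge is the sup norm about the midpoint, each coordinate being divided by half the side. On
    a flat side the quotient by 0 is 0, so that flat sides do not count, in agreement with
    [bdry]. *)
Lemma conic_box p q : conic (box p q) (bdry p q).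
Proof.
pose m i := (p i + q i) / 2; pose w i := (q i - p i) / 2.
pose F i (s : 'rV[R]_k) := `|s ord0 i - m i| / w i.
exists (fun (l : R) (s : 'rV[R]_k) => \row_i (m i + l * (s ord0 i - m i))).
exists (fun s : 'rV[R]_k => \big[Num.max/0]_i F i s).
have FN i s : box p q s -> F i s <= 1.
  move=> /(_ i) /andP[pi iq]; rewrite /F; have [w0|w0] := eqVneq (w i) 0.
    by rewrite w0 invr0 mulr0.
  have {}w0 : 0 < w i by rewrite lt_neqAle eq_sym w0 /= /w; lra.
  by rewrite ler_pdivrMr// mul1r ler_norml /m /w; apply/andP; split; lra.
have F0 i s : box p q s -> 0 <= F i s.
  by move=> /(_ i) /andP[pi iq]; rewrite /F divr_ge0// /w; lra.
split.
- exact: closed_box.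
- split; apply: cont_onT.
    apply: cont_on_row => i; apply: (@cont_on_ext _ _ _ (fun x : R * 'rV[R]_k =>
      m i + x.1 * (x.2 ord0 i - m i))); first by move=> x _; rewrite mxE.
    apply: cont_on_add; first exact: cont_on_cst.
    apply: cont_on_mul; first exact: cont_on_fst.
    apply: cont_on_subr; last exact: cont_on_cst.
    by apply: cont_on_coord; exact: cont_on_snd.
  apply: cont_on_bigmax => i; apply: cont_on_mul; last exact: cont_on_cst.
  apply: cont_on_norm; apply: cont_on_subr; last exact: cont_on_cst.
  by apply: cont_on_coord; exact: cont_on_id.
- split=> [s|s Ks]; first by apply: bigmax_ge_id.
  split; first by apply: bigmax_le => // i _; exact: FN.
  by apply/rowP => i; rewrite mxE; ring.
- move=> l s l1 Ks; have l0 : 0 <= l by apply: le_trans l1.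
  have E : forall i, F i (\row_i (m i + l * (s ord0 i - m i))) = l * F i s.
    by move=> i; rewrite /F mxE addrAC subrr add0r normrM (ger0_norm l0) mulrA.
  have EN : \big[Num.max/0]_i F i (\row_i (m i + l * (s ord0 i - m i))) =
      l * \big[Num.max/0]_i F i s.
    rewrite (eq_bigr (fun i => l * F i s)); last by move=> i _; exact: E.
    apply: (big_rec2 (fun x y => x = l * y)); first by rewrite mulr0.
    by move=> i y1 y2 _ ->; rewrite maxr_pMr.
  split=> // N1 i; have : F i (\row_i (m i + l * (s ord0 i - m i))) <= 1.
    by apply: le_trans N1; rewrite -EN; exact: le_bigmax.
  have /andP[pi iq] := Ks i.
  rewrite /F mxE; have [w0|w0] := eqVneq (w i) 0.
    have ->: s ord0 i = m i by move: w0; rewrite /w /m; lra.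
    by rewrite subrr mulr0 addr0 => _; rewrite /m; apply/andP; split; lra.
  have {}w0 : 0 < w i by rewrite lt_neqAle eq_sym w0 /= /w; lra.
  rewrite ler_pdivrMr// mul1r ler_norml /m /w => /andP[? ?].
  by apply/andP; split; lra.
- move=> s; split=> [[Ks [i [pq H]]]|[Ks N1]].
    split=> //; apply/eqP; rewrite eq_le; apply/andP; split.
      by apply: bigmax_le => // j _; exact: FN.
    apply: le_trans (le_bigmax _ _ i); rewrite /F.
    have w0 : 0 < w i by rewrite /w; lra.
    rewrite ler_pdivlMr// mul1r; case: H => ->.
      by rewrite ler0_norm /w /m; lra.
    by rewrite ger0_norm /w /m; lra.
  split=> //; apply: contrapT => nex.
  suff : \big[Num.max/0]_i F i s < 1 by rewrite N1 ltxx.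
  apply: bigmax_lt => // i _; rewrite lt_neqAle FN// andbT; apply/eqP => F1.
  apply: nex; exists i; have /andP[pi iq] := Ks i.
  have w0 : 0 < w i.
    rewrite lt_neqAle; apply/andP; split; last by rewrite /w; lra.
    by apply/eqP => w0; move: F1; rewrite /F -w0 invr0 mulr0 => /eqP; rewrite eq_sym oner_eq0.
  split; first by move: w0; rewrite /w; lra.
  have : `|s ord0 i - m i| = w i.
    by rewrite -[RHS]mul1r -F1 /F mulfVK// gt_eqF.
  rewrite /m /w; have [h|h] := leP 0 (s ord0 i - (p i + q i) / 2).
    by rewrite ger0_norm// => H; right; lra.
  by rewrite ltr0_norm// => H; left; lra.
Qed.

End Box.
End Conic.

(** * Lifting problems *)

Section Lifting.
Context {R : realType} {X Y : topologicalType}.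
Variables (f : X -> Y) (cf : continuous f).
Local Notation I := (@I01 R).

Section Problem.
Context {W : topologicalType} (B : set Y) (K dK : set W).

(** [B] confines the homotopies in [Y], both the given one and the one to be found. It will be a set
    of nondegenerate elements, a skeleton, or a neighbourhood of a skeleton in the next one. *)
Definition problem (a : W -> X) (G : W * R -> Y) (b : W -> Y) :=
  [/\ cont_on dK a, cont_on (dK `*` I) G, cont_on K b,
      forall s, dK s -> G (s, 0) = f (a s) /\ G (s, 1) = b s
    & (forall s t, dK s -> I t -> B (G (s, t))) /\ (forall s, K s -> B (b s))].

Definition solvable (a : W -> X) (G : W * R -> Y) (b : W -> Y) :=
  exists (a' : W -> X) (G' : W * R -> Y),
  [/\ cont_on K a', cont_on (K `*` I) G',
      forall s, dK s -> a' s = a s /\ forall t, I t -> G' (s, t) = G (s, t),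
      forall s, K s -> G' (s, 0) = f (a' s) /\ G' (s, 1) = b s
    & forall s t, K s -> I t -> B (G' (s, t))].

Hypothesis cK : @conic R W K dK.

Lemma I0_I01 : I 0. Proof. by rewrite /I01 /= lexx ler01. Qed.
Lemma I1_I01 : I 1. Proof. by rewrite /I01 /= lexx ler01. Qed.
Lemma I01C t : I t -> I (1 - t).
Proof. by rewrite /I01 /= => /andP[? ?]; apply/andP; split; lra. Qed.
Lemma I01M t u : I t -> I u -> I (t * u).
Proof.
rewrite /I01 /= => /andP[? ?] /andP[? ?]; rewrite mulr_ge0//=.
by rewrite mulr_ile1.
Qed.

(** Two fillings carry a solution along a deformation of the problem, from [u = 1] back to [u = 0].
    The first extends [a1] along [a] to [A]. Over the boundary of the cylinder on [K], the homotopy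
    then has to be [G] on the wall, the image of [A] at the bottom and [b] at the top: this is [S],
    and the second filling extends [G1] along it. *)
Lemma solvable_homotopic (a : W * R -> X) (G : (W * R) * R -> Y)
    (b : W * R -> Y) :
  cont_on (dK `*` I) a -> cont_on ((dK `*` I) `*` I) G -> cont_on (K `*` I) b ->
  (forall s u, dK s -> I u -> G (s, 0, u) = f (a (s, u)) /\ G (s, 1, u) = b (s, u)) ->
  (forall s t u, dK s -> I t -> I u -> B (G (s, t, u))) ->
  (forall s u, K s -> I u -> B (b (s, u))) ->
  solvable (fun s => a (s, 1)) (fun x => G (x, 1)) (fun s => b (s, 1)) ->
  solvable (fun s => a (s, 0)) (fun x => G (x, 0)) (fun s => b (s, 0)).
Proof.
move=> ca cG cb Gab GB bB [a1 [G1 [ca1 cG1 aG1 G1ab G1B]]].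
have [A [cA Aa A1 AB]] := conic_fill cK ca ca1 (fun s ds => esym (aG1 s ds).1).
pose C1 := (dK `*` I) `*` I; pose C2 := (K `*` [set (0 : R)]) `*` I.
pose C3 := (K `*` [set (1 : R)]) `*` I.
pose S (x : (W * R) * R) := if pselect (C1 x) then G x else
  (if pselect (C2 x) then f (A (x.1.1, x.2)) else b (x.1.1, x.2)).
have clK := conic_closed cK; have cldK := conic_closed_bdry cK.
have clI := @closed_I01 R.
have cswap (V : set (W * R * R)) : cont_on V (fun x : W * R * R => (x.1.1, x.2)).
  apply: cont_on_pair; last exact: cont_on_snd.
  by apply: cont_on_comp_continuous; [exact: fst_continuous|exact: cont_on_fst].
have cS : cont_on (cyl_bdry K dK `*` I) S.
  apply: (@cont_on_sub _ _ _ (C1 `|` (C2 `|` C3))).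
    move=> [[s t] u] [/= [[/= ds It]|[/= Ks [t0|t0]]] Iu]; [left|right; left|right; right];
      by split.
  apply: cont_on_glue2 => //.
  - by apply: closed_setX => //; exact: closed_setX.
  - by apply: closedU; apply: closed_setX => //; apply: closed_setX => //;
      exact: closed_eq.
  - apply: cont_on_glue2 => //.
    + by apply: closed_setX => //; apply: closed_setX => //; exact: closed_eq.
    + by apply: closed_setX => //; apply: closed_setX => //; exact: closed_eq.
    + apply: cont_on_comp_continuous => //; apply: (cont_on_comp cA (cswap _)).
      by move=> x [[/= Ks _] Iu]; split.
    + apply: (cont_on_comp cb (cswap _)).
      by move=> x [[/= Ks _] Iu]; split.
    + move=> [[s t] u] [[/= _ t0] _] [[/= _ t1] _].
      by move: t0; rewrite t1 => /eqP; rewrite oner_eq0.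
  - move=> [[s t] u] [[/= ds It] /= Iu] H; case: pselect => [[[/= _ ->] _]|n2].
      by rewrite Aa// (Gab s u ds Iu).1.
    by case: H => // -[[/= _ ->] _]; rewrite (Gab s u ds Iu).2.
have S1 x : cyl_bdry K dK x -> S (x, 1) = G1 x.
  case: x => s t H; rewrite /S; case: pselect => [[[/= ds It] _]|n1].
    by rewrite (aG1 s ds).2.
  case: pselect => [[[/= Ks ->] _]|n2 /=].
    by rewrite A1// (G1ab s Ks).1.
  case: H => [dx|[/= Ks [t0|->]]]; last by rewrite (G1ab s Ks).2.
  - by exfalso; apply: n1; split=> //; exact: I1_I01.
  - by exfalso; apply: n2; split=> //; exact: I1_I01.
have [h [ch hS h1 hB]] := conic_fill (conic_cyl cK) cS cG1 S1.
exists (fun s => A (s, 0)), (fun x => h (x, 0)); have I0 := I0_I01.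
have I1 := I1_I01.
split.
- apply: (cont_on_comp cA (B := K `*` I)) => [|s Ks]; last by split.
  by apply: cont_on_pair; [exact: cont_on_id|exact: cont_on_cst].
- apply: (cont_on_comp ch (B := (K `*` I) `*` I)) => [|s Ks]; last by split.
  by apply: cont_on_pair; [exact: cont_on_id|exact: cont_on_cst].
- move=> s ds; split=> [|t It]; first exact: Aa.
  rewrite hS//; last by left.
  by rewrite /S; case: pselect => // n1; exfalso; apply: n1.
- move=> s Ks; split.
    rewrite hS//; last by right; split=> //; left.
    rewrite /S; case: pselect => [[[/= ds _] _]|n1].
      by rewrite (Gab s 0 ds I0).1 Aa.
    by case: pselect => // n2; exfalso; apply: n2.
  rewrite hS//; last by right; split=> //; right.
  rewrite /S; case: pselect => [[[/= ds _] _]|n1].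
    by rewrite (Gab s 0 ds I0).2.
  case: pselect => // -[[/= _ /eqP]]; by rewrite oner_eq0.
- move=> s t Ks It; apply: (hB B) => //.
    move=> x u dx Iu; rewrite /S; case: pselect => [[[/= ds It'] _]|n1].
      by case: x dx ds It' => s' t' /= dx ds It'; exact: GB.
    have Kx : K x.1 by case: dx => [[/= /(conic_sub cK)]|[]].
    case: pselect => [p2|n2]; last exact: bB.
    apply: (AB (f @^-1` B)) => // [s' u' ds' Iu'|s' Ks'] /=.
      by rewrite -(Gab s' u' ds' Iu').1; exact: GB.
    by rewrite -(G1ab s' Ks').1; exact: G1B.
  by move=> [s' t'] [/= Ks' It']; exact: G1B.
Qed.


(** The boundary homotopy can be absorbed into [b]: by homotopy extension [b] is pulled back along
    [G], while [G] is cut short to the times [t * (1 - u)]. At [u = 1] only a constant homotopy is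
    left, and [solvable_homotopic] applies. *)
Lemma solvable_const :
  (forall a G b, problem a G b -> (forall s t, dK s -> I t -> G (s, t) = f (a s)) ->
     solvable a G b) ->
  forall a G b, problem a G b -> solvable a G b.
Proof.
move=> H a G b [ca cG cb Gab [GB bB]].
have [h [ch hG h1 hB]] := conic_fill cK cG cb (fun s ds => (Gab s ds).2).
have I0 := I0_I01; have I1 := I1_I01.
pose b' (x : W * R) := h (x.1, 1 - x.2).
pose G' (x : (W * R) * R) := G (x.1.1, x.1.2 * (1 - x.2)).
pose a' (x : W * R) := a x.1.
have c1 (V : topologicalType) (A : set (V * R)) : cont_on A (fun x => 1 - x.2).
  by apply: cont_on_subr; [exact: cont_on_cst|exact: cont_on_snd].
have ca' : cont_on (dK `*` I) a' by apply: (cont_on_comp ca (@cont_on_fst _ _ _)) => x [].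
have cG' : cont_on ((dK `*` I) `*` I) G'.
  apply: (cont_on_comp cG).
    apply: cont_on_pair.
      by apply: cont_on_comp_continuous; [exact: fst_continuous|exact: cont_on_fst].
    apply: cont_on_mul; last exact: c1.
    by apply: cont_on_comp_continuous; [exact: snd_continuous|exact: cont_on_fst].
  by move=> [[s t] u] [[/= ds It] /= Iu]; split => //=; apply: I01M => //; exact: I01C.
have cb' : cont_on (K `*` I) b'.
  apply: (cont_on_comp ch); first by apply: cont_on_pair; [exact: cont_on_fst|exact: c1].
  by move=> [s u] [/= Ks Iu]; split => //=; exact: I01C.
have bE s : K s -> b' (s, 0) = b s by move=> Ks; rewrite /b' /= subr0 h1.
have GE s t : G' ((s, t), 0) = G (s, t) by rewrite /G' /= subr0 mulr1.
have G'ab s u : dK s -> I u -> G' (s, 0, u) = f (a' (s, u)) /\ G' (s, 1, u) = b' (s, u).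
  move=> ds Iu; rewrite /G' /b' /a' /= mul0r mul1r (Gab s ds).1; split => //.
  by rewrite hG//; exact: I01C.
have G'B s t u : dK s -> I t -> I u -> B (G' (s, t, u)).
  by move=> ds It Iu; apply: GB => //; apply: I01M => //; exact: I01C.
have b'B s u : K s -> I u -> B (b' (s, u)).
  by move=> Ks Iu; apply: hB => //; exact: I01C.
have H1 : solvable (fun s => a' (s, 1)) (fun x => G' (x, 1)) (fun s => b' (s, 1)).
  have G1 s t : G' (s, t, 1) = G (s, 0) by rewrite /G' /= subrr mulr0.
  apply: H; last by move=> s t ds It; rewrite G1 (Gab s ds).1.
  split.
  - exact: ca.
  - apply: (cont_on_comp cG' (B := (dK `*` I) `*` I)) => [|s Ks]; last by split.
    by apply: cont_on_pair; [exact: cont_on_id|exact: cont_on_cst].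
  - apply: (cont_on_comp cb' (B := K `*` I)) => [|s Ks]; last by split.
    by apply: cont_on_pair; [exact: cont_on_id|exact: cont_on_cst].
  - by move=> s ds; exact: G'ab.
  - by split=> [s t ds It|s Ks]; [exact: G'B|exact: b'B].
have [a1 [G1 [ca1 cG1 aG1 G1ab G1B]]] := solvable_homotopic ca' cG' cb' G'ab G'B b'B H1.
exists a1, G1; split => //.
- by move=> s ds; have [-> E] := aG1 s ds; split=> // t It; rewrite E// GE.
- by move=> s Ks; have [-> ->] := G1ab s Ks; rewrite bE.
Qed.

End Problem.

(* The relative homotopy extension and lifting property of [f] over [B], for all
   boxes, possibly of lower dimension than the ambient space. As [a] is a total
   function, the second clause says nothing when [X] is empty, whence the first. *)
Definition lifts (B : set Y) :=
  (forall y, B y -> exists x : X, True) /\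
  forall (k : nat) (p q : 'I_k -> R) a G b, (forall i, p i <= q i) ->
    problem B (box p q) (bdry p q) a G b -> solvable B (box p q) (bdry p q) a G b.

End Lifting.
Arguments lifts R {X Y} f B.

(** * Extension of local data over the cells of a grid *)

Section Grid.
Context {R : realType} {k : nat} {T : Type}.
Variable F : set 'rV[R]_k -> ('rV[R]_k -> T) -> Prop.
Hypothesis F_sub : forall A B g, A `<=` B -> F B g -> F A g.
Hypothesis F_ext : forall A g g', (forall s, A s -> g s = g' s) -> F A g -> F A g'.
Hypothesis F_glue : forall A B g, closed A -> closed B -> F A g -> F B g ->
  F (A `|` B) g.
Variable x : 'I_k -> nat -> R.
Hypothesis xP : forall i, (forall m n, x i m = x i n) \/
  (forall m n, (m < n)%N -> x i m < x i n).

Definition lattice_box (v w : 'I_k -> nat) :=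
  box (fun i => x i (v i)) (fun i => x i (w i)).
Definition lattice_bdry (v w : 'I_k -> nat) :=
  bdry (fun i => x i (v i)) (fun i => x i (w i)).

Variable M : nat.
Hypothesis F_cell : forall v w, (forall i, v i <= w i <= (v i).+1)%N ->
  (forall i, w i <= M)%N -> forall g, F (lattice_bdry v w) g ->
  exists g', F (lattice_box v w) g' /\ forall s, lattice_bdry v w s -> g' s = g s.

Lemma lattice_mono i m n : (m <= n)%N -> x i m <= x i n.
Proof.
rewrite leq_eqVlt => /orP[/eqP->//|mn].
by case: (xP i) => [xc|H]; [rewrite (xc m n)|apply: ltW; exact: H].
Qed.

(** A point in the relative interior of an elementary cell lies strictly between consecutive grid
    values in each direction where the cell is not flat, and a lattice interval around such a point
    contains both values. *)
Lemma lattice_sub v w v' w' s : (forall i, v i <= w i <= (v i).+1)%N ->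
  lattice_box v w s -> ~ lattice_bdry v w s -> lattice_box v' w' s ->
  lattice_box v w `<=` lattice_box v' w'.
Proof.
move=> vw Ks nbs Ks' r Kr i; have /andP[vs sw] := Ks i; have /andP[vr rw] := Kr i.
have /andP[vs' sw'] := Ks' i.
have [lt|] := ltP (x i (v i)) (x i (w i)); last first.
  move=> wv; have -> : r ord0 i = s ord0 i by lra.
  by rewrite vs' sw'.
have vs1 : x i (v i) < s ord0 i.
  rewrite lt_neqAle vs andbT; apply/eqP => E; apply: nbs; split=> //.
  by exists i; split=> //; left.
have sw1 : s ord0 i < x i (w i).
  rewrite lt_neqAle sw andbT; apply/eqP => E; apply: nbs; split=> //.
  by exists i; split=> //; right.
have wE : w i = (v i).+1.
  have /andP[h1 h2] := vw i; apply/eqP; rewrite eqn_leq h2 /= ltn_neqAle h1 andbT.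
  by apply/eqP => E; rewrite E ltxx in lt.
apply/andP; split.
  apply: le_trans vr; apply: lattice_mono; rewrite leqNgt -wE; apply/negP => h.
  by have := lattice_mono i (h : (w i <= v' i)%N); lra.
apply: (le_trans rw); apply: lattice_mono; rewrite wE leqNgt; apply/negP => h.
by have := lattice_mono i (h : (w' i <= v i)%N); lra.
Qed.

(** Induction on the total number of grid steps along the sides. A side of more than one step is cut
    after its first step, at [c]. The data are extended over the cutting wall, whose boundary is
    part of the old one, and then over the two halves, whose boundaries lie in the old boundary and
    the wall. As walls are cut in turn, [F_cell] is called for cells of all dimensions. *)
Lemma lattice_extend v w : (forall i, v i <= w i)%N -> (forall i, w i <= M)%N ->
  forall g, F (lattice_bdry v w) g ->
  exists g', F (lattice_box v w) g' /\ forall s, lattice_bdry v w s -> g' s = g s.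
Proof.
have [n] := ubnP (\sum_i (w i - v i))%N; elim: n v w => // n IH v w hn vw wM g Fg.
have [cell|] := pselect (forall i, (w i <= (v i).+1)%N).
  by apply: F_cell => // i; rewrite vw cell.
move=> /existsNP[i0 /negP]; rewrite -ltnNge => hi0.
pose c := (v i0).+1.
pose upd (z : 'I_k -> nat) i := if i == i0 then c else z i.
have updE z : upd z i0 = c by rewrite /upd eqxx.
have updN z i : i != i0 -> upd z i = z i by rewrite /upd => /negbTE ->.
have sumD (z z' : 'I_k -> nat) :
    (\sum_i (z' i - z i) = (z' i0 - z i0) + \sum_(i | i != i0) (z' i - z i))%N.
  by rewrite (bigD1 i0).
have updv i : (v i <= upd v i)%N.
  by rewrite /upd; case: eqP => [->|_//]; rewrite /c.
have updw i : (upd w i <= w i)%N.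
  by rewrite /upd; case: eqP => [->|_//]; rewrite /c ltnW.
have vuw i : (v i <= upd w i)%N.
  by rewrite /upd; case: eqP => [->|_//]; rewrite /c.
have uvw i : (upd v i <= w i)%N.
  by rewrite /upd; case: eqP => [->|_//]; rewrite /c ltnW.
have uvuw i : (upd v i <= upd w i)%N.
  by rewrite /upd; case: eqP.
have uwM i : (upd w i <= M)%N by apply: leq_trans (wM i).
have sum1 : (\sum_i (upd w i - v i) < n)%N.
  move: hn; rewrite ltnS => /(leq_trans _); apply; rewrite !sumD updE.
  rewrite (eq_bigr (fun i => w i - v i)%N); last by move=> i /updN ->.
  by rewrite ltn_add2r /c ltn_sub2rE// ltnW.
have sum2 : (\sum_i (w i - upd v i) < n)%N.
  move: hn; rewrite ltnS => /(leq_trans _); apply; rewrite !sumD updE.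
  rewrite (eq_bigr (fun i => w i - v i)%N); last by move=> i /updN ->.
  by rewrite ltn_add2r /c ltn_sub2lE// ltnW.
have sum3 : (\sum_i (upd w i - upd v i) < n)%N.
  apply: leq_ltn_trans sum1; apply: leq_sum => i _.
  exact: leq_sub2l.
(* In a constant direction there is nothing to cut: the box with the shorter index range is the same
   set. *)
case: (xP i0) => [xc|xlt].
  have EB : lattice_box v (upd w) = lattice_box v w.
    apply/seteqP; split=> s H i; have := H i;
      (have [->|/updN ->//] := eqVneq i i0);
      by rewrite updE (xc c (w i0)).
  have Eb : lattice_bdry v (upd w) = lattice_bdry v w.
    rewrite /lattice_bdry /bdry -!/(lattice_box _ _) EB.
    apply/seteqP; split=> s [Hs [i H]]; split=> //; exists i;
      (move: H; have [->|/updN ->//] := eqVneq i i0);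
      by rewrite updE (xc c (w i0)).
  have [|g' []] := IH v (upd w) sum1 vuw uwM g; first by rewrite Eb.
  by rewrite EB Eb; exists g'.
have xv : x i0 (v i0) < x i0 c by exact: xlt.
have xw : x i0 c < x i0 (w i0) by exact: xlt.
have subK1 : lattice_box v (upd w) `<=` lattice_box v w.
  move=> s H i; have /andP[-> h] := H i; apply: le_trans h _; exact: lattice_mono.
have subK2 : lattice_box (upd v) w `<=` lattice_box v w.
  move=> s H i; have /andP[h ->] := H i; rewrite andbT; apply: le_trans h.
  exact: lattice_mono.
have subW1 : lattice_box (upd v) (upd w) `<=` lattice_box v (upd w).
  move=> s H i; have /andP[h ->] := H i; rewrite andbT; apply: le_trans h.
  exact: lattice_mono.
have subW2 : lattice_box (upd v) (upd w) `<=` lattice_box (upd v) w.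
  move=> s H i; have /andP[-> h] := H i; apply: le_trans h _; exact: lattice_mono.
have atc s : lattice_box (upd v) (upd w) s -> s ord0 i0 = x i0 c.
  by move=> /(_ i0); rewrite !updE => /le_anti.
have bW : lattice_bdry (upd v) (upd w) `<=` lattice_bdry v w.
  move=> s [Ws [i [lt H]]]; split; first exact/subK1/subW1.
  have ii0 : i != i0 by apply/eqP => E; move: lt; rewrite E !updE ltxx.
  by exists i; move: lt H; rewrite !updN.
have bW' s : lattice_bdry v w s -> lattice_box (upd v) (upd w) s ->
    lattice_bdry (upd v) (upd w) s.
  move=> [_ [i [lt H]]] Ws; split=> //.
  have ii0 : i != i0.
    apply/eqP => E; subst i; move: H; rewrite atc// => -[E|E].
      by rewrite E ltxx in xv.
    by rewrite E ltxx in xw.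
  by exists i; rewrite !updN.
have [g1 [Fg1 g1g]] := IH _ _ sum3 uvuw uwM g (F_sub bW Fg).
pose h s := if pselect (lattice_box (upd v) (upd w) s) then g1 s else g s.
have hg s : lattice_bdry v w s -> h s = g s.
  by rewrite /h; case: pselect => // Ws bs; apply: g1g; exact: bW'.
have clb v' w' : closed (lattice_box v' w') by exact: closed_box.
have cld v' w' : closed (lattice_bdry v' w').
  exact: conic_closed_bdry (conic_box _ _).
have Fh : F (lattice_bdry v w `|` lattice_box (upd v) (upd w)) h.
  apply: F_glue => //.
    by apply: F_ext Fg => s /hg.
  by apply: F_ext Fg1 => s Ws; rewrite /h; case: pselect.
have b1 : lattice_bdry v (upd w) `<=`
    lattice_bdry v w `|` lattice_box (upd v) (upd w).
  move=> s [K1s [i [lt H]]]; have [E|ii0] := eqVneq i i0; last first.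
    left; split; first exact: subK1.
    by exists i; move: lt H; rewrite !updN.
  subst i; case: H => H.
    by left; split; [exact: subK1|exists i0; split; [exact: lt_trans xw|left]].
  right=> i; have := K1s i; have [->|ii0] := eqVneq i i0; last by rewrite !updN.
  by rewrite H !updE lexx.
have b2 : lattice_bdry (upd v) w `<=`
    lattice_bdry v w `|` lattice_box (upd v) (upd w).
  move=> s [K2s [i [lt H]]]; have [E|ii0] := eqVneq i i0; last first.
    left; split; first exact: subK2.
    by exists i; move: lt H; rewrite !updN.
  subst i; case: H => H.
    right=> i; have := K2s i; have [->|ii0] := eqVneq i i0; last by rewrite !updN.
    by rewrite H !updE lexx.
  by left; split; [exact: subK2|exists i0; split; [exact: lt_trans xw|right]].
have [g2 [Fg2 g2h]] := IH _ _ sum1 vuw uwM h (F_sub b1 Fh).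
have [g3 [Fg3 g3h]] := IH _ _ sum2 uvw wM h (F_sub b2 Fh).
have W1 s : lattice_box (upd v) (upd w) s -> lattice_bdry v (upd w) s.
  move=> Ws; split; first exact: subW1.
  by exists i0; rewrite atc// updE; split=> //; right.
have W2 s : lattice_box (upd v) (upd w) s -> lattice_bdry (upd v) w s.
  move=> Ws; split; first exact: subW2.
  by exists i0; rewrite atc// updE; split=> //; left.
have KE : lattice_box v w = lattice_box v (upd w) `|` lattice_box (upd v) w.
  apply/seteqP; split=> s; last by case=> [/subK1|/subK2].
  move=> Ks; have [h0|/ltW h0] := leP (s ord0 i0) (x i0 c); [left|right] => i;
      have := Ks i; (have [->|ii0] := eqVneq i i0; last by rewrite updN);
      rewrite updE => /andP[a1 a2]; first by rewrite a1.
  by rewrite h0.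
pose g' s := if pselect (lattice_box v (upd w) s) then g2 s else g3 s.
have g23 s : lattice_box v (upd w) s -> lattice_box (upd v) w s -> g2 s = g3 s.
  move=> K1s K2s.
  have Ws : lattice_box (upd v) (upd w) s.
    by move=> i; have /andP[_ ->] := K1s i; have /andP[-> _] := K2s i.
  by rewrite g2h ?g3h//; [exact: W2|exact: W1].
exists g'; split.
  rewrite KE; apply: F_glue => //.
    by apply: F_ext Fg2 => s K1s; rewrite /g'; case: pselect.
  by apply: F_ext Fg3 => s K2s; rewrite /g'; case: pselect => // K1s; rewrite g23.
move=> s bs; have [Ks [i [lt H]]] := bs; rewrite -hg// /g'; case: pselect => K1s.
  apply: g2h; split=> //; exists i; move: lt H.
  have [->|ii0] := eqVneq i i0; last by rewrite updN.
  rewrite updE => _ [H|H]; split=> //; [by left|exfalso].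
  by have /andP[_] := K1s i0; rewrite updE H leNgt xw.
have K2s : lattice_box (upd v) w s by have : (lattice_box v (upd w) `|` lattice_box (upd v) w) s; [rewrite -KE|case].
apply: g3h; split=> //; exists i; move: lt H.
have [->|ii0] := eqVneq i i0; last by rewrite updN.
rewrite updE => _ [H|H]; split=> //; [exfalso|by right].
by have /andP[+ _] := K2s i0; rewrite updE H leNgt xv.
Qed.

End Grid.

(** * The simplex category and nondegenerate elements *)

Lemma ord_map_eq (m n : nat) (a b : ord_map m n) : a =1 b -> a = b.
Proof.
case: a b => [a ha] [b hb] /= ab; have E : a = b by apply/funext.
by subst b; congr OrdMap; exact: Prop_irrelevance.
Qed.

Section SimplexCategory.

Lemma collapse_subproof m (i : nat) (j : 'I_m.+1) :
  ((if j == i.+1 :> nat then i else j) < m.+1)%N.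
Proof. by case: eqP => // E; rewrite (ltn_trans _ (ltn_ord j)) ?E. Qed.

Lemma collapse_homo m i (j k : 'I_m.+1) : (j <= k)%N ->
  (Ordinal (collapse_subproof i j) <= Ordinal (collapse_subproof i k))%N.
Proof.
move=> /= jk; case: eqP => Ej; case: eqP => Ek //.
  by rewrite (leq_trans _ jk)// Ej.
by move: jk; rewrite Ek leq_eqVlt ltnS => /orP[/eqP|].
Qed.

(** An element is degenerate exactly when some [collapse m i] with [i < m] fixes it. Degeneracy thus
    becomes an equation inside the single space [Y m], without a witness of lower dimension. For
    [i >= m] the map is the identity. *)
Definition collapse m i : ord_map m m := OrdMap (@collapse_homo m i).

Lemma sdeg_subproof m (i : 'I_m.+1) (j : 'I_m.+2) :
  ((if (j <= i)%N then val j else j.-1) < m.+1)%N.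
Proof.
have := ltn_ord i; have := ltn_ord j; case: (leqP j i) => /=; lia.
Qed.

Lemma sdeg_homo m i (j k : 'I_m.+2) : (j <= k)%N ->
  (Ordinal (sdeg_subproof i j) <= Ordinal (sdeg_subproof i k))%N.
Proof.
by move=> /= jk; case: (leqP j i); case: (leqP k i); lia.
Qed.

Definition sdeg m i : ord_map m.+1 m := OrdMap (@sdeg_homo m i).

Lemma coface_homo m (c : 'I_m.+2) (j k : 'I_m.+1) : (j <= k)%N ->
  (lift c j <= lift c k)%N.
Proof. by move=> jk; rewrite /= leq_bump2. Qed.

Definition coface m c : ord_map m m.+1 := OrdMap (@coface_homo m c).

(** [dlow i] and [dhigh i] are the two vertices identified by [sdeg i]. The cofaces omitting them,
    composed with [sdeg i], are the idempotents that send [i] to [i.+1] and [i.+1] to [i]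
    respectively. *)
Definition dlow m (i : 'I_m.+1) : 'I_m.+2 := widen_ord (leqnSn _) i.
Definition dhigh m (i : 'I_m.+1) : 'I_m.+2 := lift ord0 i.

Lemma coface_dhigh m (i : 'I_m.+1) :
  ord_map_comp (coface (dhigh i)) (sdeg i) = collapse m.+1 i.
Proof.
apply: ord_map_eq => j; apply: val_inj; rewrite /= /bump /=.
by case: (leqP j i); case: eqP; lia.
Qed.

Lemma coface_dlow m (i : 'I_m.+1) (j : 'I_m.+2) :
  val (ord_map_comp (coface (dlow i)) (sdeg i) j) =
  if j == i :> nat then i.+1 else j.
Proof.
by rewrite /= /bump /=; case: (leqP j i); case: eqP; lia.
Qed.

Lemma ord_map_inj_le m n (b : ord_map m n) : injective b -> (m <= n)%N.
Proof. by move=> /leq_card; rewrite !card_ord. Qed.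

Lemma ord_map_gap m n (b : ord_map m n) : injective b ->
  forall i j : 'I_m.+1, (i <= j)%N -> (j - i <= b j - b i)%N.
Proof.
move=> bi i [j hj] /= ij; elim: j hj ij => [|j IH] hj ij.
  by move: ij; rewrite leqn0 => /eqP ->.
move: ij; rewrite leq_eqVlt => /orP[/eqP E|]; first by rewrite E subnn.
rewrite ltnS => ij; rewrite subSn//.
apply: leq_ltn_trans (IH (ltnW hj) ij) _.
have h : (b (Ordinal (ltnW hj)) < b (Ordinal hj))%N.
  rewrite ltn_neqAle omap_homo //= andbT; apply/eqP => /val_inj /bi /(congr1 val) /= /eqP.
  by rewrite ltn_eqF.
apply: ltn_sub2r => //; apply: leq_ltn_trans h; exact: omap_homo.
Qed.

Lemma ord_map_inj_id m (b : ord_map m m) : injective b -> b = ord_map_id m.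
Proof.
move=> bi; apply: ord_map_eq => i; apply: val_inj => /=.
apply/eqP; rewrite eqn_leq; apply/andP; split.
  have := ord_map_gap bi (leq_ord i : (i <= @ord_max m)%N).
  have := leq_ord (b ord_max); have := leq_ord (b i) => /=; have := leq_ord i.
  lia.
have := ord_map_gap bi (leq0n i : (@ord0 m <= i)%N); rewrite /= subn0.
by move=> h; apply: leq_trans h _; exact: leq_subr.
Qed.

End SimplexCategory.

Section EilenbergZilber.
Variable Y : simplicial_space.

Definition nondeg m (y : Y m) :=
  forall i : nat, (i < m)%N -> sact Y (collapse m i) y <> y.

Lemma sact_comp_app (m n p : nat) (b : ord_map n p) (a : ord_map m n) (y : Y p) :
  sact Y (ord_map_comp b a) y = sact Y a (sact Y b y).
Proof. by rewrite sact_comp. Qed.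

(** If [b i = b j] with [i < j], then [b] also agrees at [i] and [i.+1], so it absorbs
    [collapse m i], which would then fix [y]. *)
Lemma nondeg_inj m n (y : Y m) (z : Y n) (b : ord_map m n) :
  nondeg y -> y = sact Y b z -> injective b.
Proof.
move=> ny yz; suff H : forall i j : 'I_m.+1, (i < j)%N -> b i <> b j.
  move=> i j bij; apply: val_inj; case: (ltngtP i j) => // [/H|/H]; [by []|].
  by rewrite bij.
move=> i j ij bij; have im : (i < m)%N by apply: leq_trans ij (leq_ord j).
apply: (ny i im); rewrite {2}yz yz -sact_comp_app; congr (sact Y _ z).
apply: ord_map_eq => l; change (b (collapse m i l) = b l).
have cl : val (collapse m i l) = if val l == i.+1 then val i else val l by [].
have [li|li] := eqVneq (val l) i.+1; last first.
  by congr (b _); apply: val_inj; rewrite cl (negbTE li).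
rewrite li eqxx in cl; apply: val_inj; apply/eqP; rewrite eqn_leq.
apply/andP; split; first by apply: omap_homo; rewrite cl li.
apply: (@leq_trans (b j)); first by apply: omap_homo; rewrite li.
by rewrite -bij; apply: omap_homo; rewrite cl.
Qed.

(** Every section of a monotone surjection is monotone, so one may be chosen to pass through a
    prescribed point. *)
Lemma ord_map_section k m (a : ord_map k m) (j0 : 'I_k.+1) :
  (forall i, exists j, a j = i) ->
  exists d : ord_map m k, (forall i, a (d i) = i) /\ d (a j0) = j0.
Proof.
move=> sa; pose g i := if i == a j0 then j0 else sval (cid (sa i)).
have ag i : a (g i) = i by rewrite /g; case: eqP => // _; case: cid.
have gm (i j : 'I_m.+1) : (i <= j)%N -> (g i <= g j)%N.
  move=> ij; rewrite leqNgt; apply/negP => gji.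
  have := omap_homo a (ltnW gji); rewrite !ag => ji.
  have E : i = j by apply: val_inj; apply/eqP; rewrite eqn_leq ij.
  by rewrite E ltnn in gji.
by exists (OrdMap gm); split=> //=; rewrite /g eqxx.
Qed.

(** Uniqueness in the Eilenberg-Zilber lemma. A section [d] of [a] exhibits [y] as the pullback of
    [y'] along the composite of [d] and [a'], which is therefore injective. By symmetry [m = m'],
    and an injective monotone endomorphism is the identity. Taking [d] through each point [j] gives
    [a j = a' j]. *)
Lemma nondeg_unique m m' k (y : Y m) (y' : Y m') (a : ord_map k m)
    (a' : ord_map k m') :
  nondeg y -> nondeg y' -> (forall i, exists j, a j = i) ->
  (forall i, exists j, a' j = i) -> sact Y a y = sact Y a' y' ->
  existT (fun n => Y n : Type) m y = existT (fun n => Y n : Type) m' y' /\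
  forall j, a j = a' j :> nat.
Proof.
move=> ny ny' sa sa' aa'.
have yE (d : ord_map m k) : (forall i, a (d i) = i) ->
    y = sact Y (ord_map_comp a' d) y'.
  move=> ad; rewrite sact_comp_app -aa' -sact_comp_app.
  rewrite (_ : ord_map_comp a d = ord_map_id m) ?sact_id//.
  by apply: ord_map_eq => i /=.
have y'E (d : ord_map m' k) : (forall i, a' (d i) = i) ->
    y' = sact Y (ord_map_comp a d) y.
  move=> ad; rewrite sact_comp_app aa' -sact_comp_app.
  rewrite (_ : ord_map_comp a' d = ord_map_id m') ?sact_id//.
  by apply: ord_map_eq => i /=.
have [d0 [ad0 _]] := ord_map_section ord0 sa.
have [d0' [ad0' _]] := ord_map_section ord0 sa'.
have mm' := ord_map_inj_le (nondeg_inj ny (yE _ ad0)).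
have m'm := ord_map_inj_le (nondeg_inj ny' (y'E _ ad0')).
have E : m = m' by apply/eqP; rewrite eqn_leq mm'.
move: y' a' ny' sa' aa' yE y'E d0' ad0' {mm' m'm}.
case: m' / E => y' a' ny' sa' aa' yE y'E d0' ad0'; split.
  congr existT; rewrite {1}(yE _ ad0).
  by rewrite (ord_map_inj_id (nondeg_inj ny (yE _ ad0))) sact_id.
move=> j; have [d [ad dj]] := ord_map_section j sa.
have := ord_map_inj_id (nondeg_inj ny (yE _ ad)).
by move=> /(congr1 (fun b : ord_map m m => b (a j))) /=; rewrite dj => ->.
Qed.

End EilenbergZilber.

(** * Points of a simplex as step functions *)

Local Open Scope quotient_scope.

Section Theta.
Context {R : realType}.
Local Notation simplex := (@std_simplex R).

Definition bcoord m (t : simplex m) (i : 'I_m.+1) : R := simplex_val t ord0 i.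

Lemma bcoord_ge0 m (t : simplex m) i : 0 <= bcoord t i.
Proof. by have [h _] := set_valP t; exact: h. Qed.

Lemma bcoord_sum m (t : simplex m) : \sum_i bcoord t i = 1.
Proof. by have [_] := set_valP t. Qed.

Lemma simplex_eq m (t t' : simplex m) : (forall i, bcoord t i = bcoord t' i) -> t = t'.
Proof. by move=> h; apply: val_inj; apply/rowP => i; exact: h. Qed.

Lemma bcoord_push m n (a : ord_map m n) (t : simplex m) j :
  bcoord (simplex_push a t) j = \sum_(i | a i == j) bcoord t i.
Proof. by rewrite /bcoord /simplex_val /= mxE. Qed.

Definition cum m (t : simplex m) (j : nat) : R := \sum_(i < m.+1 | (i < j)%N) bcoord t i.

Lemma bcoord_sum_le m (t : simplex m) (P Q : pred 'I_m.+1) : (forall i, P i -> Q i) ->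
  \sum_(i | P i) bcoord t i <= \sum_(i | Q i) bcoord t i.
Proof.
move=> PQ; rewrite [leRHS](bigID P) /=.
have -> : \sum_(i | Q i && P i) bcoord t i = \sum_(i | P i) bcoord t i.
  by apply: eq_bigl => i; case: (boolP (P i)) => [/PQ ->|]; rewrite ?andbF.
by rewrite lerDl; apply: sumr_ge0 => i _; exact: bcoord_ge0.
Qed.

Lemma cum_mono m (t : simplex m) j j' : (j <= j')%N -> cum t j <= cum t j'.
Proof. by move=> jj'; apply: bcoord_sum_le => i ij; exact: leq_trans jj'. Qed.

Lemma cum_max m (t : simplex m) : cum t m.+1 = 1.
Proof. by rewrite -(bcoord_sum t); apply: eq_bigl => i; rewrite ltn_ord. Qed.

Lemma cumS m (t : simplex m) (j : 'I_m.+1) : cum t j.+1 = cum t j + bcoord t j.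
Proof.
rewrite /cum (bigD1 j) //= addrC; congr (_ + _).
by apply: eq_bigl => i; rewrite ltnS andbC ltn_neqAle.
Qed.

(** For [0 <= s < 1], the index of the interval containing [s] when [0, 1) is divided at the partial
    sums [cum t]; intervals of length 0 are skipped. For [s >= 1] it is the default [ord_max]. *)
Definition theta m (t : simplex m) (s : R) : 'I_m.+1 :=
  [arg min_(j < (@ord_max m) | (s < cum t j.+1)%R) val j]%N.

Lemma theta_le m (t : simplex m) s j : s < 1 ->
  (theta t s <= j)%N = (s < cum t j.+1).
Proof.
move=> s1; rewrite /theta; case: arg_minnP; first by rewrite cum_max.
move=> i si imin; apply/idP/idP => [ij|sj].
  by apply: lt_le_trans si (cum_mono _ _).
case: (leqP j m) => jm; last by rewrite ltnW// (leq_trans (ltn_ord i)).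
by have := imin (Ordinal (jm : (j < m.+1)%N)); apply.
Qed.

Lemma theta_spec m (t : simplex m) s : 0 <= s < 1 ->
  cum t (theta t s) <= s < cum t (theta t s).+1.
Proof.
move=> /andP[s0 s1]; rewrite -theta_le// leqnn andbT.
case E : (val (theta t s)) => [|j]; first by rewrite /cum big_pred0.
by rewrite leNgt -theta_le// E ltnn.
Qed.

Lemma theta_homo m (t : simplex m) s s' : s < 1 -> s' < 1 -> s <= s' ->
  (theta t s <= theta t s')%N.
Proof.
by move=> s1 s1' ss'; rewrite theta_le//; apply: (le_lt_trans ss'); rewrite -theta_le.
Qed.

(** Partial sums of the pushed point add up the coordinates in fibres of [a], and [a] is monotone.
    With step functions, the action on simplices becomes plain composition with [a]. *)
Lemma theta_push m n (a : ord_map m n) (t : simplex m) s : 0 <= s < 1 ->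
  theta (simplex_push a t) s = a (theta t s).
Proof.
move=> s01; have /andP[s0 s1] := s01.
have cumE j : cum (simplex_push a t) j = \sum_(i | (a i < j)%N) bcoord t i.
  rewrite /cum (eq_bigr _ (fun i _ => bcoord_push a t i)).
  rewrite [RHS](partition_big a (fun k : 'I_n.+1 => (k < j)%N)) //=.
  apply: eq_bigr => k kj; apply: eq_bigl => i.
  by case: eqP => [->|]; rewrite ?kj ?andbF.
have /andP[h1 h2] := theta_spec t s01.
apply: val_inj; apply/eqP; rewrite eqn_leq; apply/andP; split.
  rewrite theta_le// cumE; apply: lt_le_trans h2 _; apply: bcoord_sum_le => i.
  by rewrite !ltnS; exact: omap_homo.
rewrite leqNgt; apply/negP => lt.
have : s < cum (simplex_push a t) (theta (simplex_push a t) s).+1.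
  by have /andP[] := theta_spec (simplex_push a t) s01.
rewrite cumE ltNge => /negP; apply; apply: le_trans h1; apply: bcoord_sum_le => i.
rewrite ltnS ltnNge => h; apply/negP => /(omap_homo a).
by move=> /leq_trans /(_ h); rewrite leqNgt lt.
Qed.

Record times k := Times { time :> 'I_k.+1 -> R;
  time_homo : forall i j : 'I_k.+1, (i <= j)%N -> time i <= time j;
  time_itv : forall i, 0 <= time i < 1 }.

Lemma sample_subproof k m (t : simplex m) (s : times k) (i j : 'I_k.+1) :
  (i <= j)%N -> (theta t (s i) <= theta t (s j))%N.
Proof.
have /andP[_ ?] := time_itv s i; have /andP[_ ?] := time_itv s j.
by move=> ij; apply: theta_homo => //; exact: time_homo.
Qed.

(* A point t of the m-simplex is regarded as a step function [0, 1) -> [m]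
   whose value j is taken on an interval of length t_j; it is sampled at the
   times [s]. *)
Definition sample k m (t : simplex m) (s : times k) : ord_map k m :=
  OrdMap (@sample_subproof k m t s).

Lemma times_of (l : seq R) : l != [::] -> (forall x, x \in l -> 0 <= x < 1) ->
  exists k (s : times k), forall x, x \in l -> exists j, s j = x.
Proof.
move=> l0 lP; have zl : (0 < size l)%N by case: (l) l0.
have szE : (size l).-1.+1 = size l by rewrite prednK.
pose s (i : 'I_(size l).-1.+1) := nth 0 (sort <=%R l) i.
have sz (i : 'I_(size l).-1.+1) : (i < size (sort <=%R l))%N.
  by rewrite size_sort -[X in (_ < X)%N]szE.
have sP i : 0 <= s i < 1 by apply: lP; rewrite -(mem_sort <=%R) mem_nth.
have sh (i j : 'I_(size l).-1.+1) : (i <= j)%N -> s i <= s j.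
  move=> ij; have h := @sorted_leq_nth R <=%R le_trans lexx 0 _ (sort_le_sorted l).
  by apply: (h (val i) (val j)) => //; rewrite inE; exact: sz.
exists (size l).-1, (Times sh sP) => x; rewrite -(mem_sort <=%R) => xl.
have h : (index x (sort <=%R l) < (size l).-1.+1)%N.
  by rewrite szE -(size_sort <=%R) index_mem.
by exists (Ordinal h); rewrite /= /s /= nth_index.
Qed.

Definition interior_pt m (t : simplex m) := forall i, 0 < bcoord t i.

(** At an interior point every interval has positive length and contains its left end. *)
Lemma theta_cum m (t : simplex m) (j : 'I_m.+1) : interior_pt t ->
  0 <= cum t j < 1 /\ theta t (cum t j) = j.
Proof.
move=> it; have c0 : 0 <= cum t j by apply: sumr_ge0 => i _; exact: bcoord_ge0.
have c1 : cum t j < 1.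
  apply: (@lt_le_trans _ _ (cum t j.+1)); first by rewrite cumS ltrDl.
  by rewrite -(cum_max t); exact: cum_mono.
split; first by rewrite c0.
apply: val_inj; apply/eqP; rewrite eqn_leq; apply/andP; split.
  by rewrite theta_le// cumS ltrDl.
have /andP[_ h] : cum t (theta t (cum t j)) <= cum t j < cum t (theta t (cum t j)).+1.
  by apply: theta_spec; rewrite c0.
rewrite leqNgt; apply/negP => /(cum_mono t); rewrite leNgt => /negP; apply.
exact: h.
Qed.

Lemma theta_inj m (t t' : simplex m) : interior_pt t -> interior_pt t' ->
  (forall s, 0 <= s < 1 -> theta t s = theta t' s) -> t = t'.
Proof.
move=> it it' h.
have H (u u' : simplex m) : interior_pt u -> (forall s, 0 <= s < 1 -> theta u s = theta u' s) ->
    forall j : 'I_m.+1, cum u' j <= cum u j.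
  move=> iu hu j; have [c01 E] := theta_cum j iu.
  by have /andP[] := theta_spec u' c01; rewrite -hu// E.
have E (j : nat) : (j <= m.+1)%N -> cum t j = cum t' j.
  rewrite leq_eqVlt => /orP[/eqP ->|jm]; first by rewrite !cum_max.
  apply/eqP; rewrite eq_le (H t t' it h (Ordinal jm)) andbT.
  by apply: (H t' t it' _ (Ordinal jm)) => s /h.
apply: simplex_eq => i; apply: (addrI (cum t i)); rewrite -cumS.
by rewrite !E// ?(ltnW (ltn_ord i))// -cumS.
Qed.

End Theta.

(** * Uniqueness of the reduced representative of a point *)

Section Reduced.
Context {R : realType} (Y : simplicial_space).
Local Notation simplex := (@std_simplex R).

Definition rpt m (y : Y m) (t : simplex m) : realization R Y :=
  \pi_(realization R Y) (realization_pt y t).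

Lemma rpt_push m n (a : ord_map m n) (y : Y n) (t : simplex m) :
  rpt (sact Y a y) t = rpt y (simplex_push a t).
Proof.
apply/eqmodP; apply/asboolP; apply: rst_step; exact: RealizationStep.
Qed.

Definition sampled k (u : realization_total R Y) (s : times k) : Y k :=
  sact Y (sample (projT2 u).2 s) (projT2 u).1.

(** A generating step moves [a] from the element to the simplex coordinate; by [theta_push] the
    pullback along the sampled map does not notice. This gives invariants of points of the
    realization without an analysis of the generated equivalence relation. *)
Lemma rpt_sampled m m' (y : Y m) (t : simplex m) (y' : Y m') (t' : simplex m') :
  rpt y t = rpt y' t' -> forall k (s : times k),
  sact Y (sample t s) y = sact Y (sample t' s) y'.
Proof.
move=> /eqmodP /asboolP H k s.
suff : sampled (realization_pt y t) s = sampled (realization_pt y' t') s by [].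
elim: H => // {m m' y t y' t'} [_ _ [m n a y t]|u v w _ -> _ ->] //.
rewrite /sampled /= -sact_comp_app; congr (sact Y _ y).
by apply: ord_map_eq => i /=; rewrite theta_push ?time_itv.
Qed.

Definition reduced m (y : Y m) (t : simplex m) := nondeg y /\ interior_pt t.

(** Both step functions are sampled at the left ends of all their intervals and at one further time
    [x]. The sampled maps are then surjective, so [nondeg_unique] yields equal elements and equal
    values at [x]. As [x] is arbitrary, the step functions agree. *)
Lemma reduced_unique m m' (y : Y m) (t : simplex m) (y' : Y m') (t' : simplex m') :
  reduced y t -> reduced y' t' -> rpt y t = rpt y' t' ->
  existT (fun n => (Y n * simplex n)%type : Type) m (y, t) =
  existT (fun n => (Y n * simplex n)%type : Type) m' (y', t').
Proof.
move=> [ny it] [ny' it'] E.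
have key x : 0 <= x < 1 -> existT (fun n => Y n : Type) m y =
    existT (fun n => Y n : Type) m' y' /\ theta t x = theta t' x :> nat.
  move=> x01.
  pose l := x :: [seq cum t (val j) | j : 'I_m.+1] ++ [seq cum t' (val j) | j : 'I_m'.+1].
  have [//|z|k [s sP]] := @times_of R l.
    rewrite inE mem_cat => /orP[/eqP->//|/orP[/mapP|/mapP] [j _ ->]].
      by have [] := theta_cum j it.
    by have [] := theta_cum j it'.
  have sa i : exists j, sample t s j = i.
    have [|j sj] := sP (cum t i).
      rewrite inE mem_cat; apply/orP; right; apply/orP; left.
      by apply/mapP; exists i; rewrite ?mem_enum.
    by exists j; rewrite /= sj; have [] := theta_cum i it.
  have sa' i : exists j, sample t' s j = i.
    have [|j sj] := sP (cum t' i).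
      rewrite inE mem_cat; apply/orP; right; apply/orP; right.
      by apply/mapP; exists i; rewrite ?mem_enum.
    by exists j; rewrite /= sj; have [] := theta_cum i it'.
  have [-> H] := nondeg_unique ny ny' sa sa' (rpt_sampled E s); split=> //.
  have [|j sj] := sP x; first by rewrite inE eqxx.
  by have /= := H j; rewrite sj.
have h0 : 0 <= (0 : R) < 1 by rewrite lexx ltr01.
have [yy' _] := key 0 h0.
have mm' : m = m' by exact: (congr1 (@projT1 _ _) yy').
move: y' t' ny' it' E key yy'; case: m' / mm' => y' t' ny' it' E key yy'.
have -> : y = y' by exact: inj_pair2_eq_dec PeanoNat.Nat.eq_dec _ _ _ _ yy'.
have -> // : t = t'.
by apply: theta_inj => // s s01; apply: val_inj; have [] := key s s01.
Qed.

End Reduced.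

(** * Cells of a realization *)

Lemma closed_exists {X : topologicalType} (J : finType) (P : J -> set X) :
  (forall j, closed (P j)) -> closed [set x | exists j, P j x].
Proof.
move=> cP; rewrite -openC openE => x nx; rewrite /interior.
have : \forall y \near x, forall j, (~` P j) y.
  apply: filter_forall => j; apply: open_nbhs_nbhs; split; last first.
    by move=> Px; apply: nx; exists j.
  exact: closed_openC.
by apply: filterS => y H [j]; exact: H.
Qed.

Lemma cont_on_set_type {X Y : topologicalType} (A : set X) (D : set Y)
    (f : X -> set_type D) :
  cont_on A (fun x => set_val (f x)) -> cont_on A f.
Proof.
move=> cf x Ax O [_ [/= [P oP <-] Pf] PO].
have nP : nbhs (set_val (f x)) P by exact: open_nbhs_nbhs.
have := cf x Ax _ nP; rewrite !nbhs_simpl /=.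
by apply: filterS => y Py; exact: PO.
Qed.

Section Simplex.
Context {R : realType}.
Local Notation simplex := (@std_simplex R).

Lemma cont_on_co m (A : set (simplex m)) i : cont_on A (fun t => bcoord t i).
Proof.
apply: cont_on_coord; apply: cont_on_continuous; exact: initial_continuous.
Qed.

Lemma cont_on_simplex (X : topologicalType) m (A : set X) (f : X -> simplex m) :
  (forall i, cont_on A (fun x => bcoord (f x) i)) -> cont_on A f.
Proof. by move=> cf; apply: cont_on_set_type; apply: cont_on_row => i; exact: cf. Qed.

Lemma push_continuous m n (a : ord_map m n) :
  continuous (@simplex_push R m n a).
Proof.
apply: cont_onT; apply: cont_on_simplex => j.
apply: (@cont_on_ext _ _ _ (fun t => \sum_(i | a i == j) bcoord t i)).
  by move=> t _; rewrite bcoord_push.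
by apply: cont_on_sum => i _; exact: cont_on_co.
Qed.

Lemma closed_simplex1 m (t0 : simplex m) : closed [set t0].
Proof.
have -> : [set t0] = \bigcap_(i in [set: 'I_m.+1])
    ((fun t => bcoord t i) @^-1` [set bcoord t0 i]).
  apply/seteqP; split=> [t -> i //|t H]; apply: simplex_eq => i; exact: (H i).
apply: closed_bigI => i _; apply: closed_preim; last exact: closed_eq.
by apply: cont_onT; exact: cont_on_co.
Qed.

Lemma closed_co0 m i : closed [set t : simplex m | bcoord t i = 0].
Proof.
apply: (@closed_preim _ _ (fun t : simplex m => bcoord t i) [set 0]).
  by apply: cont_onT; exact: cont_on_co.
exact: closed_eq.
Qed.

Lemma closed_not_interior m : closed [set t : simplex m | ~ interior_pt t].
Proof.
have -> : [set t : simplex m | ~ interior_pt t] = [set t | exists i, bcoord t i = 0].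
  apply/seteqP; split=> t /= => [/existsNP[i /negP]|[i i0] /(_ i)].
    by rewrite -leNgt => h; exists i; apply/eqP; rewrite eq_le h bcoord_ge0.
  by rewrite i0 ltxx.
by apply: closed_exists => i; exact: closed_co0.
Qed.

End Simplex.

Section Cells.
Context {R : realType} (Y : simplicial_space).
Local Notation simplex := (@std_simplex R).
Hypothesis degP : forall m i, (i < m)%N ->
  clopen [set y | sact Y (collapse m i) y = y].

(** When coordinate [i] vanishes, [t] is fixed by the idempotent sending [i] to [i.+1]. This
    idempotent factors through the m-simplex, and its coface can be passed on to [y]. *)
Lemma rpt_low m (i : 'I_m.+1) (y : Y m.+1) (t : simplex m.+1) :
  bcoord t (dlow i) = 0 ->
  rpt y t = rpt (sact Y (coface (dlow i)) y) (simplex_push (sdeg i) t).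
Proof.
move=> t0; rewrite rpt_push; congr rpt; apply: simplex_eq => j.
rewrite !bcoord_push (eq_bigr _ (fun i _ => bcoord_push _ t i)).
pose a := ord_map_comp (coface (dlow i)) (sdeg i).
have aE l : val (a l) = if l == i :> nat then i.+1 else l by exact: coface_dlow.
transitivity (\sum_(l | a l == j) bcoord t l); last first.
  rewrite (partition_big (sdeg i) (fun k => coface (dlow i) k == j)) //=.
  apply: eq_bigr => k kj; apply: eq_bigl => l.
  apply/idP/idP => [/andP[_ ->//]|/eqP lk].
  by apply/andP; split; [rewrite -(eqP kj) -lk|rewrite lk].
rewrite [RHS](bigID (pred1 (dlow i))) /=.
rewrite [X in X + _]big1 ?add0r; last by move=> l /andP[_ /eqP ->].
have [->|ji] := eqVneq j (dlow i).
  rewrite t0 big1// => l /andP[/eqP h /eqP]; case; apply: val_inj.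
  have {h} := congr1 val (h : a l = dlow i); rewrite aE /=.
  by case: eqP => // _; lia.
rewrite (big_pred1 j) // => l.
change ((a l == j) && (l != dlow i) = (l == j)); have [->|lj] := eqVneq l j.
  rewrite ji andbT; apply/eqP/val_inj; rewrite aE.
  by case: eqP => // E; case/eqP: ji; apply: val_inj.
apply/negP => /andP[/eqP h li]; case/eqP: lj; apply: val_inj.
by rewrite -h aE; case: eqP => // E; case/eqP: li; apply: val_inj.
Qed.

Lemma collapse_co0 m (i : nat) (t : simplex m) (j0 : 'I_m.+1) :
  j0 = i.+1 :> nat -> bcoord t j0 = 0 -> simplex_push (collapse m i) t = t.
Proof.
move=> ij t0; apply: simplex_eq => j; rewrite bcoord_push.
have cE l : val (collapse m i l) = if val l == i.+1 then i else val l by [].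
rewrite (bigID (pred1 j0)) /=.
rewrite [X in X + _]big1 ?add0r; last by move=> l /andP[_ /eqP ->].
have [->|ji] := eqVneq j j0.
  rewrite t0 big1// => l /andP[/eqP h /eqP]; case; apply: val_inj.
  have {h} := congr1 val (h : collapse m i l = j0); rewrite cE /=.
  by case: eqP => /=; lia.
rewrite (big_pred1 j) // => l; change ((collapse m i l == j) && (l != j0) = (l == j)).
have [->|lj] := eqVneq l j.
  rewrite ji andbT; apply/eqP/val_inj; rewrite cE.
  by case: eqP => // E; case/eqP: ji; apply: val_inj; exact: etrans E (esym ij).
apply/negP => /andP[/eqP h li]; case/eqP: lj; apply: val_inj.
by rewrite -h cE; case: eqP => // E; case/eqP: li; apply: val_inj; exact: etrans E (esym ij).
Qed.

(** The same with the collapse of [i.+1] to [i], which may fix either [t] or [y]. Both cases lead to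
    one and the same representative of lower dimension. *)
Lemma rpt_high m (i : 'I_m.+1) (y : Y m.+1) (t : simplex m.+1) :
  bcoord t (dhigh i) = 0 \/ sact Y (collapse m.+1 i) y = y ->
  rpt y t = rpt (sact Y (coface (dhigh i)) y) (simplex_push (sdeg i) t).
Proof.
have E : rpt (sact Y (collapse m.+1 i) y) t =
    rpt (sact Y (coface (dhigh i)) y) (simplex_push (sdeg i) t).
  by rewrite -coface_dhigh sact_comp_app rpt_push.
case=> [t0|yy]; rewrite -E; last by rewrite yy.
by rewrite rpt_push (@collapse_co0 _ i _ (dhigh i)).
Qed.

Lemma not_reduced m (y : Y m.+1) (t : simplex m.+1) : ~ reduced y t ->
  exists i : 'I_m.+1, bcoord t (dlow i) = 0 \/
    (bcoord t (dhigh i) = 0 \/ sact Y (collapse m.+1 i) y = y).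
Proof.
move=> /not_andP[/existsNP[i /not_implyP[im /contrapT yi]]|/existsNP[j /negP]].
  by exists (Ordinal im); right; right.
rewrite -leNgt => tj; have {}tj : bcoord t j = 0 by apply/eqP; rewrite eq_le tj bcoord_ge0.
have [jm|jm] := ltnP j m.+1.
  by exists (Ordinal jm); left; rewrite -tj; congr bcoord; apply: val_inj.
exists ord_max; right; left; rewrite -tj; congr bcoord; apply: val_inj => /=.
by have := ltn_ord j; rewrite /bump; lia.
Qed.

Lemma reduced0 (y : Y 0) (t : simplex 0) : reduced y t.
Proof.
split=> // i; rewrite (ord1 i); have := bcoord_sum t.
by rewrite big_ord_recl big_ord0 addr0 => ->.
Qed.

Lemma rpt_reduced m (y : Y m) (t : simplex m) :
  exists p, (p <= m)%N /\ (~ reduced y t -> (p < m)%N) /\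
  exists (y' : Y p) (t' : simplex p), reduced y' t' /\ rpt y t = rpt y' t'.
Proof.
elim: m y t => [|m IH] y t.
  by exists 0; split=> //; split; [case; exact: reduced0|exists y, t; split=> //; exact: reduced0].
have [r|nr] := pselect (reduced y t).
  by exists m.+1; split=> //; split=> //; exists y, t.
have [y1 [t1 E]] : exists (y1 : Y m) (t1 : simplex m), rpt y t = rpt y1 t1.
  have [i [/rpt_low ->|/rpt_high ->]] := not_reduced nr.
    by do 2!eexists.
  by do 2!eexists.
have [p [pm [_ [y' [t' [r' E']]]]]] := IH y1 t1.
exists p; split; first exact: leqW.
by split=> //; exists y', t'; rewrite E.
Qed.

Definition is_cell n (z : realization R Y) :=
  exists (y : Y n) (t : simplex n), reduced y t /\ z = rpt y t.

(** Dimensions strictly below [n], one less than in the usual numbering: [sk 0] is empty and starts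
    the induction. *)
Definition sk n (z : realization R Y) := exists p, (p < n)%N /\ is_cell p z.

Lemma rpt_surj (z : realization R Y) :
  exists m (y : Y m) (t : simplex m), z = rpt y t.
Proof.
exists (projT1 (repr z)), (projT2 (repr z)).1, (projT2 (repr z)).2.
rewrite /rpt -[LHS]reprK; congr (\pi_(_) _).
by case: (repr z) => m [y t].
Qed.

Lemma is_cell_ex z : exists n, is_cell n z.
Proof.
have [m [y [t ->]]] := rpt_surj z.
have [p [_ [_ [y' [t' [r E]]]]]] := rpt_reduced y t.
by exists p, y', t'.
Qed.

Lemma is_cell_unique m n z : is_cell m z -> is_cell n z -> m = n.
Proof.
move=> [y [t [r ->]]] [y' [t' [r' E]]].
by have /(congr1 (@projT1 _ _)) := reduced_unique r r' E.
Qed.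

Lemma rpt_inj n (y y' : Y n) (t t' : simplex n) :
  reduced y t -> reduced y' t' -> rpt y t = rpt y' t' -> y = y' /\ t = t'.
Proof.
move=> r r' E; have := reduced_unique r r' E.
by move=> /(@inj_pair2_eq_dec nat PeanoNat.Nat.eq_dec _ _ _ _) [].
Qed.

Lemma sk_le m n z : (m <= n)%N -> sk m z -> sk n z.
Proof. by move=> mn [p [pm c]]; exists p; split=> //; exact: leq_trans mn. Qed.

Lemma sk_rpt m n (y : Y m) (t : simplex m) : (m < n)%N -> sk n (rpt y t).
Proof.
move=> mn; have [p [pm [_ [y' [t' [r E]]]]]] := rpt_reduced y t.
by exists p; split; [exact: leq_ltn_trans mn|exists y', t'].
Qed.

Lemma sk_not_reduced m (y : Y m) (t : simplex m) :
  ~ reduced y t -> sk m (rpt y t).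
Proof.
move=> nr; have [p [_ [/(_ nr) pm [y' [t' [r E]]]]]] := rpt_reduced y t.
by exists p; split=> //; exists y', t'.
Qed.

Lemma sk_not_cell n m z : (n <= m)%N -> sk n z -> ~ is_cell m z.
Proof.
move=> nm [p [pn c]] /(is_cell_unique c) E.
by move: (leq_trans pn nm); rewrite E ltnn.
Qed.

Lemma skS n z : sk n.+1 z <-> sk n z \/ is_cell n z.
Proof.
split=> [[p []]|[|c]]; last by exists n.
  rewrite ltnS leq_eqVlt => /orP[/eqP ->|pn c]; first by right.
  by left; exists p.
exact: sk_le.
Qed.

Lemma rpt_continuous m : continuous (fun x : Y m * simplex m => rpt x.1 x.2).
Proof.
move=> x; rewrite /rpt.
have -> : (fun x : Y m * simplex m => \pi_(realization R Y) (realization_pt x.1 x.2)) =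
    \pi_(realization R Y) \o existT (fun n => (Y n * simplex n)%type) m.
  by apply/funext => -[].
apply: continuous_comp; first exact: existT_continuous.
exact: pi_continuous.
Qed.

Lemma closed_rpt (C : set (realization R Y)) :
  (forall m, closed [set x : Y m * simplex m | C (rpt x.1 x.2)]) -> closed C.
Proof.
move=> H; rewrite -openC; change (open (\pi_(realization R Y) @^-1` (~` C))).
apply/sigT_openP => m; have := H m; rewrite -openC.
congr open; apply/seteqP; split=> [[y t]|[y t]] //.
Qed.

(* Only reduced representatives matter: the other ones factor through lower
   dimensions along finitely many faces and degeneracies, which are closed. *)
Lemma closed_cells (C : set (realization R Y))
    (B : forall m, set (Y m * simplex m)) :
  (forall m, closed (B m)) ->
  (forall m (y : Y m) t, reduced y t -> C (rpt y t) -> B m (y, t)) ->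
  (forall m (y : Y m) t, B m (y, t) -> C (rpt y t)) -> closed C.
Proof.
move=> cB CB BC; apply: closed_rpt; elim=> [|m IH].
  have -> : [set x : Y 0 * simplex 0 | C (rpt x.1 x.2)] = B 0; last exact: cB.
  apply/seteqP; split=> -[y t] /=; last exact: BC.
  by apply: CB; exact: reduced0.
pose phi c i (x : Y m.+1 * simplex m.+1) := (sact Y (@coface m c) x.1, simplex_push (@sdeg m i) x.2).
have cphi c i : continuous (phi c i).
  apply: cont_onT; apply: cont_on_pair; apply: cont_on_comp_continuous.
  - exact: cts_fun.
  - exact: cont_on_fst.
  - exact: push_continuous.
  - exact: cont_on_snd.
pose P c i := phi c i @^-1` [set x : Y m * simplex m | C (rpt x.1 x.2)].
pose E1 i := (snd @^-1` [set t : simplex m.+1 | bcoord t (dlow i) = 0]) `&` P (dlow i) i.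
pose E2 i := ((snd @^-1` [set t : simplex m.+1 | bcoord t (dhigh i) = 0]) `|`
   (fst @^-1` [set y | sact Y (collapse m.+1 i) y = y])) `&` P (dhigh i) i.
have -> : [set x : Y m.+1 * simplex m.+1 | C (rpt x.1 x.2)] =
    B m.+1 `|` [set x | exists i : 'I_m.+1, (E1 i `|` E2 i) x].
  apply/seteqP; split=> -[y t] /=.
    move=> Cx; have [r|/not_reduced[i H]] := pselect (reduced y t).
      by left; exact: CB.
    right; exists i; case: H => [h|h]; [left|right]; split=> //.
      by rewrite /P /phi /= -rpt_low.
    by rewrite /P /phi /= -rpt_high.
  case=> [|[i [] []]]; first exact: BC.
    by move=> /= t0; rewrite /P /phi /= -rpt_low.
  by move=> h; rewrite /P /phi /= -rpt_high.
apply: closedU => //; apply: closed_exists => i.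
have cP c : closed (P c i) by apply: closed_preim.
apply: closedU; apply: closedI => //.
  by apply: closed_preim; [exact: snd_continuous|exact: closed_co0].
apply: closedU.
  by apply: closed_preim; [exact: snd_continuous|exact: closed_co0].
apply: closed_preim; first exact: fst_continuous.
by have [] := degP (ltn_ord i).
Qed.

Lemma closed_nondeg m : closed [set y : Y m | nondeg y].
Proof.
have -> : [set y : Y m | nondeg y] =
    \bigcap_(i in [set i | (i < m)%N]) ~` [set y | sact Y (collapse m i) y = y].
  by apply/seteqP; split=> y H i; exact: H.
by apply: closed_bigI => i im; apply: open_closedC; have [] := degP im.
Qed.

Lemma closed_deg m : closed [set y : Y m | ~ nondeg y].
Proof.
have -> : [set y : Y m | ~ nondeg y] =
    [set y | exists i : 'I_m, sact Y (collapse m i) y = y].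
  apply/seteqP; split=> y /=.
    by move=> /existsNP[i /not_implyP[im /contrapT yi]]; exists (Ordinal im).
  by move=> [i yi] /(_ i (ltn_ord i)).
by apply: closed_exists => i; have [] := degP (ltn_ord i).
Qed.

End Cells.

(** * Maps on skeleta *)

(** Tube lemma: by compactness of [J], the open condition persists near [x] uniformly in [u]. *)
Lemma closed_proj {R : realType} {X Z : topologicalType} (J I : set R)
    (h : X * R -> Z) (O : set Z) :
  compact J -> J `<=` I -> open O -> cont_on (setT `*` I) h ->
  closed [set x | exists u, J u /\ ~ O (h (x, u))].
Proof.
move=> cJ JI oO ch; rewrite -openC openE => x nx; rewrite /interior.
have Oh u : J u -> O (h (x, u)).
  by move=> Ju; apply: contrapT => nO; apply: nx; exists u.
have /compact_near_coveringP/near_covering_withinP cov := cJ.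
have := cov X (nbhs x) (fun x' u => O (h (x', u))) _ _.
move=> /(_ _) H; have {H} : \forall x' \near x, J `<=` (fun u => O (h (x', u))).
  apply: H => u Ju.
  have Txu : (setT `*` I) (x, u) by split=> //; exact: JI.
  have nO : nbhs (h (x, u)) O by apply: open_nbhs_nbhs; split=> //; exact: Oh.
  have := ch _ Txu O nO; rewrite !nbhs_simpl /= /within /= => -[[P Q] [/= nP nQ] PQ].
  exists (Q, P) => //= -[u' x'] [/= Qu Px] Ju'.
  by apply: (PQ (x', u')) => //; split=> //; exact: JI.
by apply: filterS => x' H [u [/H]].
Qed.

Section MoreSimplex.
Context {R : realType}.
Local Notation simplex := (@std_simplex R).

(** Normalized to be 1 at the barycentre; it is 0 exactly on the boundary. *)
Definition mu_t m (t : simplex m) : R := m.+1%:R * \big[Num.min/1]_i bcoord t i.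

Lemma mu_t_le m (t : simplex m) i : mu_t t <= m.+1%:R * bcoord t i.
Proof. by rewrite /mu_t ler_pM2l ?ltr0n//; exact: bigmin_le. Qed.

Lemma mu_t_ge0 m (t : simplex m) : 0 <= mu_t t.
Proof.
apply: mulr_ge0 => //; apply: le_bigmin => // i _; exact: bcoord_ge0.
Qed.

Lemma mu_t_le1 m (t : simplex m) : mu_t t <= 1.
Proof.
rewrite -(bcoord_sum t) /mu_t mulr_natl -[X in _ *+ X](card_ord m.+1) -sumr_const.
by apply: ler_sum => i _; exact: bigmin_le.
Qed.

Lemma mu_t_gt0 m (t : simplex m) : interior_pt t <-> 0 < mu_t t.
Proof.
split=> [it|mt i].
  by apply: mulr_gt0; rewrite ?ltr0n//; apply: lt_bigmin.
by have := lt_le_trans mt (mu_t_le t i); rewrite pmulr_rgt0 ?ltr0n.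
Qed.

Lemma mu_t_eq0 m (t : simplex m) : ~ interior_pt t <-> mu_t t = 0.
Proof.
split=> [ni|mt /mu_t_gt0]; last by rewrite mt ltxx.
by apply/eqP; rewrite eq_le mu_t_ge0 andbT leNgt; apply/negP => /mu_t_gt0.
Qed.

Lemma mu_t_attained m (t : simplex m) : exists i, mu_t t = m.+1%:R * bcoord t i.
Proof.
have co1 i : bcoord t i <= 1.
  by rewrite -(bcoord_sum t) (bigD1 i) //= lerDl; apply: sumr_ge0 => j _; exact: bcoord_ge0.
have [i _ Ei] := eq_bigmin ord0 xpredT (bcoord t) isT (fun i _ => co1 i).
by exists i; rewrite /mu_t Ei.
Qed.

Lemma cont_on_mu_t m (A : set (simplex m)) : cont_on A (@mu_t m).
Proof.
apply: cont_on_mul; first exact: cont_on_cst.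
suff H (r : seq 'I_m.+1) : cont_on A (fun t => \big[Num.min/1]_(i <- r) bcoord t i) by exact: H.
elim: r => [|i r IH].
  by apply: (@cont_on_ext _ _ _ (fun=> (1 : R))); [move=> t _; rewrite big_nil|exact: cont_on_cst].
apply: (@cont_on_ext _ _ _ (fun t => Num.min (bcoord t i) (\big[Num.min/1]_(i <- r) bcoord t i))).
  by move=> t _; rewrite big_cons.
by apply: cont_on_min => //; exact: cont_on_co.
Qed.

(** The weight c of the barycentre that [grow] takes out: [t] is c times the barycentre plus 1 - c
    times [grow u t]. The bound [mu_t t] keeps the coordinates nonnegative, the bound 1/2 keeps 1 -
    c away from 0, and [u] is clamped so that the formula makes sense for all reals. *)
Definition shrink m (u : R) (t : simplex m) : R :=
  Num.max 0 (Num.min 1 u) * Num.min (mu_t t) (1 / 2).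

Lemma shrinkP m u (t : simplex m) :
  [/\ 0 <= shrink u t, shrink u t <= 1 / 2 & shrink u t <= mu_t t].
Proof.
have u0 : 0 <= Num.max 0 (Num.min 1 u) by rewrite le_max lexx.
have u1 : Num.max 0 (Num.min 1 u) <= 1 by rewrite ge_max ler01 ge_min lexx.
have m0 : 0 <= Num.min (mu_t t) (1 / 2) by rewrite le_min mu_t_ge0 /=; lra.
have h : shrink u t <= Num.min (mu_t t) (1 / 2).
  by rewrite /shrink -[leRHS]mul1r ler_wpM2r.
split; first exact: mulr_ge0.
  by apply: le_trans h _; rewrite ge_min lexx orbT.
by apply: le_trans h _; rewrite ge_min lexx.
Qed.

Definition grow_fun m u (t : simplex m) : 'rV[R]_m.+1 :=
  \row_i ((bcoord t i - shrink u t / m.+1%:R) / (1 - shrink u t)).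

Lemma grow_subproof m u (t : simplex m) : grow_fun u t \in
    [set t : 'rV[R]_m.+1 | (forall i, 0 <= t ord0 i) /\ \sum_i t ord0 i = 1].
Proof.
have [c0 c1 c2] := shrinkP u t.
rewrite inE; split=> [i|].
  rewrite mxE; apply: divr_ge0; last by lra.
  rewrite subr_ge0 ler_pdivrMr ?ltr0n// mulrC; apply: le_trans c2 _.
  exact: mu_t_le.
under eq_bigr do rewrite mxE.
rewrite -mulr_suml sumrB bcoord_sum sumr_const card_ord -[X in _ - X]mulr_natr mulfVK ?pnatr_eq0//.
by rewrite divff//; lra.
Qed.

(* Pushes [t] away from the barycentre; at [u = 1] all the points outside the
   half-size simplex have reached the boundary. *)
Definition grow m (u : R) (t : simplex m) : simplex m :=
  exist _ (grow_fun u t) (grow_subproof u t).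

Lemma bcoord_grow m u (t : simplex m) i :
  bcoord (grow u t) i = (bcoord t i - shrink u t / m.+1%:R) / (1 - shrink u t).
Proof. by rewrite /bcoord /simplex_val /= mxE. Qed.

Lemma grow0 m (t : simplex m) : grow 0 t = t.
Proof.
apply: simplex_eq => i; rewrite bcoord_grow /shrink.
have -> : Num.max 0 (Num.min 1 0) = 0 :> R.
  by rewrite (min_idPr _) ?ler01// maxxx.
by rewrite !mul0r !subr0 divr1.
Qed.

Lemma grow_bdry m u (t : simplex m) : ~ interior_pt t -> grow u t = t.
Proof.
move=> /mu_t_eq0 t0; apply: simplex_eq => i; rewrite bcoord_grow /shrink t0.
have -> : Num.min 0 (1 / 2) = 0 :> R by rewrite (min_idPl _)//; lra.
by rewrite !mulr0 mul0r !subr0 divr1.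
Qed.

Lemma mu_grow m u (t : simplex m) :
  mu_t (grow u t) <= mu_t t.
Proof.
have [c0 c1 c2] := shrinkP u t; have d0 : 0 < 1 - shrink u t by lra.
have [i Ei] := mu_t_attained t.
apply: le_trans (mu_t_le _ i) _; rewrite bcoord_grow.
have -> : m.+1%:R * ((bcoord t i - shrink u t / m.+1%:R) / (1 - shrink u t)) =
    (mu_t t - shrink u t) / (1 - shrink u t).
  rewrite Ei mulrA; congr (_ / _); rewrite mulrBr; congr (_ - _).
  by rewrite mulrC mulfVK// pnatr_eq0.
rewrite ler_pdivrMr//; have := mu_t_le1 t; have := mu_t_ge0 t; nra.
Qed.

Lemma mu_grow1 m (t : simplex m) : mu_t t <= 1 / 2 -> mu_t (grow 1 t) = 0.
Proof.
move=> t12; have E : shrink 1 t = mu_t t.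
  by rewrite /shrink minxx (max_idPr _) ?ler01// mul1r (min_idPl _).
apply/eqP; rewrite eq_le mu_t_ge0 andbT.
have [i Ei] := mu_t_attained t.
apply: le_trans (mu_t_le _ i) _; rewrite bcoord_grow E Ei.
by rewrite mulrAC divff ?pnatr_eq0// mul1r subrr mul0r mulr0.
Qed.

Lemma cont_on_grow m (A : set (simplex m * R)) : cont_on A (fun x => grow x.2 x.1).
Proof.
have cs : cont_on A (fun x => shrink x.2 x.1).
  apply: cont_on_mul.
    apply: cont_on_max; first exact: cont_on_cst.
    by apply: cont_on_min; [exact: cont_on_cst|exact: cont_on_snd].
  apply: cont_on_min; last exact: cont_on_cst.
  by apply: (cont_on_comp (@cont_on_mu_t m setT)) => //; exact: cont_on_fst.
apply: cont_on_simplex => i.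
apply: (@cont_on_ext _ _ _ (fun x => (bcoord x.1 i - shrink x.2 x.1 / m.+1%:R) / (1 - shrink x.2 x.1))).
  by move=> x _; rewrite bcoord_grow.
apply: cont_on_mul.
  apply: cont_on_subr; first by apply: (cont_on_comp (@cont_on_co _ m setT i)) => //; exact: cont_on_fst.
  by apply: cont_on_mul => //; exact: cont_on_cst.
apply: cont_on_inv => [x _|]; last by apply: cont_on_subr => //; exact: cont_on_cst.
by have [_ h _] := shrinkP x.2 x.1; apply/eqP; lra.
Qed.

End MoreSimplex.

Section Skeleta.
Context {R : realType} (Y : simplicial_space).
Local Notation simplex := (@std_simplex R).
Local Notation I := (@I01 R).
Local Notation rY := (realization R Y).
Hypothesis degP : forall m i, (i < m)%N ->
  clopen [set y | sact Y (collapse m i) y = y].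

(** The quotient topology gives no direct hold on maps out of a product with an interval. So a
    compact interval [J] of times is fixed during which the given point stays in [O]; the points
    leaving [O] at some time of [J] form a closed set, since by compactness of [J] this holds in
    each [Y m] times a simplex. *)
Lemma cont_on_sk_cyl n (Z : topologicalType) (h : rY * R -> Z) :
  (forall m, (m <= n)%N -> cont_on (setT `*` I)
    (fun x : (Y m * simplex m) * R => h (rpt x.1.1 x.1.2, x.2))) ->
  cont_on (@sk R Y n.+1 `*` I) h.
Proof.
move=> ch [z u0] [/= skz Iu0] O'; rewrite nbhsE /= => -[O [oO Oz] OO'].
have [p [pn [y0 [t0 [r0 Ez]]]]] := skz.
have [e e0 He] : exists2 e : R, 0 < e &
    forall u, I u -> `|u - u0| < e -> O (h (z, u)).
  have nO : nbhs (h (rpt y0 t0, u0)) O by apply: open_nbhs_nbhs; split=> //; rewrite -Ez.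
  have T0 : (setT `*` I) ((y0, t0), u0) by split.
  have := ch p pn _ T0 O nO; rewrite !nbhs_simpl /= /within /= => -[[P Q] [/= nP nQ] PQ].
  move: nQ => /nbhs_ballP[e /= e0 He]; exists e => // u Iu ue.
  rewrite Ez; apply: (PQ ((y0, t0), u)) => //=.
  split=> /=; first exact: nbhs_singleton.
  by apply: He; rewrite /ball /= distrC.
(* Half the radius, so that the closed interval lies in the open one of radius [e]. *)
pose J := I `&` [set u | `|u - u0| <= e / 2].
have cJ : compact J.
  apply: subclosed_compact (@segment_compact R 0 1) _; last first.
    by move=> u [Iu _] /=; rewrite in_itv.
  apply: closedI; first exact: closed_I01.
  apply: (@closed_preim _ _ (fun u : R => `|u - u0|) [set x | x <= e / 2]); last exact: closed_le.
  apply: cont_onT; apply: cont_on_norm.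
  by apply: cont_on_subr; [exact: cont_on_id|exact: cont_on_cst].
pose C : set rY := [set z' | sk n.+1 z' /\ exists u, J u /\ ~ O (h (z', u))].
have cC : closed C.
  apply: (@closed_cells R Y degP _ (fun m => [set x : Y m * simplex m | (m <= n)%N /\
    exists u, J u /\ ~ O (h (rpt x.1 x.2, u))])).
  - move=> m; have [mn|nm] := leqP m n; last first.
      rewrite (_ : mkset _ = set0); first exact: closed0.
      by apply/seteqP; split=> x // [].
    rewrite (_ : mkset _ = [set x : Y m * simplex m |
       exists u, J u /\ ~ O (h (rpt x.1 x.2, u))]); last first.
      by apply/seteqP; split=> x; [case|split].
    apply: (closed_proj (I := I) (h := fun x : (Y m * simplex m) * R => h (rpt x.1.1 x.1.2, x.2)) cJ _ oO).
      by move=> u [].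
    exact: (ch m mn).
  - move=> m y t r [skC H]; split=> //=.
    rewrite -ltnS; have [q [qn c]] := skC.
    have cm : is_cell m (rpt y t) by exists y, t.
    by rewrite (is_cell_unique cm c).
  - by move=> m y t [mn H]; split=> //; exact: sk_rpt.
have nC : ~ C z.
  move=> [_ [u [[Iu ue]]]]; apply; apply: He => //.
  by apply: le_lt_trans ue _; lra.
have nz : nbhs z (~` C) by apply: open_nbhs_nbhs; split=> //; exact: closed_openC.
have nu : nbhs u0 [set u | `|u - u0| <= e / 2].
  apply/nbhs_ballP; exists (e / 2) => /=; first by lra.
  by move=> u; rewrite /ball /= distrC => /ltW.
rewrite !nbhs_simpl /= /within /=.
exists (~` C, [set u | `|u - u0| <= e / 2]) => //= -[z' u] [/= Cz' ue] [/= skz' Iu].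
apply: OO'; apply: contrapT => nO; apply: Cz'; split=> //.
by exists u.
Qed.

Lemma cont_on_sk n (Z : topologicalType) (h : rY -> Z) :
  (forall m, (m <= n)%N -> continuous (fun x : Y m * simplex m => h (rpt x.1 x.2))) ->
  cont_on (@sk R Y n.+1) h.
Proof.
move=> ch; have H : cont_on (@sk R Y n.+1 `*` I) (fun x => h x.1).
  apply: cont_on_sk_cyl => m mn.
  by apply: (cont_on_comp_continuous (ch m mn)); exact: cont_on_fst.
apply: (cont_on_comp H (f := fun z => (z, 0))) => [|z sz].
  by apply: cont_on_pair; [exact: cont_on_id|exact: cont_on_cst].
by split=> //; rewrite /I01 /= lexx ler01.
Qed.

(** Otherwise the image meets cells of arbitrarily high dimension. One simplex coordinate met by the
    image is chosen in each such dimension. Since points of [Y m] need not be closed, [C N] contains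
    all nondegenerate elements with the chosen coordinate, in dimensions at least [N]. The sets
    [C N] are closed, decreasing, with empty intersection, so the compact image misses one of
    them. *)
Lemma sk_compact (W : topologicalType) (K : set W) (b : W -> rY) :
  compact K -> cont_on K b -> exists n, forall s, K s -> sk n (b s).
Proof.
move=> cK cb; apply: contrapT => /forallNP H.
pose A m (t : simplex m) := exists s (y : Y m), [/\ K s, reduced y t & b s = rpt y t].
have Hex N : exists m (t : simplex m), (N <= m)%N /\ A m t.
  have /existsNP[s /not_implyP[Ks nsk]] := H N.
  have [m [y [t [r E]]]] := is_cell_ex (b s); exists m, t; split; last by exists s, y.
  rewrite leqNgt; apply/negP => mN; apply: nsk; exists m; split=> //.
  by exists y, t.
(* At most one chosen point in each dimension. *)
pose T m : set (simplex m) := fun t =>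
  match pselect (exists t, A m t) with left h => t = projT1 (cid h) | _ => False end.
have cT m : closed (T m).
  rewrite /T; case: pselect => h; last first.
    exact: (@closed0 (simplex m)).
  exact: closed_simplex1.
have TA m t : T m t -> A m t.
  by rewrite /T; case: pselect => // h ->; exact: projT2 (cid h).
have AT m t : A m t -> exists t', T m t'.
  by move=> At; rewrite /T; case: pselect => [h|[]]; [eexists|exists t].
pose C N : set rY := [set z | exists m (y : Y m) (t : simplex m),
  [/\ (N <= m)%N, T m t, reduced y t & z = rpt y t]].
have cC N : closed (C N).
  apply: (@closed_cells R Y degP _ (fun m => [set x : Y m * simplex m |
     (N <= m)%N /\ (nondeg x.1 /\ T m x.2)])).
  - move=> m; have [mn|nm] := leqP N m; last first.
      rewrite (_ : mkset _ = set0); first exact: closed0.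
      by apply/seteqP; split=> x // [].
    rewrite (_ : mkset _ = [set y | nondeg y] `*` T m); last first.
      by apply/seteqP; split=> x; [case|split].
    by apply: closed_setX => //; exact: closed_nondeg.
  - move=> m y t r [m' [y' [t' [Nm Tt r' E]]]] /=.
    have E' := reduced_unique r r' E.
    have mm' : m = m' by exact: (congr1 (@projT1 _ _) E').
    move: y' t' Nm Tt r' E E'; case: m' / mm' => y' t' Nm Tt r' E E'.
    have [-> ->] := rpt_inj r r' E.
    by split=> //; split=> //; case: r'.
  - move=> m y t [Nm [ny Tt]]; exists m, y, t; split=> //.
    by split=> //; have [s [y' [_ [_ it] _]]] := TA _ _ Tt.
have /compact_near_coveringP/near_covering_withinP cov := cK.
have HC : \forall N \near \oo, K `<=` (fun s => ~ C N (b s)).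
  apply: (cov nat \oo (fun N s => ~ C N (b s))) => s Ks.
  have [d cd] := is_cell_ex (b s).
  have nC : ~ C d.+1 (b s).
    move=> [m [y [t [dm _ r E]]]].
    have cm : is_cell m (b s) by exists y, t.
    by rewrite (is_cell_unique cd cm) ltnn in dm.
  have nO : nbhs (b s) (~` C d.+1).
    by apply: open_nbhs_nbhs; split=> //; exact: closed_openC.
  have := cb s Ks _ nO; rewrite !nbhs_simpl /= /within /= => nb.
  exists ([set s' | K s' -> (~` C d.+1) (b s')], [set N | (d.+1 <= N)%N]).
    by split => //=; exists d.+1.
  move=> [s' N] [/= H1 dN] Ks'; apply: contra_not (H1 Ks').
  by move=> [m [y [t [Nm h1 h2 h3]]]]; exists m, y, t; split=> //; exact: leq_trans Nm.
have [N _ HN] := HC.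
have [m [t [Nm At]]] := Hex N.
have [t' Tt'] := AT _ _ At; have [s [y [Ks r E]]] := TA _ _ Tt'.
by apply: (HN N (leqnn N) s Ks); exists m, y, t'.
Qed.

(** Reduced representatives are unique, hence give [y] and [t]; they are continuous because the
    image of an open set of reduced pairs is open in [sk n.+1]. [y0] and [t0] are default values off
    [K]. *)
Lemma chart n (W : topologicalType) (K : set W) (b : W -> rY)
    (y0 : Y n) (t0 : simplex n) :
  cont_on K b -> (forall s, K s -> is_cell n (b s)) ->
  exists (y : W -> Y n) (t : W -> simplex n), [/\ cont_on K y, cont_on K t
    & forall s, K s -> reduced (y s) (t s) /\ b s = rpt (y s) (t s)].
Proof.
move=> cb bc.
have [yt ytP] : exists yt : W -> Y n * simplex n, forall s, K s ->
    reduced (yt s).1 (yt s).2 /\ b s = rpt (yt s).1 (yt s).2.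
  have /choice[yt H] : forall s, exists x : Y n * simplex n, K s ->
      reduced x.1 x.2 /\ b s = rpt x.1 x.2.
    move=> s; have [Ks|nK] := pselect (K s); last by exists (y0, t0).
    by have [y [t H]] := bc s Ks; exists (y, t).
  by exists yt.
suff cyt : cont_on K yt.
  exists (fun s => (yt s).1), (fun s => (yt s).2); split=> //.
    by apply: cont_on_comp_continuous cyt; exact: fst_continuous.
  by apply: cont_on_comp_continuous cyt; exact: snd_continuous.
move=> s Ks O'; rewrite nbhsE /= => -[O [oO Os] OO'].
pose C : set rY := [set z | sk n.+1 z /\
  ~ exists (y : Y n) (t : simplex n), [/\ O (y, t), reduced y t & z = rpt y t]].
have Clt m (y : Y m) (t : simplex m) : (m < n)%N -> C (rpt y t).
  move=> mn; split; first by apply: sk_rpt; exact: ltnW.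
  move=> [y' [t' [_ r' E]]]; apply: (@sk_not_cell _ _ n n (rpt y t)) => //.
    exact: sk_rpt.
  by exists y', t'.
have Ceq (y : Y n) (t : simplex n) : C (rpt y t) <-> ~ (O (y, t) /\ reduced y t).
  split=> [[_ H] [Oyt r]|H]; first by apply: H; exists y, t.
  split; first exact: sk_rpt.
  move=> [y' [t' [Oyt r' E]]]; have [r|nr] := pselect (reduced y t).
    by have [ey et] := rpt_inj r r' E; apply: H; rewrite ey et.
  apply: (sk_not_cell (leqnn n) (sk_not_reduced nr)).
  by exists y', t'.
have cC : closed C.
  apply: (@closed_cells R Y degP _ (fun m => [set x : Y m * simplex m |
    (m <= n)%N /\ C (rpt x.1 x.2)])).
  - move=> m; have [nm|mn|E] := ltngtP n m.
    + rewrite (_ : mkset _ = set0); first exact: closed0.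
      by apply/seteqP; split=> x // [].
    + rewrite (_ : mkset _ = setT); first exact: closedT.
      by apply/seteqP; split=> x // _; split=> //; exact: Clt.
    + case: m / E.
      rewrite (_ : mkset _ = ~` (O `&` ((fst @^-1` [set y | nondeg y]) `&`
        (snd @^-1` (~` [set t : simplex n | ~ interior_pt t]))))); last first.
        apply/seteqP; split=> -[y t].
          by move=> [_ /Ceq H] [Ox [nx /contrapT ix]]; apply: H.
        move=> H; split=> //; apply/Ceq => -[Ox [nx ix]].
        by apply: H; split=> //; split=> //=; apply.
      apply: open_closedC; apply: openI => //; apply: openI.
        apply: open_comp; first by move=> x _; exact: fst_continuous.
        have -> : [set y : Y n | nondeg y] = ~` [set y | ~ nondeg y].
          by apply/seteqP; split=> y /=; [move=> ny; apply|exact: contrapT].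
        by apply: closed_openC; exact: closed_deg.
      apply: open_comp; first by move=> x _; exact: snd_continuous.
      by apply: closed_openC; exact: closed_not_interior.
  - move=> m y t r sC; split=> //; have [[q [qn c]] _] := sC.
    have cm : is_cell m (rpt y t) by exists y, t.
    by rewrite -ltnS (is_cell_unique cm c).
  - by move=> m y t [].
have nC : ~ C (b s).
  move=> [_]; apply; have [r E] := ytP s Ks.
  by exists (yt s).1, (yt s).2; split=> //; rewrite -surjective_pairing.
have nO : nbhs (b s) (~` C) by apply: open_nbhs_nbhs; split=> //; exact: closed_openC.
have := cb s Ks _ nO; rewrite !nbhs_simpl /= /within /=.
apply: filterS => s' H Ks'; have {H} := H Ks'; have [r' E'] := ytP s' Ks'.
move=> /not_andP[|/contrapT [y [t [Oyt r E]]]].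
  by case; apply/skS; right; exact: bc.
apply: OO'; have [ey et] := rpt_inj r' r (etrans (esym E') E).
by rewrite [yt s']surjective_pairing ey et.
Qed.

End Skeleta.

(** * Collars, realized maps, Lebesgue numbers *)

Section Collar.
Context {R : realType} (Y : simplicial_space).
Local Notation simplex := (@std_simplex R).
Local Notation I := (@I01 R).
Local Notation rY := (realization R Y).
Hypothesis degP : forall m i, (i < m)%N ->
  clopen [set y | sact Y (collapse m i) y = y].
Variable n : nat.

Definition cell_pt (z : rY) (c : is_cell n z) : Y n * simplex n :=
  (projT1 (cid c), projT1 (cid (projT2 (cid c)))).

Lemma cell_ptP z (c : is_cell n z) :
  reduced (cell_pt c).1 (cell_pt c).2 /\ z = rpt (cell_pt c).1 (cell_pt c).2.
Proof. exact: projT2 (cid (projT2 (cid c))). Qed.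

(** The value is 0 also on cells of dimension above [n]; continuity is claimed on [sk n.+1] only. *)
Definition mu (z : rY) : R :=
  match pselect (is_cell n z) with left c => mu_t (cell_pt c).2 | _ => 0 end.

Definition expand (u : R) (z : rY) : rY :=
  match pselect (is_cell n z) with
  | left c => rpt (cell_pt c).1 (grow u (cell_pt c).2) | _ => z end.

Lemma mu_ncell z : ~ is_cell n z -> mu z = 0.
Proof. by rewrite /mu; case: pselect. Qed.

Lemma expand_ncell u z : ~ is_cell n z -> expand u z = z.
Proof. by rewrite /expand; case: pselect. Qed.

Lemma mu_sk z : sk n z -> mu z = 0.
Proof. by move=> /(sk_not_cell (leqnn n)); exact: mu_ncell. Qed.

Lemma expand_sk u z : sk n z -> expand u z = z.
Proof. by move=> /(sk_not_cell (leqnn n)); exact: expand_ncell. Qed.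

Lemma not_cell (y : Y n) (t : simplex n) : ~ reduced y t -> ~ is_cell n (rpt y t).
Proof. by move=> nr; exact: sk_not_cell (leqnn n) (sk_not_reduced nr). Qed.

Lemma mu_rpt (y : Y n) (t : simplex n) : nondeg y -> mu (rpt y t) = mu_t t.
Proof.
move=> ny; have [it|nit] := pselect (interior_pt t).
  rewrite /mu; case: pselect => [c|[]]; last by exists y, t.
  have [r E] := cell_ptP c; have ryt : reduced y t by [].
  by have [_ e2] := rpt_inj ryt r E; exact: (congr1 (@mu_t R n) (esym e2)).
by rewrite mu_ncell; [rewrite (mu_t_eq0 t).1|apply: not_cell => -[]].
Qed.

Lemma expand_rpt u (y : Y n) (t : simplex n) : nondeg y ->
  expand u (rpt y t) = rpt y (grow u t).
Proof.
move=> ny; have [it|nit] := pselect (interior_pt t).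
  rewrite /expand; case: pselect => [c|[]]; last by exists y, t.
  have [r E] := cell_ptP c; have ryt : reduced y t by [].
  have [e1 e2] := rpt_inj ryt r E.
  exact: (f_equal2 (fun a b => rpt a (grow u b)) (esym e1) (esym e2)).
by rewrite expand_ncell; [rewrite grow_bdry|apply: not_cell => -[]].
Qed.

Lemma sk_deg (y : Y n) (t : simplex n) : ~ nondeg y -> sk n (rpt y t).
Proof. by move=> ny; apply: sk_not_reduced => -[]. Qed.

Lemma mu_gt0 z : 0 < mu z <-> is_cell n z.
Proof.
split=> [|[y [t [[ny it] ->]]]]; last by rewrite mu_rpt//; apply/mu_t_gt0.
by move=> h; apply: contrapT => nc; move: h; rewrite mu_ncell// ltxx.
Qed.

(** In dimension [n], nondegenerate and degenerate elements form two closed sets by [degP]. On the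
    first the formula of [mu_rpt] holds up to the boundary of the simplex, on the second the value
    is 0. *)
Lemma cont_on_mu : cont_on (@sk R Y n.+1) mu.
Proof.
apply: cont_on_sk => // m; rewrite leq_eqVlt => /orP[/eqP ->|mn]; last first.
  apply: cont_onT; apply: (@cont_on_ext _ _ _ (fun=> (0 : R))); last exact: cont_on_cst.
  by move=> x _; rewrite mu_sk//; exact: sk_rpt.
apply: cont_onT.
apply: (@cont_on_sub _ _ _ ((fst @^-1` [set y | nondeg y]) `|` (fst @^-1` [set y : Y n | ~ nondeg y]))).
  by move=> x _; have [|] := pselect (nondeg x.1); [left|right].
apply: cont_on_glue.
- by apply: closed_preim; [exact: fst_continuous|exact: closed_nondeg].
- by apply: closed_preim; [exact: fst_continuous|exact: closed_deg].
- apply: (@cont_on_ext _ _ _ (fun x => mu_t x.2)); first by move=> x nx; rewrite mu_rpt.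
  by apply: (cont_on_comp (@cont_on_mu_t _ n setT)) => //; exact: cont_on_snd.
- apply: (@cont_on_ext _ _ _ (fun=> (0 : R))); last exact: cont_on_cst.
  by move=> x nx; rewrite mu_sk//; exact: sk_deg.
Qed.

Lemma cont_on_expand : cont_on (@sk R Y n.+1 `*` I) (fun x => expand x.2 x.1).
Proof.
have crpt m (A : set (Y m * simplex m * R)) : cont_on A (fun x => rpt x.1.1 x.1.2).
  by apply: (cont_on_comp_continuous (@rpt_continuous R Y m)); exact: cont_on_fst.
apply: cont_on_sk_cyl => // m; rewrite leq_eqVlt => /orP[/eqP ->|mn]; last first.
  by apply: cont_on_ext (crpt _ _) => x _ /=; rewrite expand_sk//; exact: sk_rpt.
pose A := [set x : Y n * simplex n * R | nondeg x.1.1].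
pose B := [set x : Y n * simplex n * R | ~ nondeg x.1.1].
have c11 : continuous (fun x : Y n * simplex n * R => x.1.1).
  by move=> x; apply: continuous_comp; exact: fst_continuous.
apply: (@cont_on_sub _ _ _ (A `|` B)).
  by move=> x _; have [|] := pselect (nondeg x.1.1); [left|right].
apply: cont_on_glue.
- exact: (closed_preim c11 (closed_nondeg degP (m := n))).
- exact: (closed_preim c11 (closed_deg degP (m := n))).
- apply: (@cont_on_ext _ _ _ (fun x => rpt x.1.1 (grow x.2 x.1.2))).
    by move=> x nx /=; rewrite expand_rpt.
  apply: (cont_on_comp_continuous (@rpt_continuous R Y n)
    (f := fun x : Y n * simplex n * R => (x.1.1, grow x.2 x.1.2))).
  apply: cont_on_pair; first exact: cont_on_continuous.
  apply: (cont_on_comp (@cont_on_grow R n setT) (f := fun x : Y n * simplex n * R => (x.1.2, x.2))) => //.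
  apply: cont_on_pair; last exact: cont_on_snd.
  by apply: cont_on_comp_continuous; [exact: snd_continuous|exact: cont_on_fst].
- by apply: cont_on_ext (crpt _ _) => x nx /=; rewrite expand_sk//; exact: sk_deg.
Qed.

Lemma expand0 z : expand 0 z = z.
Proof.
have [[y [t [[ny it] ->]]]|nc] := pselect (is_cell n z).
  by rewrite expand_rpt// grow0.
by rewrite expand_ncell.
Qed.

Lemma sk_expand u z : sk n.+1 z -> sk n.+1 (expand u z).
Proof.
have [[y [t [[ny it] ->]]]|nc] := pselect (is_cell n z).
  by rewrite expand_rpt// => _; exact: sk_rpt.
by rewrite expand_ncell.
Qed.

Lemma mu_expand u z : mu (expand u z) <= mu z.
Proof.
have [[y [t [[ny it] ->]]]|nc] := pselect (is_cell n z).
  by rewrite expand_rpt// !mu_rpt//; exact: mu_grow.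
by rewrite expand_ncell.
Qed.

Lemma sk_expand1 z : sk n.+1 z -> mu z <= 1 / 2 -> sk n (expand 1 z).
Proof.
move=> sz h; have [[y [t [[ny it] E]]]|nc] := pselect (is_cell n z).
  move: h; rewrite E expand_rpt// mu_rpt// => h; apply: sk_not_reduced => -[_].
  by move=> /mu_t_gt0; rewrite mu_grow1// ltxx.
by rewrite expand_ncell//; move/skS: sz => -[].
Qed.

End Collar.

Section RealizedMap.
Context {R : realType} (X Y : simplicial_space).
Local Notation simplex := (@std_simplex R).
Local Notation rX := (realization R X).
Local Notation rY := (realization R Y).
Variable F : forall n, continuousType (X n) (Y n).
Hypothesis F_nat : forall m n (a : ord_map m n) (x : X n),
  F m (sact X a x) = sact Y a (F n x).

Definition realmap_fun (u : realization_total R X) : rY :=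
  rpt (F (projT1 u) (projT2 u).1) (projT2 u).2.

Lemma realmap_compat : {homo realmap_fun : a b / \pi_rX a == \pi_rX b :> rX >-> a == b}.
Proof.
move=> a b /eqP/eqmodP/asboolP H; apply/eqP; elim: H => //.
  by move=> _ _ [m n c x t]; rewrite /realmap_fun /= F_nat rpt_push.
by move=> u v w _ -> _ ->.
Qed.

Lemma realmap_continuous_fun : continuous realmap_fun.
Proof.
case=> m z; apply: (@sigT_continuous nat (fun n => (X n * simplex n)%type) rY
  (fun n x => rpt (F n x.1) x.2)) => n; apply: cont_onT.
apply: (cont_on_comp_continuous (@rpt_continuous R Y n)
  (f := fun x : X n * simplex n => (F n x.1, x.2))).
apply: cont_on_pair; last exact: cont_on_snd.
by apply: cont_on_comp_continuous; [exact: cts_fun|exact: cont_on_fst].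
Qed.

Definition realmap (z : rX) : rY := realmap_fun (repr z).

Lemma realmap_continuous : continuous realmap.
Proof.
exact: (repr_comp_continuous realmap_continuous_fun realmap_compat).
Qed.

Lemma realmap_rpt n (x : X n) (t : simplex n) :
  realmap (rpt x t) = rpt (F n x) t.
Proof.
rewrite /realmap; apply/eqP; apply: (@realmap_compat _ (realization_pt x t)).
by rewrite reprK.
Qed.

Hypothesis F_deg : forall m i (x : X m), (i < m)%N ->
  sact Y (collapse m i) (F m x) = F m x -> sact X (collapse m i) x = x.

Lemma nondegF m (x : X m) : nondeg (F m x) <-> nondeg x.
Proof.
split=> nx i im; last by move=> /(F_deg im); exact: nx.
by move=> E; apply: (nx i im); rewrite -F_nat E.
Qed.

Lemma is_cell_realmap n z : is_cell n (realmap z) <-> is_cell n z.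
Proof.
have H m : is_cell m z -> is_cell m (realmap z).
  move=> [x [t [[nx it] ->]]]; rewrite realmap_rpt; exists (F m x), t; split=> //.
  by split=> //; apply/nondegF.
split=> [c|]; last exact: H.
have [m c'] := is_cell_ex z; by rewrite (is_cell_unique c (H _ c')).
Qed.

Lemma sk_realmap n z : sk n (realmap z) <-> sk n z.
Proof. by split=> -[p [pn /is_cell_realmap c]]; exists p. Qed.

Lemma expand_realmap n u z : expand n u (realmap z) = realmap (expand n u z).
Proof.
have [[x [t [[nx it] ->]]]|nc] := pselect (is_cell n z).
  by rewrite realmap_rpt !expand_rpt// ?realmap_rpt//; apply/nondegF.
by rewrite !expand_ncell// => /is_cell_realmap.
Qed.

End RealizedMap.

Section Lebesgue.
Context {R : realType} {k : nat} (p q : 'I_k -> R).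
Hypothesis pq : forall i, p i <= q i.

Definition subdiv (N : nat) (i : 'I_k) (j : nat) : R :=
  p i + (q i - p i) * (j%:R / N%:R).

Lemma subdivP N : (0 < N)%N -> forall i, (forall m n, subdiv N i m = subdiv N i n) \/
  (forall m n, (m < n)%N -> subdiv N i m < subdiv N i n).
Proof.
move=> N0 i; have [E|lt] := eqVneq (p i) (q i).
  by left=> m n; rewrite /subdiv E subrr !mul0r.
right=> m n mn; rewrite /subdiv ltrD2l ltr_pM2l; last first.
  by rewrite subr_gt0 lt_neqAle lt pq.
by rewrite ltr_pM2r ?invr_gt0 ?ltr0n// ltr_nat.
Qed.

Lemma subdiv_box N : (0 < N)%N ->
  lattice_box (subdiv N) (fun=> 0%N) (fun=> N) = box p q /\
  lattice_bdry (subdiv N) (fun=> 0%N) (fun=> N) = bdry p q.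
Proof.
move=> N0; have E0 : (fun i => subdiv N i 0) = p.
  by apply/funext => i; rewrite /subdiv mul0r mulr0 addr0.
have EN : (fun i => subdiv N i N) = q.
  by apply/funext => i; rewrite /subdiv divff ?pnatr_eq0 -?lt0n// mulr1 addrC subrK.
by rewrite /lattice_box /lattice_bdry E0 EN.
Qed.

(** A Lebesgue number for the cover of the box by the regions [0 < h] and [h < 1 / 2]. *)
Lemma lebesgue (h : 'rV[R]_k -> R) : cont_on (box p q) h ->
  exists2 N, (0 < N)%N & forall v w, (forall i, v i <= w i <= (v i).+1)%N ->
    (forall i, w i <= N)%N ->
    (forall s, lattice_box (subdiv N) v w s -> 0 < h s) \/
    (forall s, lattice_box (subdiv N) v w s -> h s < 1 / 2).
Proof.
move=> ch; pose K := box p q.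
pose P (e : R) (s : 'rV[R]_k) :=
  (forall s', K s' -> (forall i, `|s' ord0 i - s ord0 i| < e) -> 0 < h s') \/
  (forall s', K s' -> (forall i, `|s' ord0 i - s ord0 i| < e) -> h s' < 1 / 2).
have loc s : K s -> exists2 r : R, 0 < r & P r s.
  move=> Ks.
  have H (O : set R) : nbhs (h s) O -> exists2 r : R, 0 < r &
      forall s', K s' -> (forall i, `|s' ord0 i - s ord0 i| < r) -> O (h s').
    move=> /(ch s Ks); rewrite !nbhs_simpl /= /within /= => /nbhs_ballP[r /= r0 Hr].
    exists r => // s' Ks' sr; apply: Hr => //; split=> // i j.
    by rewrite (ord1 i) /ball /= distrC.
  have [h0|h0] := leP (h s) 0.
    have [|r r0 Hr] := H [set y | y < 1 / 2]; last by exists r => //; right.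
    by apply: open_nbhs_nbhs; split; [exact: open_lt|rewrite /=; lra].
  have [|r r0 Hr] := H [set y | 0 < y]; last by exists r => //; left.
  by apply: open_nbhs_nbhs; split; [exact: open_gt|].
have [e e0 He] : exists2 e : R, 0 < e & forall s, K s -> P e s.
  have /compact_near_coveringP/near_covering_withinP cov := @compact_box R k p q.
  have : \forall e \near 0^'+, K `<=` P e.
    apply: (cov R _ P) => s Ks; have [r r0 Pr] := loc s Ks.
    have r2 : 0 < r / 2 by lra.
    exists (ball s (r / 2), [set e | e < r / 2]).
      by split=> /=; [exact: nbhsx_ballx|exact: nbhs_right_lt].
    move=> [s' e] /= [[_ s'r] er] Ks'.
    have tri s'' : (forall i, `|s'' ord0 i - s' ord0 i| < e) ->
        forall i, `|s'' ord0 i - s ord0 i| < r.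
      move=> H i; have := s'r ord0 i; rewrite /ball /= => h1; have h2 := H i.
      have := ler_distD (s' ord0 i) (s'' ord0 i) (s ord0 i).
      by rewrite [`|s' ord0 i - _|]distrC; lra.
    by case: Pr => Pr; [left|right] => s'' Ks'' /tri; exact: Pr.
  move=> H; have H0 : \forall e \near 0^'+, (0 : R) < e by exact: nbhs_right_gt.
  have [e [e0 He]] := filter_ex (filterI H0 H).
  by exists e.
(* A common bound for all sides, from which one [N] serves every direction. *)
pose S := \sum_i (q i - p i).
have S0 : 0 <= S by apply: sumr_ge0 => i _; rewrite subr_ge0.
have Sge i : q i - p i <= S.
  rewrite /S (bigD1 i) //= lerDl; apply: sumr_ge0 => j _; by rewrite subr_ge0.
pose N := (Num.truncn (S / e)).+1.
have SN : S / N%:R < e.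
  rewrite ltr_pdivrMr ?ltr0n// mulrC -ltr_pdivrMr//.
  exact: truncnS_gt.
exists N => // v w vw wN.
have mono i m n : (m <= n)%N -> subdiv N i m <= subdiv N i n.
  exact: (lattice_mono (@subdivP N isT)).
have sub : lattice_box (subdiv N) v w `<=` K.
  have [EK _] := @subdiv_box N isT.
  rewrite /K -EK => s H i; have /andP[h1 h2] := H i; apply/andP; split.
    by apply: le_trans h1; exact: mono.
  by apply: (le_trans h2); exact: mono.
pose s0 : 'rV[R]_k := \row_i subdiv N i (v i).
have Ls0 : lattice_box (subdiv N) v w s0.
  by move=> i; rewrite mxE lexx /=; apply: mono; have /andP[] := vw i.
have near0 s : lattice_box (subdiv N) v w s -> forall i, `|s ord0 i - s0 ord0 i| < e.
  move=> H i; have /andP[h1 h2] := H i; rewrite mxE ger0_norm ?subr_ge0//.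
  apply: le_lt_trans SN.
  apply: (@le_trans _ _ (subdiv N i (v i).+1 - subdiv N i (v i))).
    rewrite lerD2r; apply: (le_trans h2); apply: mono; by have /andP[] := vw i.
  have -> : subdiv N i (v i).+1 - subdiv N i (v i) = (q i - p i) / N%:R.
    by rewrite /subdiv -natr1; field; rewrite pnatr_eq0.
  by rewrite ler_pM2r ?invr_gt0 ?ltr0n.
by case: (He s0 (sub _ Ls0)) => H; [left|right] => s Ls; apply: H => //;
  [exact: sub|exact: near0|exact: sub|exact: near0].
Qed.

End Lebesgue.

(** * Lifting along a realized map *)

Section Step.
Context {R : realType} (X Y : simplicial_space).
Local Notation simplex := (@std_simplex R).
Local Notation I := (@I01 R).
Local Notation rX := (realization R X).
Local Notation rY := (realization R Y).
Variable F : forall n, continuousType (X n) (Y n).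
Hypothesis F_nat : forall m n (a : ord_map m n) (x : X n),
  F m (sact X a x) = sact Y a (F n x).
Hypothesis degX : forall m i, (i < m)%N ->
  clopen [set y | sact X (collapse m i) y = y].
Hypothesis degY : forall m i, (i < m)%N ->
  clopen [set y | sact Y (collapse m i) y = y].
Hypothesis F_deg : forall m i (x : X m), (i < m)%N ->
  sact Y (collapse m i) (F m x) = F m x -> sact X (collapse m i) x = x.
Hypothesis F_lifts : forall n, lifts R (F n) [set y | nondeg y].

Local Notation f := (@realmap R X Y F).
Let cf : continuous f := realmap_continuous F_nat.

Lemma realmap_ne n z : @sk R Y n z -> exists x : rX, True.
Proof.
move=> [p [_ [y [t [[ny _] _]]]]]; have [x _] := (F_lifts p).1 y ny.
by exists (rpt x t).
Qed.

(* Inside the open n-cells a problem for [f] is one for [F n], the coordinates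
   in the simplex being kept fixed. *)
Lemma cell_solvable n k (p q : 'I_k -> R) (a : 'rV[R]_k -> rX)
    (G : 'rV[R]_k * R -> rY) (b : 'rV[R]_k -> rY) : (forall i, p i <= q i) ->
  problem f setT (box p q) (bdry p q) a G b ->
  (forall s, box p q s -> is_cell n (b s)) ->
  (forall s t, bdry p q s -> I t -> exists y y' u,
    [/\ reduced y u, reduced y' u, G (s, t) = @rpt R Y n y u & b s = rpt y' u]) ->
  exists a' G', [/\ cont_on (box p q) a', cont_on (box p q `*` I) G',
    forall s, bdry p q s -> a' s = a s /\ forall t, I t -> G' (s, t) = G (s, t),
    forall s, box p q s -> G' (s, 0) = f (a' s) /\ G' (s, 1) = b s
  & forall s t, box p q s -> I t -> exists y y' u,
    [/\ reduced y u, reduced y' u, G' (s, t) = @rpt R Y n y u & b s = rpt y' u]].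
Proof.
move=> pq [ca cG cb Gab _] bc Gc.
have I0 : I 0 by rewrite /I01 /= lexx ler01.
have I1 : I 1 by rewrite /I01 /= lexx ler01.
have bK : bdry p q `<=` box p q by move=> s [].
(* A corner of the box supplies the default values required by [chart]. *)
have [y0 [t0 [[ny0 it0] _]]] : is_cell n (b (\row_i p i)).
  by apply: bc => i; rewrite mxE lexx pq.
have [x0 _] := (F_lifts n).1 y0 ny0.
have [yb [tb [cyb ctb bE]]] := chart degY y0 t0 cb bc.
have [|xa [ta [cxa cta aE]]] := chart degX x0 t0 ca (n := n).
  move=> s ds; apply/(is_cell_realmap F_nat F_deg); rewrite -(Gab s ds).1.
  by have [y [y' [u [r r' -> _]]]] := Gc s 0 ds I0; exists y, u.
have [|yG [tG [cyG ctG GE]]] := chart degY y0 t0 cG (n := n).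
  by move=> [s t] [ds It]; have [y [y' [u [r r' -> _]]]] := Gc s t ds It; exists y, u.
have tGb s t : bdry p q s -> I t -> tG (s, t) = tb s.
  move=> ds It; have [y [y' [u [r r' E E']]]] := Gc s t ds It.
  have [rG EG] := GE (s, t) (conj ds It).
  have [rb Eb] := bE s (bK s ds).
  have [_ ->] := rpt_inj rG r (etrans (esym EG) E).
  by have [_ ->] := rpt_inj rb r' (etrans (esym Eb) E').
have aF s : bdry p q s -> F n (xa s) = yG (s, 0) /\ ta s = tb s.
  move=> ds; have [rG EG] := GE (s, 0) (conj ds I0).
  have [ra Ea] := aE s ds.
  have rFa : reduced (F n (xa s)) (ta s).
    by case: ra => nx it; split=> //; apply/(nondegF F_nat F_deg).
  have E : rpt (F n (xa s)) (ta s) = rpt (yG (s, 0)) (tG (s, 0)).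
    by rewrite -EG (Gab s ds).1 Ea realmap_rpt.
  by have [-> ->] := rpt_inj rFa rG E; rewrite tGb.
have GF s : bdry p q s -> yG (s, 1) = yb s.
  move=> ds; have [rG EG] := GE (s, 1) (conj ds I1).
  have [rb Eb] := bE s (bK s ds).
  by have [->] := rpt_inj rG rb (etrans (esym EG) (etrans (Gab s ds).2 Eb)).
have [|a' [G' [ca' cG' aG' Gab' G'B]]] := (F_lifts n).2 k p q xa yG yb pq.
  split=> //.
  - by move=> s ds; have [-> _] := aF s ds; rewrite GF.
  - by split=> [s t ds It|s Ks]; [have [[]] := GE (s, t) (conj ds It)|have [[]] := bE s Ks].
exists (fun s => rpt (a' s) (tb s)), (fun x => rpt (G' x) (tb x.1)).
have red s t : box p q s -> I t -> reduced (G' (s, t)) (tb s).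
  by move=> Ks It; split; [exact: G'B|have [[]] := bE s Ks].
split.
- apply: (cont_on_comp_continuous (@rpt_continuous R X n) (f := fun s => (a' s, tb s))).
  exact: cont_on_pair.
- apply: (cont_on_comp_continuous (@rpt_continuous R Y n) (f := fun x : 'rV[R]_k * R => (G' x, tb x.1))).
  apply: cont_on_pair => //; apply: (cont_on_comp ctb (f := fst)) => [|x []//]; exact: cont_on_fst.
- move=> s ds; have [ra Ea] := aE s ds; have [E1 E2] := aG' s ds.
  split; first by rewrite E1 Ea; have [_ ->] := aF s ds.
  move=> t It; have [rG EG] := GE (s, t) (conj ds It).
  by rewrite E2// EG tGb.
- move=> s Ks; have [E1 E2] := Gab' s Ks; have [rb Eb] := bE s Ks.
  by rewrite /= E1 E2 -Eb realmap_rpt.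
- move=> s t Ks It; have [rb Eb] := bE s Ks.
  by exists (G' (s, t)), (yb s), (tb s); split=> //; exact: red.
Qed.

(* Away from the barycentres of the n-cells, [expand] deforms a problem into
   the previous skeleton. *)
Lemma collar_solvable n k (p q : 'I_k -> R) (a : 'rV[R]_k -> rX)
    (G : 'rV[R]_k * R -> rY) (b : 'rV[R]_k -> rY) :
  let U := [set z | @sk R Y n.+1 z /\ mu n z < 1 / 2] in
  lifts R f (@sk R Y n) -> (forall i, p i <= q i) ->
  problem f U (box p q) (bdry p q) a G b -> solvable f U (box p q) (bdry p q) a G b.
Proof.
move=> U [_ L] pq [ca cG cb Gab [GB bB]].
have I0 : I 0 by rewrite /I01 /= lexx ler01.
have I1 : I 1 by rewrite /I01 /= lexx ler01.
pose a_ (x : 'rV[R]_k * R) := expand n x.2 (a x.1).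
pose G_ (x : 'rV[R]_k * R * R) := expand n x.2 (G x.1).
pose b_ (x : 'rV[R]_k * R) := expand n x.2 (b x.1).
have aE : a = (fun s => a_ (s, 0)) by apply/funext => s; rewrite /a_ expand0.
have GE : G = (fun x => G_ (x, 0)) by apply/funext => s; rewrite /G_ expand0.
have bE : b = (fun s => b_ (s, 0)) by apply/funext => s; rewrite /b_ expand0.
have ska s : bdry p q s -> sk n.+1 (a s).
  move=> ds; apply/(sk_realmap F_nat F_deg); rewrite -(Gab s ds).1.
  by have [] := GB s 0 ds I0.
(* As [expand] does not increase [mu], the whole deformation takes place in [U], and so will the
   solution carried back along it. *)
have UE u z : U z -> U (expand n u z).
  move=> [h1 h2]; split; first exact: sk_expand.
  by apply: le_lt_trans h2; exact: mu_expand.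
have ca_ : cont_on (bdry p q `*` I) a_.
  apply: (cont_on_comp (cont_on_expand degX (n := n)) (f := fun x => (a x.1, x.2))).
    apply: cont_on_pair; last exact: cont_on_snd.
    by apply: (cont_on_comp ca (f := fst)) => [|x []//]; exact: cont_on_fst.
  by move=> [s u] [/= ds Iu]; split=> //=; exact: ska.
have cG_ : cont_on ((bdry p q `*` I) `*` I) G_.
  apply: (cont_on_comp (cont_on_expand degY (n := n)) (f := fun x => (G x.1, x.2))).
    apply: cont_on_pair; last exact: cont_on_snd.
    by apply: (cont_on_comp cG (f := fst)) => [|x []//]; exact: cont_on_fst.
  by move=> [[s t] u] [[/= ds It] Iu]; split=> //=; have [] := GB s t ds It.
have cb_ : cont_on (box p q `*` I) b_.
  apply: (cont_on_comp (cont_on_expand degY (n := n)) (f := fun x => (b x.1, x.2))).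
    apply: cont_on_pair; last exact: cont_on_snd.
    by apply: (cont_on_comp cb (f := fst)) => [|x []//]; exact: cont_on_fst.
  by move=> [s u] [/= Ks Iu]; split=> //=; have [] := bB s Ks.
have comp s u : bdry p q s -> I u ->
    G_ (s, 0, u) = f (a_ (s, u)) /\ G_ (s, 1, u) = b_ (s, u).
  move=> ds Iu; rewrite /G_ /a_ /b_ /= (Gab s ds).1 (Gab s ds).2; split=> //.
  exact: (expand_realmap F_nat F_deg).
have GB_ s t u : bdry p q s -> I t -> I u -> U (G_ (s, t, u)).
  by move=> ds It Iu; apply: UE; exact: GB.
have bB_ s u : box p q s -> I u -> U (b_ (s, u)) by move=> Ks Iu; apply: UE; exact: bB.
rewrite aE GE bE; apply: (solvable_homotopic cf (conic_box p q)) => //.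
have U1 z : U z -> sk n (expand n 1 z).
  by move=> [h1 h2]; apply: sk_expand1 => //; exact: ltW.
have [|a' [G' [ca' cG' aG' Gab' GB']]] := L k p q (fun s => a_ (s, 1)) (fun x => G_ (x, 1))
   (fun s => b_ (s, 1)) pq.
  split.
  - apply: (cont_on_comp ca_ (f := fun s : 'rV[R]_k => (s, 1 : R))) => [|s ds]; last by split.
    by apply: cont_on_pair; [exact: cont_on_id|exact: cont_on_cst].
  - apply: (cont_on_comp cG_ (f := fun s : 'rV[R]_k * R => (s, 1 : R))) => [|s ds]; last by split.
    by apply: cont_on_pair; [exact: cont_on_id|exact: cont_on_cst].
  - apply: (cont_on_comp cb_ (f := fun s : 'rV[R]_k => (s, 1 : R))) => [|s ds]; last by split.
    by apply: cont_on_pair; [exact: cont_on_id|exact: cont_on_cst].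
  - by move=> s ds; exact: comp.
  - by split=> [s t ds It|s Ks]; apply: U1; [exact: GB|exact: bB].
exists a', G'; split=> // s t Ks It; have h := GB' s t Ks It.
split; first exact: sk_le h.
by rewrite mu_sk//; lra.
Qed.

(** A partial solution is a map to [T]: a point of [X] together with a path in [Y]. Adjacent cells
    may be solved by different methods, so the invariant [P] records at every point what either
    method has to know about its boundary data. *)
Lemma lifts_step n : lifts R f (@sk R Y n) -> lifts R f (@sk R Y n.+1).
Proof.
move=> L; split=> [z /realmap_ne//|k p q a G b pq].
(* Arbitrary boundary paths might leave the region of their end point; constant ones satisfy [P]
   from the start. *)
apply: solvable_const; [exact: cf|exact: conic_box|].
move=> {}a {}G {}b [ca cG cb Gab [GB bB]] Gc.
have I0 : I 0 by rewrite /I01 /= lexx ler01.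
have I1 : I 1 by rewrite /I01 /= lexx ler01.
have cmu : cont_on (box p q) (fun s => mu n (b s)) by apply: (cont_on_comp (cont_on_mu degY (n := n))).
have [N N0 HN] := lebesgue pq cmu.
pose x := subdiv p q N; have xP := subdivP pq N0; have [EK Ed] := @subdiv_box R k p q N N0.
pose LB v w := lattice_box x v w.
pose cell v w := (forall i : 'I_k, v i <= w i <= (v i).+1)%N /\ (forall i, w i <= N)%N.
have LBK v w : cell v w -> LB v w `<=` box p q.
  move=> [vw wN] s H; rewrite -EK => i; have /andP[h1 h2] := H i; apply/andP; split.
    by apply: le_trans h1; exact: (lattice_mono xP).
  by apply: (le_trans h2); exact: (lattice_mono xP).
pose Vt v w := forall s, LB v w s -> 0 < mu n (b s).
pose T := (rX * (R -> rY))%type.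
pose same_cell (z z' : rY) := exists (y y' : Y n) u,
   [/\ reduced y u, reduced y' u, z = rpt y u & z' = rpt y' u].
(* The last two clauses are the boundary conditions of [collar_solvable] and [cell_solvable]: a path
   ending where [mu < 1 / 2] stays there, and over a cell sent into the open n-cells each path keeps
   its simplex coordinate. *)
pose P s (g : T) := [/\ g.2 0 = f g.1, g.2 1 = b s,
  forall t, I t -> sk n.+1 (g.2 t),
  mu n (b s) < 1 / 2 -> forall t, I t -> mu n (g.2 t) < 1 / 2
  & forall v w, cell v w -> Vt v w -> LB v w s -> forall t, I t -> same_cell (g.2 t) (b s)].
pose Sh (A : set 'rV[R]_k) (g : 'rV[R]_k -> T) :=
  [/\ cont_on A (fun s => (g s).1), cont_on (A `*` I) (fun x => (g x.1).2 x.2)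
   & forall s, A s -> P s (g s)].
have Sh_sub A B g : A `<=` B -> Sh B g -> Sh A g.
  move=> AB [h1 h2 h3]; split; first exact: cont_on_sub h1.
    by apply: cont_on_sub h2 => -[s t] [/= /AB].
  by move=> s /AB; exact: h3.
have Sh_ext A g g' : (forall s, A s -> g s = g' s) -> Sh A g -> Sh A g'.
  move=> gg' [h1 h2 h3]; split.
  - by apply: cont_on_ext h1 => s /gg' ->.
  - by apply: cont_on_ext h2 => -[s t] [/= /gg' ->].
  - by move=> s As; rewrite -gg'//; exact: h3.
have Sh_glue A B g : closed A -> closed B -> Sh A g -> Sh B g -> Sh (A `|` B) g.
  move=> cA cB [h1 h2 h3] [h1' h2' h3']; split; first exact: cont_on_glue.
    apply: (@cont_on_sub _ _ _ ((A `*` I) `|` (B `*` I))).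
      by move=> [s t] [/= [As|Bs] It]; [left|right].
    by apply: cont_on_glue => //; apply: closed_setX => //; exact: closed_I01.
  by move=> s [/h3|/h3'].
have same_mu z z' : same_cell z z' -> mu n z = mu n z'.
  by move=> [y [y' [u [[ny _] [ny' _] -> ->]]]]; rewrite !mu_rpt.
have Sh_cell v w : (forall i, v i <= w i <= (v i).+1)%N -> (forall i, w i <= N)%N ->
    forall g, Sh (lattice_bdry x v w) g -> exists g', Sh (lattice_box x v w) g' /\
      forall s, lattice_bdry x v w s -> g' s = g s.
  move=> vw wN g [ga gG gP].
  have cvw : cell v w by [].
  have xvw i : x i (v i) <= x i (w i).
    by apply: (lattice_mono xP); have /andP[] := vw i.
  have bL : lattice_bdry x v w `<=` LB v w by move=> s [].
  have bK s : LB v w s -> box p q s by exact: LBK.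
  have cbL : cont_on (LB v w) b by apply: cont_on_sub cb; exact: LBK.
  suff [a' [G' [ca' cG' aG' Gab' GP']]] : exists a' G',
    [/\ cont_on (LB v w) a', cont_on (LB v w `*` I) G',
      forall s, lattice_bdry x v w s -> a' s = (g s).1 /\ forall t, I t -> G' (s, t) = (g s).2 t,
      forall s, LB v w s -> G' (s, 0) = f (a' s) /\ G' (s, 1) = b s
    & (forall s t, LB v w s -> I t -> sk n.+1 (G' (s, t)) /\
        (mu n (b s) < 1 / 2 -> mu n (G' (s, t)) < 1 / 2)) /\
      (forall s t, LB v w s -> I t -> Vt v w -> same_cell (G' (s, t)) (b s))].
    pose g' s := if pselect (lattice_bdry x v w s) then g s else (a' s, fun t => G' (s, t)).
    have gd s : lattice_bdry x v w s -> g' s = g s by rewrite /g'; case: pselect.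
    exists g'; split=> //; split.
    - apply: cont_on_ext ca' => s Ls; rewrite /g'; case: pselect => // ds.
      by rewrite (aG' s ds).1.
    - apply: cont_on_ext cG' => -[s t] [/= Ls It]; rewrite /g'; case: pselect => // ds.
      by rewrite (aG' s ds).2.
    - move=> s Ls; rewrite /g'; case: pselect => ds; first exact: gP.
      split=> /=; [exact: (Gab' s Ls).1|exact: (Gab' s Ls).2| | |].
      + by move=> t It; exact: (GP'.1 s t Ls It).1.
      + by move=> m t It; exact: (GP'.1 s t Ls It).2.
      (* Here [s] is in the relative interior, so any cell through it contains the present one; if
         that cell is sent into the open n-cells, so is this one. *)
      + move=> v' w' c' V' L' t It; apply: (GP'.2 s t Ls It) => r Lr.
        by apply: V'; exact: (lattice_sub xP vw Ls ds L').
  have Gab1 s : lattice_bdry x v w s -> (g s).2 0 = f (g s).1 /\ (g s).2 1 = b s.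
    by move=> ds; have [-> -> _ _ _] := gP s ds.
  have [V|nV] := pselect (Vt v w).
    have [| | |a' [G' [ca' cG' aG' Gab' GP']]] := @cell_solvable n k _ _
       (fun s => (g s).1) (fun x => (g x.1).2 x.2) b xvw.
    - by split.
    - by move=> s Ls; apply/mu_gt0; exact: V.
    - by move=> s t ds It; have [_ _ _ _ H] := gP s ds; apply: (H v w) => //; exact: bL.
    exists a', G'; split=> //; split=> s t Ls It; have E := GP' s t Ls It; last by [].
    (* A fixed simplex coordinate means a fixed [mu], so this method respects the collar clause
       too. *)
    split; last by rewrite (same_mu _ _ E).
    by have [y [y' [u [_ _ -> _]]]] := E; exact: sk_rpt.
  have U s : LB v w s -> mu n (b s) < 1 / 2.
    by have [H|H] := HN v w vw wN; [exfalso; apply: nV; exact: H|exact: H].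
  have [|a' [G' [ca' cG' aG' Gab' GP']]] := @collar_solvable n k _ _
       (fun s => (g s).1) (fun x => (g x.1).2 x.2) b L xvw.
    split=> //; split=> [s t ds It|s Ls]; last by split; [apply: bB; exact: bK|exact: U].
    have [_ _ H1 H2 _] := gP s ds; split; [exact: H1|apply: H2 => //].
    by apply: U; exact: bL.
  exists a', G'; split=> //; split=> s t Ls It; last by [].
  by have [h1 h2] := GP' s t Ls It; split.
have [|g' [[h1 h2 h3] g'g]] := @lattice_extend R k T Sh Sh_sub Sh_ext Sh_glue x xP N
    Sh_cell (fun=> 0%N) (fun=> N) (fun=> leq0n N) (fun=> leqnn N)
    (fun s => (a s, fun t => G (s, t))).
  rewrite Ed; split=> /=; first exact: ca.
    by apply: cont_on_ext cG => -[].
  move=> s ds; have Ks : box p q s by case: ds.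
  have [E1 E2] := Gab s ds.
  have GE t : I t -> G (s, t) = b s by move=> It; rewrite Gc// -E2 Gc.
  split=> //=.
  - by move=> t It; exact: GB.
  - by move=> m t It; rewrite GE.
  - move=> v w c V Ls t It; rewrite GE//.
    have /mu_gt0 [y [u [r E]]] := V s Ls.
    by exists y, y, u.
rewrite EK in h1 h2 h3; rewrite Ed in g'g.
exists (fun s => (g' s).1), (fun x => (g' x.1).2 x.2); split=> //.
- by move=> s ds; rewrite g'g.
- by move=> s Ks; have [-> -> _ _ _] := h3 s Ks.
- by move=> s t Ks It; have [_ _ H _ _] := h3 s Ks; exact: H.
Qed.

Lemma lifts_sk n : lifts R f (@sk R Y n).
Proof.
elim: n => [|n IH]; last exact: lifts_step.
split=> [y [p []]//|k p q a G b pq [_ _ _ _ [_ bB]]].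
have [|i []] := bB (\row_i p i); last by [].
by move=> i; rewrite mxE lexx pq.
Qed.

Lemma lifts_realmap : lifts R f setT.
Proof.
split=> [z _|k p q a G b pq [ca cG cb Gab _]].
  have [m [y [t [r E]]]] := is_cell_ex z; apply: (@realmap_ne m.+1 z).
  by exists m; split=> //; exists y, t.
have [n1 H1] := sk_compact degY (@compact_box R k p q) cb.
have cd : compact (bdry p q `*` I).
  apply: compact_setX.
    apply: subclosed_compact (@compact_box R k p q) _; last by move=> s [].
    exact: conic_closed_bdry (conic_box _ _).
  rewrite (_ : I = `[0, 1]%classic); first exact: segment_compact.
  by apply/seteqP; split=> t; rewrite /= in_itv.
have [n2 H2] := sk_compact degY cd cG.
have [|a' [G' [h1 h2 h3 h4 h5]]] := (lifts_sk (maxn n1 n2)).2 k p q a G b pq.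
  split=> //; split=> [s t ds It|s Ks].
    by apply: sk_le (H2 (s, t) (conj ds It)); exact: leq_maxr.
  by apply: sk_le (H1 s Ks); exact: leq_maxl.
by exists a', G'; split.
Qed.

End Step.

(** * From lifting to weak equivalences *)

Section Cubes.
Context {R : realType}.
Local Notation I := (@I01 R).
Local Notation UI := (unit_interval R).

Definition ubox n : set 'rV[R]_n := box (fun=> 0) (fun=> 1).
Definition ubdry n : set 'rV[R]_n := bdry (fun=> 0) (fun=> 1).

Lemma ubdryE n (s : 'rV[R]_n) :
  ubdry s <-> ubox s /\ exists i, s ord0 i = 0 \/ s ord0 i = 1.
Proof.
split=> -[Ks [i H]]; split=> //; first by exists i; have [] := H.
by exists i; split; [exact: ltr01|].
Qed.

(** Retractions built from [clamp] turn maps on [unit_interval] and [cube] into total functions. *)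
Definition clamp (t : R) : R := Num.max 0 (Num.min 1 t).

Lemma clampP t : 0 <= clamp t <= 1.
Proof. by rewrite /clamp le_max lexx /= ge_max ler01 ge_min lexx. Qed.

Lemma clamp_id t : I t -> clamp t = t.
Proof. by move=> /andP[h0 h1]; rewrite /clamp (min_idPr h1) (max_idPr h0). Qed.

Lemma cont_on_clamp {X : topologicalType} (A : set X) (g : X -> R) :
  cont_on A g -> cont_on A (fun x => clamp (g x)).
Proof.
move=> cg; apply: cont_on_max; first exact: cont_on_cst.
by apply: cont_on_min => //; exact: cont_on_cst.
Qed.

Lemma iproj_subproof t : clamp t \in (`[0, 1]%classic : set R).
Proof. by rewrite inE /= in_itv /=; exact: clampP. Qed.
Definition iproj (t : R) : UI := exist _ (clamp t) (iproj_subproof t).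
Definition ival (t : UI) : R := set_val t.

Lemma ival_I (t : UI) : I (ival t).
Proof. by have := set_valP t; rewrite /= in_itv. Qed.
Lemma iproj0 : iproj 0 = I0 R.
Proof. by apply: val_inj => /=; rewrite clamp_id//; exact: I0_I01. Qed.
Lemma iproj1 : iproj 1 = I1 R.
Proof. by apply: val_inj => /=; rewrite clamp_id//; exact: I1_I01. Qed.
Lemma cont_on_iproj {X : topologicalType} (A : set X) (g : X -> R) :
  cont_on A g -> cont_on A (fun x => iproj (g x)).
Proof. by move=> cg; apply: cont_on_set_type; exact: cont_on_clamp. Qed.
Lemma cont_on_ival {X : topologicalType} (A : set X) (g : X -> UI) :
  cont_on A g -> cont_on A (fun x => ival (g x)).
Proof. by move=> cg; apply: cont_on_comp_continuous cg; exact: initial_continuous. Qed.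

Lemma cproj_subproof n (s : 'rV[R]_n) :
  (\row_i clamp (s ord0 i)) \in [set s : 'rV[R]_n | forall i, 0 <= s ord0 i <= 1].
Proof. by rewrite inE => i; rewrite mxE; exact: clampP. Qed.
Definition cproj_row n (s : 'rV[R]_n) : 'rV[R]_n := \row_i clamp (s ord0 i).
Definition cproj n (s : 'rV[R]_n) : cube R n := exist _ (cproj_row s) (cproj_subproof s).

Lemma cube_val_ubox n (s : cube R n) : ubox (cube_val s).
Proof. by have := set_valP s. Qed.
Lemma cprojK n (s : 'rV[R]_n) : ubox s -> cube_val (cproj s) = s.
Proof. by move=> Ks; apply/rowP => i; rewrite /cube_val /= mxE clamp_id//; exact: Ks. Qed.
Lemma cube_valK n (s : cube R n) : cproj (cube_val s) = s.
Proof.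
apply: val_inj; apply/rowP => i; rewrite mxE clamp_id//; exact: cube_val_ubox.
Qed.
Lemma cont_on_cproj {X : topologicalType} (A : set X) n (g : X -> 'rV[R]_n) :
  cont_on A g -> cont_on A (fun x => cproj (g x)).
Proof.
move=> cg; apply: cont_on_set_type; apply: cont_on_row => i.
apply: (@cont_on_ext _ _ _ (fun x => clamp (g x ord0 i))).
  by move=> x _; rewrite /= mxE.
by apply: cont_on_clamp; exact: cont_on_coord.
Qed.
Lemma cont_on_cube_val {X : topologicalType} (A : set X) n (g : X -> cube R n) :
  cont_on A g -> cont_on A (fun x => cube_val (g x)).
Proof. by move=> cg; apply: cont_on_comp_continuous cg; exact: initial_continuous. Qed.

Lemma cube_boundaryP n (s : cube R n) : cube_boundary s <-> ubdry (cube_val s).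
Proof. by rewrite ubdryE; split=> [|[]//]; split=> //; exact: cube_val_ubox. Qed.

Lemma cont_on_cts {X Y Z : topologicalType} (A : set X) (h : continuousType Y Z) (g : X -> Y) :
  cont_on A g -> cont_on A (fun x => h (g x)).
Proof. by move=> cg; apply: cont_on_comp_continuous cg; exact: cts_fun. Qed.

(** The cube of dimension [n.+1] is regarded as a cylinder on the n-cube, its first coordinate being
    the height or the time of a homotopy. *)
Definition vhd n (s : 'rV[R]_n.+1) : R := s ord0 ord0.
Definition vtl n (s : 'rV[R]_n.+1) : 'rV[R]_n := \row_i s ord0 (lift ord0 i).
Definition vcons n (t : R) (w : 'rV[R]_n) : 'rV[R]_n.+1 :=
  \row_j (if unlift ord0 j is Some i then w ord0 i else t).

Lemma vhd_vcons n t (w : 'rV[R]_n) : vhd (vcons t w) = t.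
Proof. by rewrite /vhd mxE unlift_none. Qed.
Lemma vtl_vcons n t (w : 'rV[R]_n) : vtl (vcons t w) = w.
Proof. by apply/rowP => i; rewrite !mxE liftK. Qed.
Lemma vcons_vhd_vtl n (s : 'rV[R]_n.+1) : vcons (vhd s) (vtl s) = s.
Proof.
by apply/rowP => i; rewrite mxE; case: unliftP => [j ->|->//]; rewrite mxE.
Qed.
Lemma cont_on_vhd {X : topologicalType} (A : set X) n (g : X -> 'rV[R]_n.+1) :
  cont_on A g -> cont_on A (fun x => vhd (g x)).
Proof. exact: cont_on_coord. Qed.
Lemma cont_on_vtl {X : topologicalType} (A : set X) n (g : X -> 'rV[R]_n.+1) :
  cont_on A g -> cont_on A (fun x => vtl (g x)).
Proof.
move=> cg; apply: cont_on_row => i; apply: (@cont_on_ext _ _ _ (fun x => g x ord0 (lift ord0 i))).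
  by move=> x _; rewrite mxE.
exact: cont_on_coord.
Qed.
Lemma cont_on_vcons {X : topologicalType} (A : set X) n (h : X -> R) (g : X -> 'rV[R]_n) :
  cont_on A h -> cont_on A g -> cont_on A (fun x => vcons (h x) (g x)).
Proof.
move=> ch cg; apply: cont_on_row => j.
apply: (@cont_on_ext _ _ _ (fun x => if unlift ord0 j is Some i then g x ord0 i else h x)).
  by move=> x _; rewrite mxE.
by case: unliftP => // i _; exact: cont_on_coord.
Qed.
Lemma ubox_vcons n t (w : 'rV[R]_n) : I t -> ubox w -> ubox (vcons t w).
Proof. by move=> It Kw i; rewrite mxE; case: unliftP => [j _|_]//; exact: Kw. Qed.
Lemma ubox_vtl n (s : 'rV[R]_n.+1) : ubox s -> ubox (vtl s).
Proof. by move=> Ks i; rewrite mxE; exact: Ks. Qed.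
Lemma ubox_vhd n (s : 'rV[R]_n.+1) : ubox s -> I (vhd s).
Proof. by move=> Ks; exact: Ks. Qed.

Lemma ubdryS n (s : 'rV[R]_n.+1) :
  ubdry s <-> ubox s /\ [\/ vhd s = 0, vhd s = 1 | ubdry (vtl s)].
Proof.
rewrite ubdryE; split=> -[Ks H]; split=> //.
  case: H => i; case: (unliftP ord0 i) => [j ->|->] H; last by case: H => h; [apply: Or31|apply: Or32].
  apply: Or33; apply/ubdryE; split; first exact: ubox_vtl.
  by exists j; rewrite mxE.
case: H => [h|h|/ubdryE [_ [j]]]; [by exists ord0; left|by exists ord0; right|].
by rewrite mxE; exists (lift ord0 j).
Qed.

Lemma ubdry0 (s : 'rV[R]_0) : ~ ubdry s.
Proof. by move=> /ubdryE[_ [[m]]]. Qed.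

Lemma closed_ubox n : closed (@ubox n). Proof. exact: closed_box. Qed.
Lemma closed_ubdry n : closed (@ubdry n).
Proof. exact: conic_closed_bdry (conic_box _ _). Qed.
Lemma closed_vhd n (c : R) : closed [set s : 'rV[R]_n.+1 | vhd s = c].
Proof.
apply: (@closed_preim _ _ (@vhd n) [set c]); last exact: closed_eq.
by apply: cont_onT; apply: cont_on_vhd; exact: cont_on_id.
Qed.
Lemma closed_vtl n : closed [set s : 'rV[R]_n.+1 | ubdry (vtl s)].
Proof.
apply: (@closed_preim _ _ (@vtl n) (@ubdry n)); last exact: closed_ubdry.
by apply: cont_onT; apply: cont_on_vtl; exact: cont_on_id.
Qed.

End Cubes.
Arguments ubox {R} n.
Arguments ubdry {R} n.

Section LiftsWeq.
Context {R : realType} {X Y : topologicalType} (f : continuousType X Y).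
Local Notation I := (@I01 R).
Let cf : continuous f := @cts_fun _ _ f.

(** Injectivity on homotopy groups is lifting for a box of one dimension more: the map is the
    homotopy in [Y], and the two representatives with the basepoint on the walls lift its boundary.
    Surjectivity is lifting with constant boundary. Path components are the cases of dimensions 1
    and 0. *)
Lemma lifts_weak_equivalence : lifts R f setT -> weak_homotopy_equivalence R f.
Proof.
move=> [neX L].
(* Strictly commuting problems suffice here; their solutions keep the homotopy constant on the
   boundary. *)
have U (k : nat) a b : cont_on (ubdry k) a -> cont_on (ubox k) b ->
    (forall s, ubdry k s -> b s = f (a s)) ->
    exists (a' : 'rV[R]_k -> X) (G' : 'rV[R]_k * R -> Y),
    [/\ cont_on (ubox k) a', cont_on (ubox k `*` I) G', forall s, ubdry k s -> a' s = a s,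
      forall s t, ubdry k s -> I t -> G' (s, t) = f (a s)
    & forall s, ubox k s -> G' (s, 0) = f (a' s) /\ G' (s, 1) = b s].
  move=> ca cb ab; have [||a' [G' [h1 h2 h3 h4 _]]] := L k (fun=> 0) (fun=> 1) a
      (fun x => f (a x.1)) b.
  - by move=> i; exact: ler01.
  - split=> //; last by move=> s /ab.
    by apply: cont_on_cts; apply: (cont_on_comp ca (f := fst)) => [|x []//]; exact: cont_on_fst.
  exists a', G'; split=> //; first by move=> s /h3[].
  by move=> s t /h3[_ H] /H.
have i0 := @I0_I01 R; have i1 := @I1_I01 R.
split.
  split=> [x x' [p [p0 p1]]|y].
    pose a (s : 'rV[R]_1) := if pselect (vhd s = 0) then x else x'.
    have ca : cont_on (ubdry 1) a.
      apply: (@cont_on_sub _ _ _ ([set s | vhd s = 0] `|` [set s | vhd s = 1])).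
        by move=> s /ubdryS[_ [h|h|/ubdry0//]]; [left|right].
      apply: cont_on_glue2; [exact: closed_vhd|exact: closed_vhd|exact: cont_on_cst|exact: cont_on_cst|].
      by move=> s /= -> /eqP; rewrite eq_sym oner_eq0.
    have [||a' [G' [ca' _ a'a _ _]]] := U 1%N a (fun s => p (iproj (vhd s))) ca.
    - by apply: cont_on_cts; apply: cont_on_iproj; apply: cont_on_vhd; exact: cont_on_id.
    - move=> s /ubdryS[_ H]; rewrite /a; case: pselect => [s0|n0] /=.
        by rewrite s0 iproj0 p0.
      by case: H => // [->|/ubdry0//]; rewrite iproj1 p1.
    have cg : continuous (fun t : unit_interval R => a' (vcons (ival t) 0)).
      apply: cont_onT; apply: (cont_on_comp ca' (f := fun t : unit_interval R => vcons (ival t) 0)).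
        by apply: cont_on_vcons; [apply: cont_on_ival; exact: cont_on_id|exact: cont_on_cst].
      by move=> t _; apply: ubox_vcons; [exact: ival_I|case].
    exists (mkcts cg).
    have b0 (c : R) : c = 0 \/ c = 1 -> ubdry 1 (vcons c 0).
      move=> Hc; apply/ubdryS; rewrite vhd_vcons; split; last first.
        by case: Hc => ->; [apply: Or31|apply: Or32].
      by apply: ubox_vcons; [case: Hc => ->|case].
    split.
      transitivity (a' (vcons 0 0)); first by [].
      by rewrite a'a; [rewrite /a vhd_vcons; case: pselect|apply: b0; left].
    transitivity (a' (vcons 1 0)); first by [].
    rewrite a'a; last by apply: b0; right.
    by rewrite /a vhd_vcons; case: pselect => [h|//]; have /eqP := h; rewrite oner_eq0.
  have [x0 _] := neX y Logic.I.
  have [|||a' [G' [_ cG' _ _ E]]] := U 0%N (fun=> x0) (fun=> y).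
  - exact: cont_on_cst.
  - exact: cont_on_cst.
  - by move=> s /ubdry0.
  have K0 : ubox 0 (0 : 'rV[R]_0) by case.
  exists (a' 0).
  have cg : continuous (fun t : unit_interval R => G' (0, ival t)).
    apply: cont_onT.
    apply: (cont_on_comp cG' (f := fun t : unit_interval R => ((0 : 'rV[R]_0), ival t))) => [|t _].
      by apply: cont_on_pair; [exact: cont_on_cst|apply: cont_on_ival; exact: cont_on_id].
    by split=> //; exact: ival_I.
  by exists (mkcts cg); rewrite /mkcts /=; have [<- <-] := E 0 K0.
move=> n x0 n0; split=> [a0 a1 [H [H0 H1 Hb]]|b].
  pose A0 := [set s : 'rV[R]_n.+1 | vhd s = 0].
  pose A1 := [set s : 'rV[R]_n.+1 | vhd s = 1].
  pose A2 := [set s : 'rV[R]_n.+1 | ubdry n (vtl s)].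
  pose e (c : based_map R x0 n) (s : 'rV[R]_n.+1) := sval c (cproj (vtl s)).
  have ce (V : set 'rV[R]_n.+1) c : cont_on V (e c).
    by apply: cont_on_cts; apply: cont_on_cproj; apply: cont_on_vtl; exact: cont_on_id.
  have eb c s : A2 s -> e c s = x0.
    move=> ds; rewrite /e (svalP c)//; apply/cube_boundaryP.
    by rewrite cprojK//; case: ds.
  pose a s := if pselect (A0 s) then e a0 s else if pselect (A1 s) then e a1 s else x0.
  have n01 s : A0 s -> A1 s -> False.
    by rewrite /A0 /A1 /= => -> /eqP; rewrite eq_sym oner_eq0.
  have ca : cont_on (ubdry n.+1) a.
    apply: (@cont_on_sub _ _ _ (A0 `|` (A1 `|` A2))).
      by move=> s /ubdryS[_ [h|h|h]]; [left|right; left|right; right].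
    apply: cont_on_glue2 => //; [exact: closed_vhd| | |].
    - by apply: closedU; [exact: closed_vhd|exact: closed_vtl].
    - apply: cont_on_glue2 => //; [exact: closed_vhd|exact: closed_vtl|exact: cont_on_cst|].
      by move=> s _ /eb.
    - move=> s s0 H'; rewrite eb; last by case: H' => // /(n01 _ s0).
      by case: pselect => // h; case: (n01 _ s0 h).
  pose b (s : 'rV[R]_n.+1) := H (cproj (vtl s), iproj (vhd s)).
  have [||a' [G' [ca' _ a'a _ _]]] := U n.+1 a b ca.
  - apply: cont_on_cts; apply: cont_on_pair.
      by apply: cont_on_cproj; apply: cont_on_vtl; exact: cont_on_id.
    by apply: cont_on_iproj; apply: cont_on_vhd; exact: cont_on_id.
  - move=> s /ubdryS[Ks Hs]; rewrite /a /b; case: pselect => [s0|n0'] /=.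
      by rewrite s0 iproj0 H0.
    case: pselect => [s1|n1] /=; first by rewrite s1 iproj1 H1.
    case: Hs => // ds; have dc : cube_boundary (cproj (vtl s)).
      by apply/cube_boundaryP; rewrite cprojK//; case: ds.
    by rewrite Hb//= (svalP a0).
  have cg : continuous (fun x : cylinder R (cube R n) => a' (vcons (ival x.2) (cube_val x.1))).
    apply: cont_onT.
    apply: (cont_on_comp ca' (f := fun x : cylinder R (cube R n) => vcons (ival x.2) (cube_val x.1))).
      by apply: cont_on_vcons; [apply: cont_on_ival; exact: cont_on_snd|apply: cont_on_cube_val; exact: cont_on_fst].
    by move=> x _; apply: ubox_vcons; [exact: ival_I|exact: cube_val_ubox].
  have b01 (c : R) w : I c -> ubox n w -> c = 0 \/ c = 1 \/ ubdry n w -> ubdry n.+1 (vcons c w).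
    move=> Ic Kw Hc; apply/ubdryS; rewrite vhd_vcons vtl_vcons; split; first exact: ubox_vcons.
    by case: Hc => [->|[->|h]]; [apply: Or31|apply: Or32|apply: Or33].
  exists (mkcts cg); rewrite /mkcts; split=> [w|w|w t dw] /=.
  - change (a' (vcons 0 (cube_val w)) = sval a0 w).
    rewrite a'a; last by apply: b01 => //; [exact: cube_val_ubox|left].
    rewrite /a; case: pselect => [h|[]]; last by rewrite /A0 /= vhd_vcons.
    by rewrite /e vtl_vcons cube_valK.
  - change (a' (vcons 1 (cube_val w)) = sval a1 w).
    rewrite a'a; last by apply: b01 => //; [exact: cube_val_ubox|right; left].
    rewrite /a; case: pselect => [h|h'].
      by have := h; rewrite /A0 /= vhd_vcons => /eqP; rewrite oner_eq0.
    case: pselect => [h|[]]; last by rewrite /A1 /= vhd_vcons.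
    by rewrite /e vtl_vcons cube_valK.
  - change (a' (vcons (ival t) (cube_val w)) = sval a0 w).
    have dw' := dw; move/cube_boundaryP in dw'.
    rewrite a'a; last first.
      by apply: b01 => //; [exact: ival_I|exact: cube_val_ubox|right; right].
    have A2w : A2 (vcons (ival t) (cube_val w)) by rewrite /A2 /= vtl_vcons.
    rewrite (svalP a0)// /a; case: pselect => [h|h]; first exact: eb.
    by case: pselect => [h'|//]; exact: eb.
have [|||a' [G' [ca' cG' a'a G'a E]]] := U n (fun=> x0) (fun s => sval b (cproj s)).
- exact: cont_on_cst.
- by apply: cont_on_cts; apply: cont_on_cproj; exact: cont_on_id.
- move=> s ds; rewrite (svalP b)//; apply/cube_boundaryP.
  by rewrite cprojK//; case: ds.
have cg : continuous (fun s : cube R n => a' (cube_val s)).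
  apply: cont_onT; apply: (cont_on_comp ca' (f := @cube_val R n)).
    by apply: cont_on_cube_val; exact: cont_on_id.
  by move=> s _; exact: cube_val_ubox.
have gb (s : cube R n) : cube_boundary s -> (mkcts cg : continuousType _ _) s = x0.
  by move=> /cube_boundaryP ds; exact: (a'a _ ds).
exists (exist (fun c : continuousType (cube R n) X => forall s, cube_boundary s -> c s = x0) (mkcts cg) gb).
have cH : continuous (fun x : cylinder R (cube R n) => G' (cube_val x.1, ival x.2)).
  apply: cont_onT.
  apply: (cont_on_comp cG' (f := fun x : cylinder R (cube R n) => (cube_val x.1, ival x.2))).
    by apply: cont_on_pair; [apply: cont_on_cube_val; exact: cont_on_fst|apply: cont_on_ival; exact: cont_on_snd].
  by move=> x _; split; [exact: cube_val_ubox|exact: ival_I].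
exists (mkcts cH); split=> [s|s|s t ds].
- exact: (E _ (cube_val_ubox s)).1.
- have [_ H] := E _ (cube_val_ubox s); change (G' (cube_val s, 1) = sval b s).
  by rewrite H cube_valK.
- have /cube_boundaryP ds' := ds.
  change (G' (cube_val s, ival t) = f (a' (cube_val s))).
  by rewrite G'a//; [rewrite a'a|exact: ival_I].
Qed.

End LiftsWeq.

(** * From weak equivalences to lifting *)

Section SolvableExt.
Context {R : realType} {X Y W : topologicalType}.
Variables (f : X -> Y) (B : set Y) (K dK : set W).
Local Notation I := (@I01 R).

Lemma solvable_ext (a a2 : W -> X) (G G2 : W * R -> Y) (b b2 : W -> Y) :
  (forall s, dK s -> a2 s = a s) ->
  (forall s t, dK s -> I t -> G2 (s, t) = G (s, t)) ->
  (forall s, K s -> b2 s = b s) ->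
  solvable f B K dK a2 G2 b2 -> solvable f B K dK a G b.
Proof.
move=> aa GG bb [a' [G' [h1 h2 h3 h4 h5]]]; exists a', G'; split=> //.
  move=> s ds; have [-> H] := h3 s ds; rewrite aa//; split=> // t It.
  by rewrite H// GG.
by move=> s Ks; have [-> ->] := h4 s Ks; rewrite bb.
Qed.

Lemma solvable_transport (W' : topologicalType) (K' dK' : set W')
    (phi : W' -> W) (psi : W -> W') a (G : W * R -> Y) b :
  cont_on K' phi -> cont_on K psi ->
  (forall w, K' w -> K (phi w)) -> (forall w, dK' w -> dK (phi w)) ->
  (forall w, dK' w -> K' w) -> (forall w, dK w -> K w) ->
  (forall w, K w -> K' (psi w)) -> (forall w, dK w -> dK' (psi w)) ->
  (forall w, K w -> phi (psi w) = w) ->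
  (forall a (G : W' * R -> Y) b, problem f B K' dK' a G b -> solvable f B K' dK' a G b) ->
  problem f B K dK a G b -> solvable f B K dK a G b.
Proof.
move=> cphi cpsi K'K dK'K sK' dKK KK' dKK' pK H [ca cG cb Gab [GB bB]].
have [|a' [G' [h1 h2 h3 h4 h5]]] := H (a \o phi) (fun x => G (phi x.1, x.2)) (b \o phi).
  split.
  - by apply: (cont_on_comp ca) => //; apply: cont_on_sub cphi.
  - apply: (cont_on_comp cG (f := fun x : W' * R => (phi x.1, x.2))).
      apply: cont_on_pair; last exact: cont_on_snd.
      by apply: (cont_on_comp cphi (f := fst)) => [|x [/sK']//]; exact: cont_on_fst.
    by move=> [w t] [/= dw It]; split=> //=; exact: dK'K.
  - exact: (cont_on_comp cb).
  - by move=> s ds; apply: Gab; exact: dK'K.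
  - by split=> [s t ds It|s Ks]; [apply: GB => //; exact: dK'K|apply: bB; exact: K'K].
exists (a' \o psi), (fun x => G' (psi x.1, x.2)); split.
- exact: (cont_on_comp h1).
- apply: (cont_on_comp h2 (f := fun x : W * R => (psi x.1, x.2))).
    apply: cont_on_pair; last exact: cont_on_snd.
    by apply: (cont_on_comp cpsi (f := fst)) => [|x []//]; exact: cont_on_fst.
  by move=> [w t] [/= Kw It]; split=> //=; exact: KK'.
- move=> s ds; have [/= -> E] := h3 _ (dKK' s ds); rewrite pK; last exact: dKK.
  by split=> // t It; rewrite E// pK//; exact: dKK.
- move=> s Ks; have [E1 E2] := h4 _ (KK' s Ks).
  by rewrite /= E1 E2 /= pK.
- by move=> s t Ks It; apply: h5 => //; exact: KK'.
Qed.

End SolvableExt.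

Section WeqLifts.
Context {R : realType} {X Y : topologicalType} (f : continuousType X Y).
Local Notation I := (@I01 R).
Let cf : continuous f := @cts_fun _ _ f.
Let i0 : I 0 := @I0_I01 R.
Let i1 : I 1 := @I1_I01 R.

Definition csolvable (k : nat) (a : 'rV[R]_k -> X) (b : 'rV[R]_k -> Y) :=
  solvable f setT (ubox k) (ubdry k) a (fun x : 'rV[R]_k * R => f (a x.1)) b.

Lemma csolvable_homotopic k (a : 'rV[R]_k * R -> X) (b : 'rV[R]_k * R -> Y) :
  cont_on (ubdry k `*` I) a -> cont_on (ubox k `*` I) b ->
  (forall s u, ubdry k s -> I u -> b (s, u) = f (a (s, u))) ->
  csolvable (fun s => a (s, 1)) (fun s => b (s, 1)) ->
  csolvable (fun s => a (s, 0)) (fun s => b (s, 0)).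
Proof.
move=> ca cb ab H.
apply: (@solvable_homotopic R X Y f cf _ setT _ _ (conic_box _ _) a
  (fun x => f (a (x.1.1, x.2))) b) => //.
- apply: cont_on_cts; apply: (cont_on_comp ca (f := fun x : 'rV[R]_k * R * R => (x.1.1, x.2))).
    apply: cont_on_pair; last exact: cont_on_snd.
    by apply: cont_on_comp_continuous; [exact: fst_continuous|exact: cont_on_fst].
  by move=> [[s t] u] [[/= ds It] Iu].
- by move=> s u ds Iu; rewrite ab.
Qed.

Hypothesis wf : weak_homotopy_equivalence R f.

(** Injectivity on path components or on a homotopy group. The nullhomotopy [h] need not lie over
    [be]; the discrepancy will be an element of the next homotopy group of [Y]. *)
Lemma weq_null k (x0 : X) (al : 'rV[R]_k -> X) (be : 'rV[R]_k * R -> Y) :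
  cont_on (ubox k) al -> cont_on (ubox k `*` I) be ->
  (forall w, ubdry k w -> al w = x0) ->
  (forall w, ubox k w -> be (w, 0) = f x0 /\ be (w, 1) = f (al w)) ->
  (forall w t, ubdry k w -> I t -> be (w, t) = f x0) ->
  exists h : 'rV[R]_k * R -> X, [/\ cont_on (ubox k `*` I) h,
    forall w, ubox k w -> h (w, 0) = x0 /\ h (w, 1) = al w
  & forall w t, ubdry k w -> I t -> h (w, t) = x0].
Proof.
case: k al be => [|k] al be cal cbe ald be01 bed.
  have K0 : ubox 0 (0 : 'rV[R]_0) by case.
  have [[inj _] _] := wf.
  have cp : continuous (fun t : unit_interval R => be (0, ival t)).
    apply: cont_onT.
    apply: (cont_on_comp cbe (f := fun t : unit_interval R => ((0 : 'rV[R]_0), ival t))).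
      by apply: cont_on_pair; [exact: cont_on_cst|apply: cont_on_ival; exact: cont_on_id].
    by move=> t _; split=> //; exact: ival_I.
  have [|p [p0 p1]] := inj x0 (al 0).
    by exists (mkcts cp); have [h0 h1] := be01 0 K0; split.
  exists (fun x => p (iproj x.2)); split.
  - by apply: cont_on_cts; apply: cont_on_iproj; exact: cont_on_snd.
  - move=> w _; have -> : w = 0 by apply/rowP => -[].
    by rewrite /= iproj0 iproj1 p0 p1.
  - by move=> w t /ubdry0.
have [_ /(_ k.+1 x0 isT)[inj _]] := wf.
have cal' : continuous (fun s : cube R k.+1 => al (cube_val s)).
  apply: cont_onT; apply: (cont_on_comp cal (f := @cube_val R k.+1)).
    by apply: cont_on_cube_val; exact: cont_on_id.
  by move=> s _; exact: cube_val_ubox.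
have c0 : continuous (fun s : cube R k.+1 => x0) by apply: cont_onT; exact: cont_on_cst.
have bal (s : cube R k.+1) : cube_boundary s -> (mkcts cal' : continuousType _ _) s = x0.
  by move=> /cube_boundaryP ds; exact: (ald _ ds).
pose A1 : based_map R x0 k.+1 :=
  exist (fun c : continuousType (cube R k.+1) X => forall s, cube_boundary s -> c s = x0) (mkcts cal') bal.
pose A0 : based_map R x0 k.+1 :=
  exist (fun c : continuousType (cube R k.+1) X => forall s, cube_boundary s -> c s = x0) (mkcts c0) (fun _ _ => erefl).
have cH : continuous (fun x : cylinder R (cube R k.+1) => be (cube_val x.1, ival x.2)).
  apply: cont_onT.
  apply: (cont_on_comp cbe (f := fun x : cylinder R (cube R k.+1) => (cube_val x.1, ival x.2))).
    by apply: cont_on_pair; [apply: cont_on_cube_val; exact: cont_on_fst|apply: cont_on_ival; exact: cont_on_snd].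
  by move=> x _; split; [exact: cube_val_ubox|exact: ival_I].
have [|H [H0 H1 Hd]] := inj A0 A1.
  exists (mkcts cH); split=> [s|s|s t /cube_boundaryP ds].
  - exact: (be01 _ (cube_val_ubox s)).1.
  - exact: (be01 _ (cube_val_ubox s)).2.
  - by apply: (bed _ _ ds); exact: ival_I.
exists (fun x => H (cproj x.1, iproj x.2)); split.
- apply: cont_on_cts; apply: cont_on_pair; first by apply: cont_on_cproj; exact: cont_on_fst.
  by apply: cont_on_iproj; exact: cont_on_snd.
- move=> w Kw; rewrite /= iproj0 iproj1 H0 H1; split=> //.
  change (al (cube_val (cproj w)) = al w); by rewrite cprojK.
- move=> w t dw It; apply: Hd; apply/cube_boundaryP.
  by rewrite cprojK//; case: dw.
Qed.

Lemma weq_surj k (x0 : X) (c : 'rV[R]_k.+1 -> Y) :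
  cont_on (ubox k.+1) c -> (forall s, ubdry k.+1 s -> c s = f x0) ->
  csolvable (fun=> x0) c.
Proof.
move=> cc cd; have [_ /(_ k.+1 x0 isT)[_ surj]] := wf.
have cc' : continuous (fun s : cube R k.+1 => c (cube_val s)).
  apply: cont_onT; apply: (cont_on_comp cc (f := @cube_val R k.+1)).
    by apply: cont_on_cube_val; exact: cont_on_id.
  by move=> s _; exact: cube_val_ubox.
have bc (s : cube R k.+1) : cube_boundary s -> (mkcts cc' : continuousType _ _) s = f x0.
  by move=> /cube_boundaryP ds; exact: (cd _ ds).
have [a [H [H0 H1 Hd]]] := surj (exist (fun c : continuousType (cube R k.+1) Y =>
  forall s, cube_boundary s -> c s = f x0) (mkcts cc') bc).
exists (fun s => sval a (cproj s)), (fun x => H (cproj x.1, iproj x.2)).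
have db s : ubdry k.+1 s -> cube_boundary (cproj s).
  by move=> ds; apply/cube_boundaryP; rewrite cprojK//; case: ds.
split=> //.
- by apply: cont_on_cts; apply: cont_on_cproj; exact: cont_on_id.
- apply: cont_on_cts; apply: cont_on_pair; first by apply: cont_on_cproj; exact: cont_on_fst.
  by apply: cont_on_iproj; exact: cont_on_snd.
- move=> s /db ds; rewrite (svalP a)//; split=> // t It /=.
  rewrite Hd//; change (f (sval a (cproj s)) = f x0); by rewrite (svalP a).
- move=> s Ks; rewrite /= iproj0 iproj1 H0 H1; split=> //.
  change (c (cube_val (cproj s)) = c s); by rewrite cprojK.
Qed.

Lemma ubdry_cases k (s : 'rV[R]_k.+1) : ubdry k.+1 s ->
  [\/ vhd s = 0, vhd s = 1 | ubdry k (vtl s)].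
Proof. by move=> /ubdryS[]. Qed.

Lemma ubdry_box k (s : 'rV[R]_k) : ubdry k s -> ubox k s.
Proof. by case. Qed.

(* [b] is a nullhomotopy of the image of the top face of [a]; by injectivity
   that face is null in [X], by [h], and gluing the image of [h] on top of [b]
   gives an element of a homotopy group of [Y], to be lifted. *)
Lemma weq_solvable_face k (x0 : X) (a : 'rV[R]_k.+1 -> X) (b : 'rV[R]_k.+1 -> Y) :
  cont_on (ubdry k.+1) a -> cont_on (ubox k.+1) b ->
  (forall s, ubdry k.+1 s -> b s = f (a s)) ->
  (forall s, ubox k.+1 s -> vhd s = 0 \/ ubdry k (vtl s) -> a s = x0) ->
  csolvable a b.
Proof.
move=> ca cb ab aJ.
have bd1 (w : 'rV[R]_k) : ubox k w -> ubdry k.+1 (vcons 1 w).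
  by move=> Kw; apply/ubdryS; split; [exact: ubox_vcons|apply: Or32; rewrite vhd_vcons].
have bJ s : ubox k.+1 s -> vhd s = 0 \/ ubdry k (vtl s) -> b s = f x0.
  move=> Ks H; rewrite ab ?aJ//; apply/ubdryS; split=> //.
  by case: H => h; [apply: Or31|apply: Or33].
have [||||w t|h [ch h01 hd_]] := @weq_null k x0 (fun w => a (vcons 1 w)) (fun x => b (vcons x.2 x.1)).
- apply: (cont_on_comp ca (f := @vcons R k 1)) => //.
  by apply: cont_on_vcons; [exact: cont_on_cst|exact: cont_on_id].
- apply: (cont_on_comp cb (f := fun x : 'rV[R]_k * R => vcons x.2 x.1)).
    by apply: cont_on_vcons; [exact: cont_on_snd|exact: cont_on_fst].
  by move=> [w t] [/= Kw It]; exact: ubox_vcons.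
- move=> w dw; apply: aJ; last by right; rewrite vtl_vcons.
  by apply: ubox_vcons => //; exact: ubdry_box.
- move=> w Kw; split; last by rewrite ab//; exact: bd1.
  by apply: bJ; [exact: ubox_vcons|left; rewrite vhd_vcons].
- move=> dw It; apply: bJ; last by right; rewrite vtl_vcons.
  by apply: ubox_vcons => //; exact: ubdry_box.
pose J := [set s : 'rV[R]_k.+1 | vhd s = 0 \/ ubdry k (vtl s)].
have cJ : closed J by apply: closedU; [exact: closed_vhd|exact: closed_vtl].
(* Deforms [a] to the constant [x0], by running [h] backwards on the top face. *)
pose a_ (x : 'rV[R]_k.+1 * R) :=
  if pselect ((J `*` I) x) then x0 else h (vtl x.1, 1 - x.2).
pose A2 := ((ubox k.+1 `&` [set s | vhd s = 1]) `*` I : set ('rV[R]_k.+1 * R)).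
have ctlu (V : set ('rV[R]_k.+1 * R)) (g : 'rV[R]_k.+1 * R -> R) : cont_on V g ->
    cont_on V (fun x => (vtl x.1, g x)).
  by move=> cg; apply: cont_on_pair => //; apply: cont_on_vtl; exact: cont_on_fst.
have chd (V : set ('rV[R]_k.+1 * R)) : cont_on V (fun x => vhd x.1).
  by apply: cont_on_vhd; exact: cont_on_fst.
have cu1 (V : set ('rV[R]_k.+1 * R)) : cont_on V (fun x => 1 - x.2).
  by apply: cont_on_subr; [exact: cont_on_cst|exact: cont_on_snd].
have ca_ : cont_on (ubdry k.+1 `*` I) a_.
  apply: (@cont_on_sub _ _ _ ((J `*` I) `|` A2)).
    move=> [s u] [/= ds Iu]; have Ks := ubdry_box ds.
    by case: (ubdry_cases ds) => H; [left; split=> //; left|right; split|left; split=> //; right].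
  apply: cont_on_glue2.
  - by apply: closed_setX => //; exact: closed_I01.
  - apply: closed_setX; last exact: closed_I01.
    by apply: closedI; [exact: closed_ubox|exact: closed_vhd].
  - exact: cont_on_cst.
  - apply: (cont_on_comp ch (ctlu _ _ (cu1 _))) => -[s u] [[/= Ks _] Iu].
    by split=> /=; [exact: ubox_vtl|exact: I01C].
  - move=> [s u] [/= [h0|dt] Iu] [[/= _ h1] _].
      by move: h0; rewrite h1 => /eqP; rewrite oner_eq0.
    by rewrite hd_//; exact: I01C.
(* The height is stretched by [1 + u]: [b] occupies the heights up to 1, and above it stands the
   image of [h], run backwards. The top, at height [1 + u], sees [h] at time [1 - u], in agreement
   with [a_]. *)
pose e (x : 'rV[R]_k.+1 * R) := vhd x.1 * (1 + x.2).
have ce (V : set ('rV[R]_k.+1 * R)) : cont_on V e.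
  by apply: cont_on_mul => //; apply: cont_on_add; [exact: cont_on_cst|exact: cont_on_snd].
pose b_ (x : 'rV[R]_k.+1 * R) :=
  if pselect (((ubox k.+1 `*` I) `&` [set x | e x <= 1]) x) then b (vcons (e x) (vtl x.1))
  else f (h (vtl x.1, 2 - e x)).
have ccl : closed (ubox k.+1 `*` I : set ('rV[R]_k.+1 * R)).
  by apply: closed_setX; [exact: closed_ubox|exact: closed_I01].
have cb_ : cont_on (ubox k.+1 `*` I) b_.
  pose A3 := ((ubox k.+1 `*` I) `&` [set x | 1 <= e x]) : set ('rV[R]_k.+1 * R).
  apply: (@cont_on_sub _ _ _ (((ubox k.+1 `*` I) `&` [set x | e x <= 1]) `|` A3)).
    by move=> x Kx; have [h1|/ltW h1] := leP (e x) 1; [left|right].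
  have cT := cont_onT (ce setT).
  apply: cont_on_glue2.
  - apply: closedI => //; apply: (@closed_preim _ _ e [set y | y <= 1]); first exact: cT.
    exact: closed_le.
  - apply: closedI => //; apply: (@closed_preim _ _ e [set y | 1 <= y]); first exact: cT.
    exact: closed_ge.
  - apply: (cont_on_comp cb (f := fun x => vcons (e x) (vtl x.1))).
      by apply: cont_on_vcons => //; apply: cont_on_vtl; exact: cont_on_fst.
    move=> [s u] [[/= Ks /andP[u0 u1]] h1]; apply: ubox_vcons; last exact: ubox_vtl.
    have /andP[s0 s1] := ubox_vhd Ks; apply/andP; split=> //.
    by rewrite /e /=; apply: mulr_ge0 => //; lra.
  - apply: cont_on_cts; apply: (cont_on_comp ch (f := fun x => (vtl x.1, 2 - e x))).
      by apply: ctlu; apply: cont_on_subr => //; exact: cont_on_cst.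
    move=> [s u] [[/= Ks /andP[u0 u1]] h1]; split=> /=; first exact: ubox_vtl.
    have /andP[s0 s1] := ubox_vhd Ks; move: h1; rewrite /e /= => h1.
    have : vhd s * (1 + u) <= 1 * (1 + u) by rewrite ler_pM2r//; lra.
    by move=> h2; apply/andP; split; lra.
  - move=> [s u] [[Ks _] /= h1] [[_ _] /= h2]; have Kt := ubox_vtl Ks.
    have -> : e (s, u) = 1 by apply/eqP; rewrite eq_le h1.
    rewrite (_ : 2 - 1 = 1); last by ring.
    by rewrite (h01 _ Kt).2 ab//; exact: bd1.
have a_J s u : I u -> ubox k.+1 s -> vhd s = 0 \/ ubdry k (vtl s) -> a_ (s, u) = x0.
  by move=> Iu Ks H; rewrite /a_; case: pselect => // nH; case: nH; split.
have a_h s u : I u -> ubox k.+1 s -> vhd s = 1 -> a_ (s, u) = h (vtl s, 1 - u).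
  move=> Iu Ks H; rewrite /a_; case: pselect => // -[/= [h0|dt] _].
    by move: h0; rewrite H => /eqP; rewrite oner_eq0.
  by rewrite hd_//; exact: I01C.
have ab_ s u : ubdry k.+1 s -> I u -> b_ (s, u) = f (a_ (s, u)).
  move=> ds Iu; have Ks := ubdry_box ds; have Kt := ubox_vtl Ks.
  have /andP[u0 u1] := Iu; have /andP[s0 s1] := ubox_vhd Ks.
  have e0 : 0 <= e (s, u) by rewrite /e /=; apply: mulr_ge0 => //; lra.
  have eI : e (s, u) <= 2.
    have : vhd s * (1 + u) <= 1 * (1 + u) by rewrite ler_pM2r//; lra.
    by rewrite /e /=; lra.
  have [HJ|nJ] := pselect (vhd s = 0 \/ ubdry k (vtl s)).
    rewrite a_J// /b_; case: pselect => [[_ /= h1]|n1].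
      apply: bJ; first by apply: ubox_vcons => //; apply/andP.
      by rewrite vhd_vcons vtl_vcons /e; case: HJ => /= [->|dt]; [left; rewrite mul0r|right].
    have e1 : 1 < e (s, u) by rewrite ltNge; apply/negP => h1; apply: n1; split.
    case: HJ => [h0|dt].
      by move: e1; rewrite /e /= h0 mul0r ltr10.
    rewrite hd_//; apply/andP; split; lra.
  have hs1 : vhd s = 1 by case: (ubdry_cases ds) => // H; case: nJ; [left|right].
  rewrite a_h// /b_; case: pselect => [[_ /= h1]|n1].
    have E : u = 0 by move: h1; rewrite /e /= hs1; lra.
    rewrite /e /= hs1 E addr0 mulr1 subr0 (h01 _ Kt).2.
    by rewrite ab//; exact: bd1.
  by congr (f (h (_, _))); rewrite /e /= hs1; ring.
(* By time 1 the whole boundary has reached [x0], and surjectivity on a homotopy group applies. *)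
have S1 : csolvable (fun s => a_ (s, 1)) (fun s => b_ (s, 1)).
  have a1 s : ubdry k.+1 s -> a_ (s, 1) = x0.
    move=> ds; have Ks := ubdry_box ds.
    case: (ubdry_cases ds) => H; [by apply: a_J => //; left| |by apply: a_J => //; right].
    by rewrite a_h// subrr (h01 _ (ubox_vtl Ks)).1.
  apply: solvable_ext (@weq_surj k x0 (fun s => b_ (s, 1)) _ _) => //.
  - by move=> s ds; rewrite a1.
  - by move=> s t ds It; rewrite /= a1.
  - apply: (cont_on_comp cb_ (f := fun s : 'rV[R]_k.+1 => (s, 1 : R))) => [|s Ks]; last by split.
    by apply: cont_on_pair; [exact: cont_on_id|exact: cont_on_cst].
  - by move=> s ds; rewrite ab_// a1.
have a0E s : ubdry k.+1 s -> a_ (s, 0) = a s.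
  move=> ds; have Ks := ubdry_box ds.
  case: (ubdry_cases ds) => H.
  - by rewrite a_J ?aJ//; left.
  - by rewrite a_h// subr0 (h01 _ (ubox_vtl Ks)).2 -[in RHS](vcons_vhd_vtl s) H.
  - by rewrite a_J ?aJ//; right.
apply: solvable_ext (csolvable_homotopic ca_ cb_ ab_ S1) => //.
- by move=> s t ds It; rewrite /= a0E.
- move=> s Ks; rewrite /b_; have /andP[s0 s1] := ubox_vhd Ks.
  have E : e (s, 0) = vhd s by rewrite /e /= addr0 mulr1.
  case: pselect => [p|[]]; first by rewrite /= E vcons_vhd_vtl.
  by split=> //=; rewrite E.
Qed.

(* The faces other than the top one contract, through themselves, to a vertex. *)
Lemma weq_solvable_cube k (a : 'rV[R]_k -> X) (b : 'rV[R]_k -> Y) :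
  cont_on (ubdry k) a -> cont_on (ubox k) b -> (forall s, ubdry k s -> b s = f (a s)) ->
  csolvable a b.
Proof.
case: k a b => [|k] a b ca cb ab.
  have [[_ surj] _] := wf; have [x [p [p0 p1]]] := surj (b 0).
  exists (fun=> x), (fun x => p (iproj x.2)); split=> //.
  - exact: cont_on_cst.
  - by apply: cont_on_cts; apply: cont_on_iproj; exact: cont_on_snd.
  - by move=> s /ubdry0.
  - move=> s _; have -> : s = 0 by apply/rowP => -[].
    by rewrite /= iproj0 iproj1.
pose J := ubox k.+1 `&` [set s : 'rV[R]_k.+1 | vhd s = 0 \/ ubdry k (vtl s)].
have cJ : closed J.
  apply: closedI; first exact: closed_ubox.
  by apply: closedU; [exact: closed_vhd|exact: closed_vtl].
(* The height is brought to 0 for [u <= 1 / 2], the other coordinates afterwards. In the first half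
   a wall moves in itself, since [m2 = 1]; in the second half everything is in the bottom face,
   since [m1 = 0]. *)
pose m1 (u : R) := Num.max 0 (1 - 2 * u); pose m2 (u : R) := Num.min 1 (2 - 2 * u).
pose j (x : 'rV[R]_k.+1 * R) : 'rV[R]_k.+1 :=
  vcons (m1 x.2 * vhd x.1) (\row_i (m2 x.2 * vtl x.1 ord0 i)).
have cj (V : set ('rV[R]_k.+1 * R)) : cont_on V j.
  apply: cont_on_vcons.
    apply: cont_on_mul; last by apply: cont_on_vhd; exact: cont_on_fst.
    apply: cont_on_max; first exact: cont_on_cst.
    apply: cont_on_subr; first exact: cont_on_cst.
    by apply: cont_on_mul; [exact: cont_on_cst|exact: cont_on_snd].
  apply: cont_on_row => i; apply: (@cont_on_ext _ _ _ (fun x => m2 x.2 * vtl x.1 ord0 i)).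
    by move=> x _; rewrite [RHS]mxE.
  apply: cont_on_mul; last by apply: cont_on_coord; apply: cont_on_vtl; exact: cont_on_fst.
  apply: cont_on_min; first exact: cont_on_cst.
  apply: cont_on_subr; first exact: cont_on_cst.
  by apply: cont_on_mul; [exact: cont_on_cst|exact: cont_on_snd].
have m1I u : I u -> I (m1 u).
  by move=> /andP[? ?]; rewrite /I01 /m1 /= le_max lexx /= ge_max ler01 /=; lra.
have m2I u : I u -> I (m2 u).
  move=> /andP[? ?]; rewrite /I01 /m2 /= le_min ler01 /= ge_min lexx /= andbT; lra.
have jbox s u : ubox k.+1 s -> I u -> ubox k.+1 (j (s, u)).
  move=> Ks Iu; apply: ubox_vcons; first by apply: I01M; [exact: m1I|exact: ubox_vhd].
  by move=> i; rewrite mxE; apply: I01M; [exact: m2I|exact: ubox_vtl].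
have m12 u : I u -> m1 u = 0 \/ m2 u = 1.
  move=> /andP[? ?]; rewrite /m1 /m2; have [h|h] := leP u (1 / 2).
    by right; rewrite (min_idPl _)//; lra.
  by left; rewrite (max_idPl _)//; lra.
have jJ s u : J s -> I u -> J (j (s, u)).
  move=> [Ks H] Iu; split; first exact: jbox.
  rewrite /= /j vhd_vcons vtl_vcons; case: H => [->|dt]; first by left; rewrite mulr0.
  case: (m12 u Iu) => /= ->; [by left; rewrite mul0r|right].
  by have -> : (\row_i (1 * vtl s ord0 i)) = vtl s by apply/rowP => i; rewrite mxE mul1r.
have j0 s : j (s, 0) = s.
  rewrite /j /= /m1 /m2 mulr0 !subr0 (max_idPr _) ?ler01// (min_idPl _); last by lra.
  rewrite mul1r -[RHS]vcons_vhd_vtl; congr (vcons _ _).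
  by apply/rowP => i; rewrite mxE mul1r.
have j1 s : j (s, 1) = 0.
  rewrite /j /= /m1 /m2 mulr1 (max_idPl _); last by lra.
  rewrite (min_idPr _); last by lra.
  apply/rowP => i; rewrite !mxE; case: unliftP => [l _|_]; last by rewrite mul0r.
  by rewrite mxE subrr mul0r.
have Jd s : J s -> ubdry k.+1 s.
  move=> [Ks H]; apply/ubdryS; split=> //.
  by case: H => h; [apply: Or31|apply: Or33].
have bd1 (w : 'rV[R]_k) : ubox k w -> ubdry k.+1 (vcons 1 w).
  by move=> Kw; apply/ubdryS; split; [exact: ubox_vcons|apply: Or32; rewrite vhd_vcons].
have J1 (w : 'rV[R]_k) : ubdry k w -> J (vcons 1 w).
  move=> dw; split; first by apply: ubox_vcons => //; exact: ubdry_box.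
  by right; rewrite vtl_vcons.
have caJ : cont_on (J `*` I) (fun x => a (j x)).
  by apply: (cont_on_comp ca (cj _)) => -[s u] [/= Js Iu]; apply: Jd; exact: jJ.
(* Extends the contraction from the rim of the top face over that face; time is reversed because
   [conic_fill] prescribes the end 1. *)
have [|||h [ch hs h1 _]] := @conic_fill R _ _ _ (conic_box (fun=> 0) (fun=> 1 : R)) X
    (fun x : 'rV[R]_k * R => a (j (vcons 1 x.1, 1 - x.2))) (fun w => a (vcons 1 w)).
- apply: (cont_on_comp caJ (f := fun x : 'rV[R]_k * R => (vcons 1 x.1, 1 - x.2))).
    apply: cont_on_pair; first by apply: cont_on_vcons; [exact: cont_on_cst|exact: cont_on_fst].
    by apply: cont_on_subr; [exact: cont_on_cst|exact: cont_on_snd].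
  by move=> [w u] [/= dw Iu]; split=> /=; [exact: J1|exact: I01C].
- apply: (cont_on_comp ca (f := @vcons R k 1)) => //.
  by apply: cont_on_vcons; [exact: cont_on_cst|exact: cont_on_id].
- by move=> w dw; rewrite /= subrr j0.
pose a_ (x : 'rV[R]_k.+1 * R) :=
  if pselect ((J `*` I) x) then a (j x) else h (vtl x.1, 1 - x.2).
pose A2 := ((ubox k.+1 `&` [set s | vhd s = 1]) `*` I : set ('rV[R]_k.+1 * R)).
have ca_ : cont_on (ubdry k.+1 `*` I) a_.
  apply: (@cont_on_sub _ _ _ ((J `*` I) `|` A2)).
    move=> [s u] [/= ds Iu]; have Ks := ubdry_box ds.
    by case: (ubdry_cases ds) => H; [left; split=> //; split=> //; left|right; split|
      left; split=> //; split=> //; right].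
  apply: cont_on_glue2 => //.
  - by apply: closed_setX => //; exact: closed_I01.
  - apply: closed_setX; last exact: closed_I01.
    by apply: closedI; [exact: closed_ubox|exact: closed_vhd].
  - apply: (cont_on_comp ch (f := fun x : 'rV[R]_k.+1 * R => (vtl x.1, 1 - x.2))).
      apply: cont_on_pair; first by apply: cont_on_vtl; exact: cont_on_fst.
      by apply: cont_on_subr; [exact: cont_on_cst|exact: cont_on_snd].
    by move=> [s u] [[/= Ks _] Iu]; split=> /=; [exact: ubox_vtl|exact: I01C].
  - move=> [s u] [/= [Ks Js] Iu] [[/= _ s1] _].
    have dt : ubdry k (vtl s).
      case: Js => // h0; move: s1; rewrite h0 => /eqP; by rewrite eq_sym oner_eq0.
    rewrite hs//; last exact: I01C.
    rewrite /= (_ : 1 - (1 - u) = u); last by ring.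
    by rewrite -s1 vcons_vhd_vtl.
have a_J s u : J s -> I u -> a_ (s, u) = a (j (s, u)).
  by move=> Js Iu; rewrite /a_; case: pselect => // nH; case: nH; split.
have a_0 s : ubdry k.+1 s -> a_ (s, 0) = a s.
  move=> ds; have Ks := ubdry_box ds.
  have [Js|nJ] := pselect (J s); first by rewrite a_J// j0.
  have s1 : vhd s = 1.
    by case: (ubdry_cases ds) => // H; case: nJ; split=> //; [left|right].
  rewrite /a_; case: pselect => [[]//|_] /=.
  rewrite subr0 h1; last exact: ubox_vtl.
  by rewrite -[in RHS](vcons_vhd_vtl s) s1.
have a_1 s : J s -> a_ (s, 1) = a 0 by move=> Js; rewrite a_J// j1.
(* The image of the deformation of the boundary is extended to a deformation of [b], again in
   reversed time. *)
have [|||g [cg gs g1 _]] := @conic_fill R _ _ _ (conic_box (fun=> 0) (fun=> 1 : R)) Y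
    (fun x : 'rV[R]_k.+1 * R => f (a_ (x.1, 1 - x.2))) b.
- apply: cont_on_cts.
  apply: (cont_on_comp ca_ (f := fun x : 'rV[R]_k.+1 * R => (x.1, 1 - x.2))).
    apply: cont_on_pair; first exact: cont_on_fst.
    by apply: cont_on_subr; [exact: cont_on_cst|exact: cont_on_snd].
  by move=> [s u] [/= ds Iu]; split=> //=; exact: I01C.
- exact: cb.
- by move=> s ds; rewrite /= subrr a_0// ab.
pose b_ (x : 'rV[R]_k.+1 * R) := g (x.1, 1 - x.2).
have cb_ : cont_on (ubox k.+1 `*` I) b_.
  apply: (cont_on_comp cg (f := fun x : 'rV[R]_k.+1 * R => (x.1, 1 - x.2))).
    apply: cont_on_pair; first exact: cont_on_fst.
    by apply: cont_on_subr; [exact: cont_on_cst|exact: cont_on_snd].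
  by move=> [s u] [/= Ks Iu]; split=> //=; exact: I01C.
have ab_ s u : ubdry k.+1 s -> I u -> b_ (s, u) = f (a_ (s, u)).
  move=> ds Iu; rewrite /b_ /= gs//; last exact: I01C.
  by rewrite /= (_ : 1 - (1 - u) = u)//; ring.
have S1 : csolvable (fun s => a_ (s, 1)) (fun s => b_ (s, 1)).
  apply: (@weq_solvable_face k (a 0)).
  - apply: (cont_on_comp ca_ (f := fun s : 'rV[R]_k.+1 => (s, 1 : R))) => [|s Ks]; last by split.
    by apply: cont_on_pair; [exact: cont_on_id|exact: cont_on_cst].
  - apply: (cont_on_comp cb_ (f := fun s : 'rV[R]_k.+1 => (s, 1 : R))) => [|s Ks]; last by split.
    by apply: cont_on_pair; [exact: cont_on_id|exact: cont_on_cst].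
  - by move=> s ds; exact: ab_.
  - by move=> s Ks H; apply: a_1; split.
apply: solvable_ext (csolvable_homotopic ca_ cb_ ab_ S1) => //.
- by move=> s t ds It; rewrite /= a_0.
- by move=> s Ks; rewrite /b_ /= subr0 g1.
Qed.

(** Flat sides are discarded: over the remaining directions [D], the affine maps [phi] and [psi]
    identify the box and its relative boundary with the unit cube of dimension [d] and its
    boundary. *)
Lemma weq_lifts : lifts R f setT.
Proof.
split=> [y _|k p q a G b pq].
  by have [[_ surj] _] := wf; have [x _] := surj y; exists x.
pose D := [set i | p i < q i]%SET; pose d := #|D|.
pose e (j : 'I_d) : 'I_k := enum_val j.
have eD j : p (e j) < q (e j) by have := enum_valP j; rewrite inE.
have einj : injective e by exact: enum_val_inj.
have esurj i : p i < q i -> exists j, e j = i.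
  move=> lt; have iD : i \in D by rewrite inE.
  by exists (enum_rank_in iD i); rewrite /e enum_rankK_in.
pose psi (s : 'rV[R]_k) : 'rV[R]_d := \row_j ((s ord0 (e j) - p (e j)) / (q (e j) - p (e j))).
pose phi (r : 'rV[R]_d) : 'rV[R]_k :=
  \row_i (p i + \sum_(j | e j == i) (q i - p i) * r ord0 j).
have phiE r j : phi r ord0 (e j) = p (e j) + (q (e j) - p (e j)) * r ord0 j.
  by rewrite mxE (big_pred1 j)// => j' /=; rewrite (inj_eq einj).
have phi0 r i : p i = q i -> phi r ord0 i = p i.
  by move=> E; rewrite mxE E subrr big1 ?addr0// => j _; rewrite mul0r.
have cphi (V : set 'rV[R]_d) : cont_on V phi.
  apply: cont_on_row => i.
  apply: (@cont_on_ext _ _ _ (fun r : 'rV[R]_d => p i + \sum_(j | e j == i) (q i - p i) * r ord0 j)).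
    by move=> r _; rewrite mxE.
  apply: cont_on_add; first exact: cont_on_cst.
  apply: cont_on_sum => j _; apply: cont_on_mul; first exact: cont_on_cst.
  by apply: cont_on_coord; exact: cont_on_id.
have cpsi (V : set 'rV[R]_k) : cont_on V psi.
  apply: cont_on_row => j.
  apply: (@cont_on_ext _ _ _ (fun s : 'rV[R]_k => (s ord0 (e j) - p (e j)) / (q (e j) - p (e j)))).
    by move=> s _; rewrite mxE.
  apply: cont_on_mul; last exact: cont_on_cst.
  apply: cont_on_subr; last exact: cont_on_cst.
  by apply: cont_on_coord; exact: cont_on_id.
have cases i : p i = q i \/ exists j, e j = i.
  have := pq i; rewrite le_eqVlt => /orP[/eqP|/esurj]; by [left|right].
have phiK r : ubox d r -> box p q (phi r).
  move=> Kr i; have [E|[j <-]] := cases i; first by rewrite phi0// lexx pq.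
  rewrite phiE; have /andP[r0 r1] := Kr j; have := eD j => lt.
  by apply/andP; split; nra.
have phid r : ubdry d r -> bdry p q (phi r).
  move=> /ubdryE[Kr [j H]]; split; first exact: phiK.
  exists (e j); split; first exact: eD.
  by rewrite phiE; case: H => ->; [left; ring|right; ring].
have psiK s : box p q s -> ubox d (psi s).
  move=> Ks j; rewrite mxE; have /andP[h0 h1] := Ks (e j); have lt := eD j.
  have lt' : 0 < q (e j) - p (e j) by rewrite subr_gt0.
  by rewrite divr_ge0 ?subr_ge0 ?(ltW lt)//= ler_pdivrMr// mul1r lerD2r.
have psid s : bdry p q s -> ubdry d (psi s).
  move=> [Ks [i [lt H]]]; apply/ubdryE; split; first exact: psiK.
  have [j E] := esurj i lt; exists j; rewrite mxE E; case: H => ->.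
    by left; rewrite subrr mul0r.
  by right; rewrite divff// subr_eq0 gt_eqF.
have phipsi s : box p q s -> phi (psi s) = s.
  move=> Ks; apply/rowP => i; have [E|[j <-]] := cases i.
    by rewrite phi0//; have /andP[h0 h1] := Ks i; apply/eqP; rewrite eq_le h0 E h1.
  rewrite phiE mxE mulrC mulfVK ?subr_eq0; first by ring.
  by rewrite gt_eqF.
apply: (solvable_transport (K' := ubox d) (dK' := ubdry d) (cphi _) (cpsi _)) => //.
- by move=> w [].
- by move=> w [].
- move=> {}a {}G {}b; apply: (solvable_const cf (conic_box _ _)).
  move=> {}a {}G {}b [ca cG cb Gab _] Gc.
  apply: solvable_ext (weq_solvable_cube ca cb _) => //.
    by move=> s t ds It; rewrite Gc.
  by move=> s ds; rewrite -(Gab s ds).2 Gc.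
Qed.

End WeqLifts.

(** * Simplicial replacements *)

Section Coproduct.
Context {R : realType} {J : choiceType} (A C : J -> topologicalType).
Variable eta : forall j, continuousType (A j) (C j).
Local Notation I := (@I01 R).
Local Notation sA := {j : J & A j}.
Local Notation sC := {j : J & C j}.

Definition coproduct_map (u : sA) : sC := existT C (projT1 u) (eta (projT1 u) (projT2 u)).

Lemma coproduct_map_continuous : continuous coproduct_map.
Proof.
case=> j x; apply: (@sigT_continuous J A sC (fun j x => existT C j (eta j x))) => j'.
apply: cont_onT; apply: (cont_on_comp_continuous (@existT_continuous _ C j')).
by apply: cont_on_continuous; exact: cts_fun.
Qed.

Section Component.
Variable (T : J -> topologicalType) (j : J) (d : T j).
Local Notation sT := {j : J & T j}.

(** Projection to one summand, made total by the default [d]; it is continuous because it is so on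
    each summand. *)
Definition component (u : sT) : T j :=
  match pselect (projT1 u = j) with
  | left E => eq_rect _ (fun j => T j : Type) (projT2 u) _ E | right _ => d end.

Lemma component_existT (x : T j) : component (existT T j x) = x.
Proof.
by rewrite /component; case: pselect => //= E; rewrite (Prop_irrelevance E erefl).
Qed.

Lemma existT_component (u : sT) : projT1 u = j -> existT T j (component u) = u.
Proof. by case: u => j' x /= E; subst j'; rewrite component_existT. Qed.

Lemma component_continuous : continuous component.
Proof.
case=> j' x'; apply: (@sigT_continuous J T (T j) (fun j' x => component (existT T j' x))) => i.
have [E|ne] := pselect (i = j).
  subst i; apply: cont_onT; apply: (@cont_on_ext _ _ _ id); last exact: cont_on_id.
  by move=> x _; rewrite component_existT.
apply: cont_onT; apply: (@cont_on_ext _ _ _ (fun=> d)); last exact: cont_on_cst.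
by move=> x _; rewrite /component; case: pselect.
Qed.

Lemma sigT_clopen (P : J -> Prop) : clopen [set u : sT | P (projT1 u)].
Proof.
have H (Q : J -> Prop) : open [set u : sT | Q (projT1 u)].
  apply/sigT_openP => i; have [Qi|nQi] := pselect (Q i).
    rewrite (_ : _ @^-1` _ = setT); first exact: openT.
    by apply/seteqP; split.
  rewrite (_ : _ @^-1` _ = set0); first exact: open0.
  by apply/seteqP; split.
by split; [exact: H|rewrite -openC; exact: (H (fun i => ~ P i))].
Qed.

Lemma path_component (g : R -> sT) : cont_on I g -> forall t, I t -> projT1 (g t) = projT1 (g 0).
Proof.
move=> cg; pose P := [set u : sT | projT1 u = projT1 (g 0)].
have [oP cP] : clopen P by exact: (sigT_clopen (fun i => i = projT1 (g 0))).
have cI : connected I.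
  rewrite (_ : I = `[0, 1]%classic); first exact: segment_connected.
  by apply/seteqP; split=> t; rewrite /= in_itv.
have E : I `&` g @^-1` P = I.
  apply: cI.
  - by exists 0; split=> //; exact: I0_I01.
  - exists (~` (I `&` g @^-1` (~` P))).
      apply: closed_openC; apply: cont_on_closed => //; first exact: closed_I01.
      exact: open_closedC.
    apply/seteqP; split=> t [It H]; split=> //.
      by move=> [_]; apply.
    by apply: contrapT => nP; apply: H; split.
  - exists (I `&` g @^-1` P); last by rewrite setIA setIid.
    by apply: cont_on_closed => //; exact: closed_I01.
by move=> t; rewrite -{1}E => -[].
Qed.

End Component.

(** A box is connected, and so is every path of the homotopy, which ends on a value of [b]. The
    problem thus takes place in the summand of [b] at one corner, which satisfies [P]. *)
Lemma lifts_coproduct (P : J -> Prop) : (forall j, lifts R (eta j) setT) ->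
  lifts R coproduct_map [set u | P (projT1 u)].
Proof.
move=> L; split=> [[j y] _|k p q a G b pq [ca cG cb Gab [GB bB]]].
  by have [x _] := (L j).1 y Logic.I; exists (existT A j x).
pose s0 : 'rV[R]_k := \row_i p i.
have K0 : box p q s0 by move=> i; rewrite mxE lexx pq.
have i0 := @I0_I01 R; have i1 := @I1_I01 R.
case E0 : (b s0) => [j y0]; have Pj : P j by have := bB _ K0; rewrite E0.
have [x0 _] := (L j).1 y0 Logic.I.
have bj s : box p q s -> projT1 (b s) = j.
  move=> Ks; pose g (t : R) := b (\row_i (p i + t * (s ord0 i - p i))).
  have gK t : I t -> box p q (\row_i (p i + t * (s ord0 i - p i))).
    move=> /andP[t0 t1] i; rewrite mxE; have /andP[h0 h1] := Ks i.
    by apply/andP; split; nra.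
  have cg : cont_on I g.
    apply: (cont_on_comp cb (f := fun t : R => \row_i (p i + t * (s ord0 i - p i)))) => //.
    apply: cont_on_row => i; apply: (@cont_on_ext _ _ _ (fun t : R => p i + t * (s ord0 i - p i))).
      by move=> t _; rewrite mxE.
    apply: cont_on_add; first exact: cont_on_cst.
    by apply: cont_on_mul; [exact: cont_on_id|exact: cont_on_cst].
  have := path_component cg i1; rewrite /g.
  have -> : (\row_i (p i + 1 * (s ord0 i - p i))) = s.
    by apply/rowP => i; rewrite mxE; ring.
  have -> : (\row_i (p i + 0 * (s ord0 i - p i))) = s0.
    by apply/rowP => i; rewrite !mxE; ring.
  by rewrite E0.
have bK : bdry p q `<=` box p q by move=> s [].
have Gj s t : bdry p q s -> I t -> projT1 (G (s, t)) = j.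
  move=> ds It; have cg : cont_on I (fun t => G (s, t)).
    apply: (cont_on_comp cG (f := fun t : R => (s, t))) => [|u Iu]; last by split.
    by apply: cont_on_pair; [exact: cont_on_cst|exact: cont_on_id].
  rewrite (path_component cg It) -(path_component cg i1) (Gab s ds).2.
  exact: bj (bK s ds).
have aj s : bdry p q s -> projT1 (a s) = j.
  by move=> ds; rewrite -(Gj s 0 ds i0) (Gab s ds).1.
have eta_comp u : projT1 u = j ->
    component y0 (coproduct_map u) = eta j (component x0 u).
  by case: u => i x /= E; subst i; rewrite !component_existT.
have [|a' [G' [h1 h2 h3 h4 _]]] := (L j).2 k p q (fun s => component x0 (a s))
    (fun x => component y0 (G x)) (fun s => component y0 (b s)) pq.
  split=> //.
  - by apply: cont_on_comp_continuous ca; exact: component_continuous.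
  - by apply: cont_on_comp_continuous cG; exact: component_continuous.
  - by apply: cont_on_comp_continuous cb; exact: component_continuous.
  - move=> s ds; have [-> ->] := Gab s ds; split=> //.
    by rewrite eta_comp//; exact: aj.
exists (fun s => existT A j (a' s)), (fun x => existT C j (G' x)); split.
- by apply: cont_on_comp_continuous h1; exact: existT_continuous.
- by apply: cont_on_comp_continuous h2; exact: existT_continuous.
- move=> s ds; have [-> E] := h3 s ds; split; first by rewrite existT_component// aj.
  by move=> t It; rewrite E// existT_component// Gj.
- move=> s Ks; have [-> ->] := h4 s Ks.
  by split=> //; rewrite existT_component// bj.
- by move=> s t Ks It.
Qed.

End Coproduct.

Section SimplicialReplacementMap.
Context {R : realType} (I : small_category) (D E : diagram I).

Lemma collapse0 m i : collapse m i ord0 = ord0.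
Proof. exact: val_inj. Qed.

(** A collapse fixes the first vertex, so it acts on the point lying there by an identity: only the
    chain can change. *)
Lemma chain_pull_collapse (G : diagram I) m i (u : srep_space G m) :
  srep_act G (collapse m i) u = u <-> chain_pull (collapse m i) (projT1 u) = projT1 u.
Proof.
split=> [/(congr1 (@projT1 _ _))//|]; case: u => c x /= Ec.
change (srep_act_fun (collapse m i) (srep_pt (c := c) x) = srep_pt (c := c) x).
rewrite /srep_act_fun /=.
(* The type of the point depends on the chain being rewritten, so the equality is stated in the sum
   over all objects and brought back at the end. *)
have key (j : 'I_m.+1) : j = ord0 ->
    existT (fun l : I => G l : Type) (vertex (c : chain I m) j) (dmap G (from_start c j) x) =
    existT (fun l : I => G l : Type) (vertex (c : chain I m) ord0) x.
  by move=> ->; rewrite /from_start edge_id dmap_id.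
have := key _ (collapse0 m i).
move: (dmap G _ x); change (vertex (c : chain I m) (collapse m i ord0)) with
  (vertex (chain_pull (collapse m i) c) ord0).
rewrite Ec => x' H; congr (srep_pt (c := c) _).
exact: (inj_pair2_eq_dec _ (fun a b => pselect (a = b)) _ _ _ _ H).
Qed.

Lemma srep_clopen (G : diagram I) m i : (i < m)%N ->
  clopen [set u | sact (simplicial_replacement G) (collapse m i) u = u].
Proof.
move=> _; have -> : [set u | sact (simplicial_replacement G) (collapse m i) u = u] =
    [set u : srep_space G m | chain_pull (collapse m i) (projT1 u) = projT1 u].
  by apply/seteqP; split=> u /= /chain_pull_collapse.
exact: (@sigT_clopen {classic chain I m} (fun c => G (vertex (c : chain I m) ord0))
  (fun c => chain_pull (collapse m i) c = c)).
Qed.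

Lemma nondeg_chain (G : diagram I) m : [set u | @nondeg (simplicial_replacement G) m u] =
  [set u : srep_space G m | forall i, (i < m)%N ->
     chain_pull (collapse m i) (projT1 u) <> projT1 u].
Proof.
by apply/seteqP; split=> u H i im => [/chain_pull_collapse|/chain_pull_collapse]; exact: H.
Qed.

Variable eta : forall i : I, continuousType (D i) (E i).
Hypothesis eta_nat : forall (i j : I) (g : Defs.hom i j) (x : D i),
  dmap E g (eta i x) = eta j (dmap D g x).

Definition srep_map m : continuousType (srep_space D m) (srep_space E m) :=
  mkcts (@coproduct_map_continuous {classic chain I m}
    (fun c => D (vertex (c : chain I m) ord0)) (fun c => E (vertex (c : chain I m) ord0))
    (fun c => eta (vertex (c : chain I m) ord0))).

Lemma srep_map_natural m n (a : ord_map m n) (u : srep_space D n) :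
  srep_map m (srep_act D a u) = srep_act E a (srep_map n u).
Proof.
case: u => c x; rewrite /srep_map /= /mkcts /coproduct_map /srep_act_fun /srep_pt /=.
by congr existT; rewrite eta_nat.
Qed.

(** Chains index the summands and decide degeneracy. So degenerate elements form unions of summands,
    which are clopen and respected by [srep_map], and on the nondegenerate summands the map is a
    coproduct of components of [eta]. *)
Lemma realize_srep_map : (forall i, weak_homotopy_equivalence R (eta i)) ->
  exists f : continuousType (realization R (simplicial_replacement D))
    (realization R (simplicial_replacement E)), weak_homotopy_equivalence R f.
Proof.
move=> w; pose X := simplicial_replacement D; pose Y := simplicial_replacement E.
have F_nat m n (a : ord_map m n) (x : X n) :
    srep_map m (sact X a x) = sact Y a (srep_map n x) by exact: srep_map_natural.
have F_deg m i (x : X m) : (i < m)%N ->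
    sact Y (collapse m i) (srep_map m x) = srep_map m x -> sact X (collapse m i) x = x.
  by move=> _ /chain_pull_collapse H; apply/chain_pull_collapse.
have F_lifts n : lifts R (srep_map n) [set y | @nondeg Y n y].
  rewrite nondeg_chain.
  apply: (@lifts_coproduct R {classic chain I n} _ _ _ (fun c => forall i, (i < n)%N ->
    chain_pull (collapse n i) c <> c)) => c.
  exact: weq_lifts.
exists (mkcts (@realmap_continuous R X Y srep_map F_nat)).
apply: lifts_weak_equivalence.
apply: (@lifts_realmap R X Y srep_map F_nat _ _ F_deg F_lifts) => m i im; exact: srep_clopen.
Qed.

End SimplicialReplacementMap.

Theorem theoremA8 (R : realType) (I : small_category) (D : diagram I)
    (Q : cofibrant_replacement (Top_Quillen R)) :
  same_weak_homotopy_type R (hocolim R Q D) (hocolim_Strom R D).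
Proof.
rewrite hocolim_StromE; apply: rst_step.
apply: (@realize_srep_map R I (post_comp Q D) D (fun i => crep_map Q (D i))).
  move=> i j g x; have := crep_natural Q (dmap D g).
  by move=> /(congr1 (fun h : continuousType _ _ => h x)) /= ->.
by move=> i; exact: (crep_weq Q (D i)).
Qed.
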